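(* Let $\lambda^+(t,X,Y)$ and $\lambda^-(t,X,Y)$, $t\ge 0$, $X,Y\in\mathcal X$, be Borel measurable, non-negative, bounded functions which are continuous in all variables, and let $\Lambda^\pm[t,X,\mu]=\int_{\mathcal X}\lambda^\pm(t,X,Y)\,\mu(dY)$ for $t\ge0$, $X\in\mathcal X$ and any probability measure $\mu$ on $\mathcal X$. For $t\ge 0$, $X',X\in\mathcal X$ with $X=(k,x,y)$, and a probability measure $\mu$ on $\mathcal X$, put $$L[t,X',\mu]g(X)=\Lambda^+[t,X',\mu]\,(g(X^+)-g(X))+1(k>0)\,\Lambda^-[t,X',\mu]\,(g(X^-)-g(X))+\frac{\partial}{\partial x}g(k,x,y)+1(k>0)\frac{\partial}{\partial y}g(k,x,y).$$ Then: (1) For any initial probability distribution $\mu_0$ on $\mathcal X$, on some probability space there exists a Markov process $(X_t,\ t\ge 0)$ with values in $\mathcal X$, with marginal distributions $\mu_t$ (i.e. $\mu_t$ is the distribution of $X_t$ for every $t\ge 0$, and in particular $X_0$ has distribution $\mu_0$) and with intensities of upward and downward jumps $\Lambda^+[t,X_t,\mu_t]$ and $\Lambda^-[t,X_t,\mu_t]$; in other words, such that for any bounded continuous function $g$ on $\mathcal X$ with bounded continuous derivatives in $(x,y)$, the process $$M_t=g(X_t)-g(X_0)-\int_0^t L[s,X_s,\mu_s]g(X_s)\,ds,\qquad t\ge 0,$$ is a martingale. (2) Moreover, for any given measurable function $(m_s,\ s\ge 0)$ with values in the probability measures on $\mathcal X$, and for any given initial distribution on $\mathcal X$, the martingale problem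 requiring that $$g(X_t)-g(X_0)-\int_0^t L[s,X_s,m_s]g(X_s)\,ds,\qquad t\ge 0,$$ be a martingale for every bounded continuous $g$ on $\mathcal X$ with bounded continuous derivatives in $(x,y)$ (where $m_s$ is not required to be the distribution of $X_s$) has a weakly unique solution, i.e. a solution that is unique in distribution.
   Context: State space: $\mathcal X=\{(0,x): x\ge 0\}\cup\bigcup_{k=1}^\infty\{(k,x,y): x,y\ge 0\}$. Here $k$ is the number of customers in a single-server queue, $x$ is the time elapsed since the last arrival, and $y$ is the elapsed time of the current service. The notation $(0,x,y)$ is also used, with $y$ a false variable: all triples $(0,x,y)$, for any $y$, are identified with $(0,x)$, so functions on $\mathcal X$ do not depend on $y$ when $k=0$; the representative $(0,x,0)$ is used in formulas that need a value of $y$. The space $\mathcal X$ carries the metric $\rho(X,X')=|k-k'|+|x-x'|+|y-y'|$ for $X=(k,x,y)$, $X'=(k',x',y')$, and the corresponding Borel sigma-algebra; continuity is with respect to this metric. For $X=(k,x,y)$: $X^+=(k+1,0,y)$ for $k\ge 0$ (so $(0,x)^+=(1,0,0)$), and $X^-=(k-1,x,0)$ for $k\ge 1$ (so $(1,x,y)^-=(0,x)$). $X^-$ is not defined for $k=0$, and the term containing it in $L$ is then absent, by the factor $1(k>0)$. $1(\cdot)$ denotes the indicator. ''Derivatives in $(x,y)$'' means the partial derivatives in $x$ and $y$ for $k\ge 1$ and the derivative in $x$ for $k=0$ (one-sided at the boundary). Processes are càdlàg and $\mathcal X$-valued, with finitely many jumps on bounded time intervals. The process with the stated intensities is piecewise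 linear: between any two subsequent jumps the continuous components ($(x,y)$ if $k>0$, just $x$ if $k=0$) grow linearly with rate $1$ while $k$ remains unchanged; jumps take $X$ to $X^+$ or $X^-$. Martingales are with respect to the natural filtration of $(X_t)$. Markov processes may be time-inhomogeneous. *)

(* Defs.v *)
From HB Require Import structures.
From mathcomp Require Import all_boot all_order all_algebra.
From mathcomp Require Import all_classical all_reals all_analysis.

Set Implicit Arguments.
Unset Strict Implicit.
Unset Printing Implicit Defensive.

Import Order.TTheory GRing.Theory Num.Theory.
Import numFieldTopology.Exports.
Import numFieldNormedType.Exports.

Local Open Scope classical_set_scope.
Local Open Scope ring_scope.

(* The triples (0, x, y) are all identified with (0, x): each class is stored
   through its representative (0, x, 0). *)
Definition is_state (R : realType) (p : nat * R * R) : bool :=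
  [&& 0 <= p.1.2, 0 <= p.2 & (p.1.1 == 0%N) ==> (p.2 == 0)].

Record state (R : realType) :=
  State { state_val : nat * R * R; state_valP : is_state state_val }.

HB.instance Definition _ (R : realType) := [isSub for @state_val R].
HB.instance Definition _ (R : realType) := [Choice of state R by <:].

Definition st_k (R : realType) (X : state R) : nat := (val X).1.1.
Definition st_x (R : realType) (X : state R) : R := (val X).1.2.
Definition st_y (R : realType) (X : state R) : R := (val X).2.

Lemma mkstate_subproof (R : realType) (k : nat) (x y : R) :
  is_state (k, Num.max 0 x, if k == 0%N then 0 else Num.max 0 y).
Proof.
by rewrite /is_state /= le_max lexx; case: eqP => _ /=;
  rewrite ?le_max ?lexx ?eqxx.
Qed.

(* The point (k, x, y), meant for x, y >= 0; y is a false variable if k = 0.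
   The truncation of negative arguments only makes the function total. *)
Definition mkstate (R : realType) (k : nat) (x y : R) : state R :=
  State (mkstate_subproof k x y).

HB.instance Definition _ (R : realType) :=
  isPointed.Build (state R) (mkstate 0 0 0).

Definition state_dist (R : realType) (X X' : state R) : R :=
  `|(st_k X)%:R - (st_k X')%:R| + `|st_x X - st_x X'| + `|st_y X - st_y X'|.

Lemma state_distxx (R : realType) (X : state R) : state_dist X X = 0.
Proof. by rewrite /state_dist !subrr normr0 !addr0. Qed.

Lemma state_dist_eq0 (R : realType) (X X' : state R) :
  state_dist X X' = 0 -> X = X'.
Proof.
move=> /eqP; rewrite /state_dist !paddr_eq0 ?addr_ge0 //.
rewrite !normr_eq0 !subr_eq0 eqr_nat => /andP[/andP[/eqP ek /eqP ex] /eqP ey].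
apply: val_inj; move: ek ex ey; rewrite /st_k /st_x /st_y.
by case: (val X) (val X') => [[k x] y] [[k' x'] y'] /= -> -> ->.
Qed.

Lemma state_distC (R : realType) (X X' : state R) :
  state_dist X X' = state_dist X' X.
Proof.
by rewrite /state_dist (distrC (st_k X)%:R) (distrC (st_x X))
  (distrC (st_y X)).
Qed.

Lemma state_dist_triangle (R : realType) (Y X Z : state R) :
  state_dist X Z <= state_dist X Y + state_dist Y Z.
Proof.
rewrite /state_dist addrACA (addrACA `|_ - _| `|_ - _|).
by rewrite !lerD // ler_distD.
Qed.

HB.instance Definition _ (R : realType) := isMetric.Build R (state R)
  (@state_distxx R) (@state_dist_eq0 R) (@state_distC R)
  (@state_dist_triangle R).

Section state_borel.
Variable R : realType.

Let state_opens : set_system (state R) := @open (state R).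

Let borel0 : <<s state_opens >> set0.
Proof. exact: sigma_algebra0. Qed.

Let borelC A : <<s state_opens >> A -> <<s state_opens >> (~` A).
Proof. exact: sigma_algebraC. Qed.

Let borel_bigcup (F : (set (state R))^nat) :
  (forall i, <<s state_opens >> (F i)) -> <<s state_opens >> (\bigcup_i F i).
Proof. exact: sigma_algebra_bigcup. Qed.

HB.instance Definition _ := @isMeasurable.Build
  (sigma_display (@open (state R))) (state R)
  <<s state_opens >> borel0 borelC borel_bigcup.

End state_borel.

Definition st_up (R : realType) (X : state R) : state R :=
  mkstate (st_k X).+1 0 (st_y X).

(* X^- is only meaningful for k > 0; the value at k = 0 is junk, always
   multiplied by 1(k > 0). *)
Definition st_down (R : realType) (X : state R) : state R :=
  mkstate (st_k X).-1 (st_x X) 0.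

Section generator.
Variable R : realType.
Implicit Types (g : state R -> R) (X : state R) (mu : probability (state R) R).

Definition quot_x g X (h : R) : R :=
  h^-1 * (g (mkstate (st_k X) (st_x X + h) (st_y X)) - g X).

Definition quot_y g X (h : R) : R :=
  h^-1 * (g (mkstate (st_k X) (st_x X) (st_y X + h)) - g X).

(* Nonzero increments h -> 0 with a + h >= 0: two-sided for a > 0,
   one-sided at the boundary a = 0. *)
Definition increments (a : R) : set_system R :=
  within [set h | 0 <= a + h] (0 : R)^'.

Definition pdx g X : R := lim (quot_x g X @ increments (st_x X)).
Definition pdy g X : R := lim (quot_y g X @ increments (st_y X)).

Definition bounded_on (A : set (state R)) (f : state R -> R) : Prop :=
  exists C : R, forall X, A X -> `|f X| <= C.

Definition busy : set (state R) := [set X | (0 < st_k X)%N].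

Record test_function g : Prop := {
  test_bounded : bounded_on setT g ;
  test_continuous : continuous g ;
  test_derivable_x : forall X, cvg (quot_x g X @ increments (st_x X)) ;
  test_pdx_bounded : bounded_on setT (pdx g) ;
  test_pdx_continuous : continuous (pdx g) ;
  test_derivable_y : forall X, busy X -> cvg (quot_y g X @ increments (st_y X)) ;
  test_pdy_bounded : bounded_on busy (pdy g) ;
  test_pdy_continuous : {within busy, continuous (pdy g)} }.

(* Only the values of lam at times t >= 0 matter. *)
Record rate_function (lam : R -> state R -> state R -> R) : Prop := {
  rate_measurable : measurable_fun [set p : R * state R * state R | 0 <= p.1.1]
    (fun p => lam p.1.1 p.1.2 p.2) ;
  rate_ge0 : forall (t : R) X Y, 0 <= t -> 0 <= lam t X Y ;
  rate_bounded : exists C : R, forall (t : R) X Y, 0 <= t -> lam t X Y <= C ;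
  rate_continuous :
    {within [set p : R * state R * state R | 0 <= p.1.1],
      continuous (fun p => lam p.1.1 p.1.2 p.2)} }.

Definition Lambda (lam : R -> state R -> state R -> R) (t : R) X mu : R :=
  \int[mu]_Y lam t X Y.

Definition generator (lamp lamm : R -> state R -> state R -> R)
    (t : R) X' mu g X : R :=
  Lambda lamp t X' mu * (g (st_up X) - g X)
  + (0 < st_k X)%N%:R * (Lambda lamm t X' mu * (g (st_down X) - g X))
  + pdx g X + (0 < st_k X)%N%:R * pdy g X.

End generator.

Section paths.
Variable R : realType.
Implicit Type w : R -> state R.

Definition cadlag w : Prop :=
  (forall t : R, 0 <= t -> w @ t^'+ --> w t) /\
  (forall t : R, 0 < t -> exists Z : state R, w @ t^'- --> Z).

Definition jump_time w (t : R) : Prop := 0 < t /\ ~ (w @ t^'- --> w t).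

Definition admissible_path w : Prop :=
  cadlag w /\ forall t : R, finite_set [set s | s <= t /\ jump_time w s].

Definition flow (X : state R) (h : R) : state R :=
  mkstate (st_k X) (st_x X + h) (st_y X + h).

Definition piecewise_linear w : Prop :=
  (forall s t : R, 0 <= s -> s <= t ->
    (forall u : R, s < u -> u <= t -> ~ jump_time w u) ->
    w t = flow (w s) (t - s)) /\
  (forall t : R, jump_time w t -> exists2 Z : state R, w @ t^'- --> Z &
    w t = st_up Z \/ (0 < st_k Z)%N /\ w t = st_down Z).

(* The sigma-algebra generated by the coordinates w t, t >= 0. *)
Definition path_sigma_algebra : set_system (R -> state R) :=
  <<s [set B | exists (t : R) (A : set (state R)), [/\ 0 <= t, measurable A & B = [set w | A (w t)]]] >>.

End paths.

Section processes.
Context (R : realType) (d : measure_display) (Om : measurableType d)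
  (P : probability Om R).

Definition measurable_wrt (G : set_system Om) (W : Om -> R) : Prop :=
  forall B, measurable B -> G (W @^-1` B).

(* W is a version of E[Z | G], for Z integrable and G a sub-sigma-algebra. *)
Definition is_cond_exp (G : set_system Om) (Z W : Om -> R) : Prop :=
  [/\ measurable_wrt G W,
      P.-integrable setT (EFin \o W) &
      forall A, G A ->
        (\int[P]_(o in A) (W o)%:E = \int[P]_(o in A) (Z o)%:E)%E].

Definition martingale (F : R -> set_system Om) (M : R -> Om -> R) : Prop :=
  (forall t : R, 0 <= t ->
    measurable_wrt (F t) (M t) /\ P.-integrable setT (EFin \o M t)) /\
  (forall s t : R, 0 <= s -> s <= t -> is_cond_exp (F s) (M t) (M s)).

(* Processes are indexed by R, but only times t >= 0 are ever considered. *)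
Variable X : R -> {mfun Om >-> state R}.

Definition natural_filtration (t : R) : set_system Om :=
  <<s \bigcup_(s in `[0, t]) g_sigma_algebra_preimage (X s) >>.

Definition admissible_process : Prop :=
  forall o, admissible_path (fun t => X t o).

(* P(X_t \in A | F_s) = P(X_t \in A | X_s) almost surely. *)
Definition markov_process : Prop :=
  forall (s t : R) (A : set (state R)), 0 <= s -> s <= t -> measurable A ->
    exists2 W : Om -> R, is_cond_exp (g_sigma_algebra_preimage (X s)) (\1_A \o X t) W
             & is_cond_exp (natural_filtration s) (\1_A \o X t) W.

Definition initial_law (mu0 : probability (state R) R) : Prop :=
  forall A, measurable A -> distribution P (X 0) A = mu0 A.

Definition dynkin_process (lamp lamm : R -> state R -> state R -> R)
    (m : R -> probability (state R) R) (g : state R -> R)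
    (t : R) (o : Om) : R :=
  g (X t o) - g (X 0 o)
  - \int[lebesgue_measure]_(s in `[0, t])
      generator lamp lamm s (X s o) (m s) g (X s o).

Definition martingale_problem (lamp lamm : R -> state R -> state R -> R)
    (m : R -> probability (state R) R) : Prop :=
  forall g, test_function g ->
    martingale natural_filtration (dynkin_process lamp lamm m g).

Definition solution (lamp lamm : R -> state R -> state R -> R)
    (m : R -> probability (state R) R) (mu0 : probability (state R) R) : Prop :=
  [/\ admissible_process, initial_law mu0 & martingale_problem lamp lamm m].

End processes.

Definition same_law (R : realType)
    (d1 : measure_display) (Om1 : measurableType d1) (P1 : probability Om1 R)
    (X1 : R -> {mfun Om1 >-> state R})
    (d2 : measure_display) (Om2 : measurableType d2) (P2 : probability Om2 R)
    (X2 : R -> {mfun Om2 >-> state R}) : Prop :=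
  forall B, path_sigma_algebra B ->
    P1 [set o | B (fun t => X1 t o)] = P2 [set o | B (fun t => X2 t o)].

(* Main.v *)
(** The jump rates are dominated by a constant [c]. For a given flow of laws [m],
    put potential jumps at the points of a Poisson process of rate [c] and keep
    some of them, with the probabilities prescribed by the rates, as actual
    jumps; the noise is built on [0, 1] by splitting binary digits. Conditioning
    on the first potential jump turns the Markov property and Dynkin's formula
    into the assertion that a bounded quantity [D] vanishes because
    [|D| <= q * sup |D|] with [q < 1].

    Conversely, let [X] solve the martingale problem. Testing with the functions
    [1(k = j) exp (- a x - b y)], which determine laws on the state space, shows
    that the law of [X t] on an event [B] of the past of [s <= t] is obtained by
    looking back at the last potential jump: flow from [X s] if there is none in
    [(s, t]], and thin [X (t - v)] and then flow during [v] if it is at [t - v].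
    Hence, if the rates of two solutions differ by at most [A exp (K r)] at time
    [r], then their laws at time [r] differ by at most [C A exp (K r)], where [C]
    is small for [K] large. With [A = 0] this is uniqueness in law; with rates
    computed from two flows of laws it makes the map from [m] to the flow of laws
    of the solution a contraction, and its fixed point is the required process. *)
Require Import Defs.
From HB Require Import structures.
From mathcomp Require Import all_boot all_order all_algebra.
From mathcomp Require Import all_classical all_reals all_analysis.
From mathcomp Require Import measurable_realfun ring lra.
Import Order.TTheory GRing.Theory Num.Theory.
Import numFieldTopology.Exports.
Import numFieldNormedType.Exports.
Local Open Scope classical_set_scope.
Local Open Scope ring_scope.
Set Implicit Arguments.
Unset Strict Implicit.
Unset Printing Implicit Defensive.

(** * Expectations of bounded measurable functions *)

(** A solution of the martingale problem is given without any noise and is not known to be Markov,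
    so it cannot be followed forward from jump to jump. This is why the backward formula is proved
    on an arbitrary event of the past, and why events of the pasts of two solutions are carried
    along until all finite-dimensional laws agree. The dominating rate [c] makes the waiting times
    independent of states and rates, so processes with different rates can be compared on the same
    potential jump. Exponentials serve because the transport part of the generator multiplies them
    by a constant: the forward equation becomes a scalar linear one, solved by an exponential weight
    and Fubini without differentiating in time. The weight [exp (K r)] makes the constants small on
    the whole half-line at once, so no short time intervals have to be glued. Since admissibility is
    required of every path, and not of almost every one, the noise is modified on a null set. *)

Lemma contraction_bound (R : realType) (I : Type) (P : I -> Prop)
    (f w : I -> R) (q e D0 : R) :
  0 <= q < 1 -> 0 <= e -> 0 <= D0 ->
  (forall D, 0 <= D -> (forall i, P i -> f i <= D * w i) ->
     forall i, P i -> f i <= (q * D + e) * w i) ->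
  (forall i, P i -> f i <= D0 * w i) ->
  forall i, P i -> f i <= e / (1 - q) * w i.
Proof.
move=> /andP[q0 q1] e0 D00 H H0 i Pi.
have q1' : 0 < 1 - q by rewrite subr_gt0.
(* Applying the hypothesis [n] times from [D0] produces a geometric sum; letting [n] tend to
   infinity removes [D0]. *)
have K n : forall i, P i -> f i <= (q ^+ n * D0 + e / (1 - q) * (1 - q ^+ n)) * w i.
  elim: n => [|n IH]; first by move=> j Pj; rewrite expr0 subrr mulr0 addr0 mul1r; exact: H0.
  move=> j Pj.
  have -> : q ^+ n.+1 * D0 + e / (1 - q) * (1 - q ^+ n.+1) =
     q * (q ^+ n * D0 + e / (1 - q) * (1 - q ^+ n)) + e.
    by rewrite exprS; field; rewrite gt_eqF.
  apply: H => //; rewrite addr_ge0// mulr_ge0 ?exprn_ge0//.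
    by rewrite divr_ge0// ltW.
  by rewrite subr_ge0 exprn_ile1// ltW.
have cq : q ^+ n @[n --> \oo] --> (0 : R).
  by apply: cvg_expr; rewrite ger0_norm.
have : (q ^+ n * D0 + e / (1 - q) * (1 - q ^+ n)) * w i @[n --> \oo] -->
       (0 * D0 + e / (1 - q) * (1 - 0)) * w i.
  apply: cvgMr_tmp; apply: cvgD; first exact: cvgMr_tmp.
  by apply: cvgMl_tmp; apply: cvgB => //; exact: cvg_cst.
rewrite mul0r add0r subr0 mulr1 => cv.
rewrite -(cvg_lim _ cv)//; apply: limr_ge; first by apply/cvg_ex; eexists; exact: cv.
by apply: nearW => n; exact: K.
Qed.

(** With zero error and constant weight the limiting bound of [contraction_bound] is [0]. This
    serves for the independence of interleaved digits, for Dynkin's formula and for the Markov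
    property. *)
Lemma contraction0 (R : realType) (I : Type) (P : I -> Prop)
    (f : I -> R) (q D0 : R) :
  0 <= q < 1 ->
  (forall D, 0 <= D -> (forall i, P i -> `|f i| <= D) ->
     forall i, P i -> `|f i| <= q * D) ->
  (forall i, P i -> `|f i| <= D0) ->
  forall i, P i -> f i = 0.
Proof.
move=> q01 H H0 i Pi.
have D00 : 0 <= D0 by apply: le_trans (H0 _ Pi).
apply/eqP; rewrite -normr_le0.
have := @contraction_bound R I P (fun i => `|f i|) (fun=> 1) q 0 D0 q01 (lexx _) D00.
move=> /(_ _ _ i Pi); rewrite mul0r mul0r; apply.
  move=> D D_ge0 HD j Pj; rewrite addr0 mulr1; apply: H => // k Pk.
  by rewrite -[leRHS]mulr1; exact: HD.
by move=> j Pj; rewrite mulr1; exact: H0.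
Qed.

(** The class of integrands used throughout: against finite measures such functions are integrable,
    so linearity, monotonicity and Fubini for the real-valued integral carry no further side
    conditions. *)
Definition bmeas d (T : measurableType d) (R : realType) (f : T -> R) : Prop :=
  measurable_fun setT f /\ exists C : R, forall x, `|f x| <= C.

Section bmeas_closure.
Context d (T : measurableType d) (R : realType).
Implicit Types f g : T -> R.

Lemma bmeas_cst (r : R) : bmeas (fun _ : T => r).
Proof. by split; [exact: measurable_cst|exists `|r|]. Qed.

Lemma bmeasD f g : bmeas f -> bmeas g -> bmeas (fun x => f x + g x).
Proof.
move=> [mf [C fC]] [mg [D gD]]; split; first exact: measurable_funD.
exists (C + D) => x; apply: le_trans (ler_normD _ _) _; exact: lerD.
Qed.

Lemma bmeasN f : bmeas f -> bmeas (fun x => - f x).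
Proof.
move=> [mf [C fC]]; split; first exact: measurable_funN.
by exists C => x; rewrite normrN.
Qed.

Lemma bmeasB f g : bmeas f -> bmeas g -> bmeas (fun x => f x - g x).
Proof. by move=> mf mg; apply: bmeasD => //; exact: bmeasN. Qed.

Lemma bmeasM f g : bmeas f -> bmeas g -> bmeas (fun x => f x * g x).
Proof.
move=> [mf [C fC]] [mg [D gD]]; split; first exact: measurable_funM.
by exists (C * D) => x; rewrite normrM; apply: ler_pM.
Qed.

Lemma bmeasX f n : bmeas f -> bmeas (fun x => f x ^+ n).
Proof.
move=> mf; elim: n => [|n IH]; first exact: bmeas_cst.
by under eq_fun do rewrite exprS; exact: bmeasM.
Qed.

Lemma bmeas_indic (A : set T) : measurable A -> bmeas (\1_A : T -> R).
Proof.
move=> mA; split; first exact: measurable_indic.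
by exists 1 => x; rewrite indicE; case: (_ \in _); rewrite ?normr1// normr0.
Qed.

Lemma bmeas_abs f : bmeas f -> bmeas (fun x => `|f x|).
Proof.
move=> [mf [C fC]]; split; first exact: measurableT_comp.
by exists C => x; rewrite normr_id.
Qed.

End bmeas_closure.

Lemma bmeas_comp d d' (T : measurableType d) (T' : measurableType d')
    (R : realType) (f : T' -> R) (h : T -> T') :
  measurable_fun setT h -> bmeas f -> bmeas (fun x => f (h x)).
Proof.
move=> mh [mf [C fC]]; split; first exact: measurableT_comp mf mh.
by exists C => x.
Qed.

Section bmeas_integral.
Context d (T : measurableType d) (R : realType).
Variable P : {finite_measure set T -> \bar R}.
Implicit Types f g : T -> R.

Lemma bmeas_integrable f D : measurable D -> bmeas f ->
  P.-integrable D (EFin \o f).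
Proof.
move=> mD [mf [C fC]]; apply: measurable_bounded_integrable => //.
- by rewrite ltey_eq fin_num_measure.
- exact: measurable_funTS.
- exists C; split; first exact: num_real.
  by move=> y Cy x _; apply: le_trans (fC x) (ltW Cy).
Qed.

Lemma ED f g : bmeas f -> bmeas g ->
  \int[P]_x (f x + g x) = \int[P]_x f x + \int[P]_x g x.
Proof. by move=> bf bg; rewrite RintegralD//; exact: bmeas_integrable. Qed.

Lemma EB f g : bmeas f -> bmeas g ->
  \int[P]_x (f x - g x) = \int[P]_x f x - \int[P]_x g x.
Proof. by move=> bf bg; rewrite RintegralB//; exact: bmeas_integrable. Qed.

Lemma EZ (r : R) f : bmeas f ->
  \int[P]_x (r * f x) = r * \int[P]_x f x.
Proof. by move=> bf; rewrite RintegralZl//; exact: bmeas_integrable. Qed.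

Lemma le_E f g : bmeas f -> bmeas g -> (forall x, f x <= g x) ->
  \int[P]_x f x <= \int[P]_x g x.
Proof.
by move=> bf bg fg; apply: le_Rintegral => //; exact: bmeas_integrable.
Qed.

Lemma norm_E_le f g : bmeas f -> bmeas g -> (forall x, `|f x| <= g x) ->
  `|\int[P]_x f x| <= \int[P]_x g x.
Proof.
move=> bf bg fg; apply: le_trans (le_normr_Rintegral measurableT _) _.
  exact: bmeas_integrable.
by apply: le_E => //; exact: bmeas_abs.
Qed.

Lemma bounded_cvg_E (f_ : nat -> T -> R) f C :
  (forall n, measurable_fun setT (f_ n)) -> (forall n x, `|f_ n x| <= C) ->
  (forall x, f_ n x @[n --> \oo] --> f x) ->
  \int[P]_x f_ n x @[n --> \oo] --> \int[P]_x f x.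
Proof.
move=> mf fC ff.
have mf' : measurable_fun setT f.
  exact: (measurable_fun_cvg (h := f_)).
have bC : P.-integrable setT (EFin \o (fun=> C)).
  by apply: bmeas_integrable => //; exact: bmeas_cst.
have cst1 : {ae P, forall x, setT x -> (EFin \o f_ n) x @[n --> \oo] --> (EFin \o f) x}.
  by apply: aeW => x _; apply: cvg_EFin; [exact: nearW|exact: ff].
have cst2 : {ae P, forall x n, setT x -> (`|(EFin \o f_ n) x| <= (EFin \o (fun=> C)) x)%E}.
  by apply: aeW => x n _ /=; rewrite lee_fin.
have [i1 _ i3] := dominated_convergence measurableT
  (fun n => (measurable_EFinP _ _).2 (mf n))
  ((measurable_EFinP _ _).2 mf') cst1 bC cst2.
apply: fine_cvg; rewrite fineK; first exact: i3.
exact: integrable_fin_num.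
Qed.

End bmeas_integral.

Section bmeas_fubini.
Context d1 d2 (T1 : measurableType d1) (T2 : measurableType d2) (R : realType).
Variable P1 : {finite_measure set T1 -> \bar R}.
Variable P2 : {finite_measure set T2 -> \bar R}.
Variable f : T1 * T2 -> R.
Hypothesis bf : bmeas f.

Lemma bmeas_prod_integrable : (P1 \x P2)%E.-integrable setT (EFin \o f).
Proof.
have [mf [C fC]] := bf.
apply/integrable12ltyP; first exact/measurable_EFinP.
apply: (@le_lt_trans _ _ (\int[P1]_x \int[P2]_y C%:E)%E); last first.
  have e2 : (\int[P2]_y C%:E = C%:E * P2 setT)%E by exact: integral_cst.
  rewrite e2.
  have -> : (\int[P1]_x (C%:E * P2 setT) = C%:E * P2 setT * P1 setT)%E.
    exact: integral_cst.
  by rewrite -[P1 setT]fineK ?fin_num_measure// -[P2 setT]fineK ?fin_num_measure//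
    -!EFinM ltry.
apply: ge0_le_integral => //.
- by move=> x _; exact: integral_ge0.
- apply: (measurable_fun_fubini_tonelli_F (abse \o (EFin \o f))) => //; last first.
    by move=> x; exact: abse_ge0.
  by apply: measurableT_comp => //; exact/measurable_EFinP.
- by move=> x _; apply: ge0_le_integral => //;
   [apply: measurableT_comp => //; apply/measurable_EFinP; exact: measurableT_comp
   |move=> y _; rewrite lee_fin; exact: fC].
Qed.

Lemma Rintegral_fin2 (g : T2 -> R) : bmeas g ->
  (\int[P2]_y (g y)%:E)%E = (\int[P2]_y g y)%:E.
Proof.
move=> bg; rewrite /Rintegral fineK//.
by apply: integrable_fin_num => //; exact: bmeas_integrable.
Qed.

Lemma bmeas_pair1 x : bmeas (fun y => f (x, y)).
Proof. exact: (bmeas_comp (h := pair x)). Qed.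

Lemma bmeas_E2 : bmeas (fun x => \int[P2]_y f (x, y)).
Proof.
split.
  have := measurable_fubini_F bmeas_prod_integrable; rewrite /fubini_F => /= h.
  exact: (measurableT_comp (fine_measurable measurableT) h).
have [_ [C fC]] := bf; exists (\int[P2]_y C) => x.
by apply: norm_E_le; [exact: bmeas_pair1|exact: bmeas_cst|].
Qed.

End bmeas_fubini.


Section bmeas_fubini2.
Context d1 d2 (T1 : measurableType d1) (T2 : measurableType d2) (R : realType).
Variable P1 : {finite_measure set T1 -> \bar R}.
Variable P2 : {finite_measure set T2 -> \bar R}.
Variable f : T1 * T2 -> R.
Hypothesis bf : bmeas f.

Lemma bmeas_swap : bmeas (fun z : T2 * T1 => f (z.2, z.1)).
Proof. by apply: bmeas_comp bf; exact: measurable_swap. Qed.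

Lemma bmeas_E1 : bmeas (fun y => \int[P1]_x f (x, y)).
Proof. exact: (bmeas_E2 P2 P1 bmeas_swap). Qed.

Lemma E_prod : \int[(P1 \x P2)%E]_z f z = \int[P1]_x \int[P2]_y f (x, y).
Proof.
rewrite {1 2}/Rintegral; congr fine.
rewrite -(integral12_prod_meas1 (bmeas_prod_integrable P1 P2 bf)).
apply: eq_integral => x _; rewrite /fubini_F /=.
by rewrite (Rintegral_fin2 P2 (bmeas_pair1 bf x)).
Qed.

Lemma E_fubini : \int[P1]_x \int[P2]_y f (x, y) = \int[P2]_y \int[P1]_x f (x, y).
Proof.
rewrite -E_prod {1 2}/Rintegral; congr fine.
rewrite -(integral21_prod_meas1 (bmeas_prod_integrable P1 P2 bf)).
apply: eq_integral => y _; rewrite /fubini_G /=.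
by rewrite (Rintegral_fin2 P1 (bmeas_pair1 bmeas_swap y)).
Qed.

End bmeas_fubini2.

Lemma eq_measure_E d (T : measurableType d) (R : realType)
    (m1 m2 : {measure set T -> \bar R}) (f : T -> R) :
  (forall A, measurable A -> m1 A = m2 A) ->
  \int[m1]_x f x = \int[m2]_x f x.
Proof.
by move=> m12; congr fine; apply: eq_measure_integral => A mA _; exact: m12.
Qed.

Lemma E_law d1 d2 d (T1 : measurableType d1) (T2 : measurableType d2)
    (T : measurableType d) (R : realType)
    (P1 : {finite_measure set T1 -> \bar R})
    (P2 : {finite_measure set T2 -> \bar R})
    (h1 : T1 -> T) (h2 : T2 -> T) (f : T -> R) :
  measurable_fun setT h1 -> measurable_fun setT h2 -> bmeas f ->
  (forall A, measurable A -> P1 (h1 @^-1` A) = P2 (h2 @^-1` A)) ->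
  \int[P1]_x f (h1 x) = \int[P2]_x f (h2 x).
Proof.
move=> mh1 mh2 bf P12.
pose h1' : {mfun T1 >-> T} :=
  MeasurableFun.Pack (MeasurableFun.Class (isMeasurableFun.Build _ _ _ _ _ mh1)).
pose h2' : {mfun T2 >-> T} :=
  MeasurableFun.Pack (MeasurableFun.Class (isMeasurableFun.Build _ _ _ _ _ mh2)).
have E1 d' (T' : measurableType d') (P : {finite_measure set T' -> \bar R})
    (h : {mfun T' >-> T}) : \int[P]_x f (h x) = \int[pushforward P h]_x f x.
  rewrite /Rintegral; congr fine.
  rewrite integral_pushforward//; first exact/measurable_EFinP/bf.1.
  exact: (bmeas_integrable P measurableT (bmeas_comp (measurable_funPT h) bf)).
have E1' := E1 (fun d' T' h => measurable_funPT h).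
rewrite (E1' _ _ P1 h1') (E1' _ _ P2 h2').
by apply: eq_measure_E => A mA; exact: P12.
Qed.

Lemma E_cst d (T : measurableType d) (R : realType) (P : probability T R)
  (r : R) : \int[P]_x r = r.
Proof. rewrite Rintegral_cst//; have /= -> := @probability_setT _ _ _ P.
by rewrite mulr1. Qed.

Lemma E_indic d (T : measurableType d) (R : realType)
    (P : {finite_measure set T -> \bar R}) (A : set T) : measurable A ->
  \int[P]_x (\1_A x) = fine (P A).
Proof. by move=> mA; rewrite /Rintegral integral_indic// setIT. Qed.

(** The sum counts the positive integers up to [y], so it is the integer part of [y]. Applied to a
    function, it writes a staircase approximation as a sum of indicators of level sets. *)
Lemma staircase_bounds (R : realFieldType) (y : R) N : 0 <= y <= N%:R ->
  \sum_(k < N) (k.+1%:R <= y)%R%:R <= y <= \sum_(k < N) (k.+1%:R <= y)%R%:R + 1.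
Proof.
move=> /andP[y0]; elim: N => [|N IH] yN.
  by rewrite big_ord0 y0 add0r (le_trans yN).
rewrite big_ord_recr /=; have [yN'|Ny] := leP y N%:R.
  have /negbTE -> : ~~ (N.+1%:R <= y).
    by rewrite -ltNge; apply: le_lt_trans yN' _; rewrite ltr_nat.
  by rewrite addr0; exact: IH.
rewrite (eq_bigr (fun=> 1)); last first.
  move=> k _; suff -> : k.+1%:R <= y by [].
  by apply: le_trans (ltW Ny); rewrite ler_nat ltn_ord.
rewrite sumr_const card_ord; move: Ny yN; rewrite -(natr1 N) => Ny yN.
have [h|h] := leP (N%:R + 1) y; rewrite /= ?mulr0n ?mulr1n ?addr0;
  by apply/andP; split; lra.
Qed.

(** Covers integrals with a weight and a change of variables, so that an integration formula has to
    be checked on indicators only. *)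
Definition positive_functional d (T : measurableType d) (R : realType)
    (I : (T -> R) -> R) : Prop :=
  [/\ (forall f g, bmeas f -> bmeas g -> I (fun x => f x + g x) = I f + I g),
      (forall r f, bmeas f -> I (fun x => r * f x) = r * I f) &
      (forall f g, bmeas f -> bmeas g -> (forall x, f x <= g x) -> I f <= I g)].

(** A bounded function is uniformly within [e] of a combination of indicators of its level sets, and
    positivity turns this into an error of at most [e] times the total mass. *)
Lemma bmeas_ext d (T : measurableType d) (R : realType) (I J : (T -> R) -> R) :
  positive_functional I -> positive_functional J ->
  (forall A, measurable A -> I \1_A = J \1_A) ->
  forall f, bmeas f -> I f = J f.
Proof.
move=> [ID IZ Ile] [JD JZ Jle] IJ f bf; have [mf [C fC]] := bf.
have C0 : 0 <= C by apply: le_trans (fC point).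
have IJ1 : I (fun=> 1) = J (fun=> 1).
  have -> : (fun=> 1) = (\1_setT : T -> R) by apply/funext => x; rewrite indicT.
  exact: IJ.
have M0 : 0 <= I (fun=> 1).
  rewrite -[leLHS](mul0r (I (fun=> 1))) -IZ; last exact: bmeas_cst.
  by apply: Ile; [exact: bmeas_cst..|move=> x; rewrite mul0r].
set M := I (fun=> 1) in IJ1 M0.
suff H e : 0 < e -> `|I f - J f| <= e * M.
  apply/eqP; rewrite -subr_eq0 -normr_le0; apply/ler_addgt0Pr => e e0.
  have M1 : 0 < M + 1 by rewrite ltr_wpDl.
  rewrite add0r; apply: le_trans (H _ (divr_gt0 e0 M1)) _.
  by rewrite mulrAC ler_pdivrMr// ler_wpM2l ?(ltW e0)// lerDl.
move=> e0.
(* [(f + C) / e] lies between [0] and [2 C / e], so [N] levels suffice; [g] below is the lower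
   staircase, with [g <= f <= g + e]. *)
pose N := (Num.truncn ((C + C) / e)).+1.
pose A k := [set x | k.+1%:R <= (f x + C) / e].
have mA k : measurable (A k).
  have mg : measurable_fun setT (fun x => (f x + C) / e).
    by apply: measurable_funM => //; apply: measurable_funD.
  rewrite (_ : A k = setT `&` (fun x => (f x + C) / e) @^-1` `[k.+1%:R, +oo[); first exact: mg.
  by rewrite setTI; apply/seteqP; split => x /=; rewrite in_itv/= andbT.
pose s n x := \sum_(k < n) (\1_(A k) x : R).
have bs n : bmeas (s n).
  rewrite /s; elim: n => [|n IH].
    by under eq_fun do rewrite big_ord0; exact: bmeas_cst.
  by under eq_fun do rewrite big_ord_recr /=; apply: bmeasD => //; exact: bmeas_indic.
have Is n : I (s n) = J (s n).
  rewrite /s; elim: n => [|n IH].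
    under eq_fun do rewrite big_ord0.
    have -> : (fun _ : T => 0 : R) = (fun x => 0 * 1) by apply/funext => x; rewrite mul0r.
    by rewrite IZ ?JZ ?mul0r//; exact: bmeas_cst.
  under eq_fun do rewrite big_ord_recr /=.
  by rewrite ID ?JD ?IH ?IJ//; [exact: bs|exact: bmeas_indic|exact: bs|exact: bmeas_indic].
pose g x := e * s N x + (- C) * 1.
have bes : bmeas (fun x => e * s N x) by apply: bmeasM => //; exact: bmeas_cst.
have b1 : bmeas (fun _ : T => 1 : R) by exact: bmeas_cst.
have bC : bmeas (fun _ : T => (- C) * 1) by apply: bmeasM; exact: bmeas_cst.
have bg : bmeas g by exact: bmeasD.
have Ig : I g = J g.
  rewrite /g (ID _ _ bes bC) (JD _ _ bes bC) (IZ _ _ (bs N)) (JZ _ _ (bs N)).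
  by rewrite (IZ _ _ b1) (JZ _ _ b1) Is -IJ1.
have gf x : g x <= f x <= g x + e * 1.
  have y0 : 0 <= (f x + C) / e <= N%:R.
    have := fC x; rewrite ler_norml => /andP[f1 f2]; apply/andP; split.
      by apply: divr_ge0; [lra|exact: ltW].
    apply: (@le_trans _ _ ((C + C) / e)); first by rewrite ler_pM2r ?invr_gt0// lerD2r.
    have ye0 : 0 <= (C + C) / e by apply: divr_ge0; [lra|exact: ltW].
    by have /andP[_ h] := truncn_itv ye0; exact: ltW h.
  have := staircase_bounds y0.
  have -> : \sum_(k < N) (k.+1%:R <= (f x + C) / e)%R%:R = s N x.
    apply: eq_bigr => k _; rewrite indicE; congr (nat_of_bool _)%:R.
    by apply/idP/idP; rewrite inE.
  rewrite ler_pdivlMr// ler_pdivrMr// => /andP[h1 h2]; rewrite /g; apply/andP; split; lra.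
have be : bmeas (fun _ : T => e * 1) by apply: bmeasM; exact: bmeas_cst.
have I1 := Ile _ _ bg bf (fun x => (andP (gf x)).1).
have I2 := Ile _ _ bf (bmeasD bg be) (fun x => (andP (gf x)).2).
have J1 := Jle _ _ bg bf (fun x => (andP (gf x)).1).
have J2 := Jle _ _ bf (bmeasD bg be) (fun x => (andP (gf x)).2).
move: I2 J2; rewrite (ID _ _ bg be) (JD _ _ bg be) (IZ _ _ b1) (JZ _ _ b1) -IJ1 -/M -Ig.
move: J1; rewrite -Ig => J1.
by move=> I2 J2; rewrite ler_norml; apply/andP; split; lra.
Qed.

Lemma E_functional d (T : measurableType d) (R : realType)
    (P : {finite_measure set T -> \bar R}) :
  positive_functional (fun f => \int[P]_x f x).
Proof. by split => *; [exact: ED|exact: EZ|exact: le_E]. Qed.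

Lemma EM_functional d d' (T : measurableType d) (T' : measurableType d') (R : realType)
    (P : {finite_measure set T -> \bar R}) (w : T -> R) (h : T -> T') :
  bmeas w -> (forall x, 0 <= w x) -> measurable_fun setT h ->
  positive_functional (fun f => \int[P]_x (w x * f (h x))).
Proof.
move=> bw w0 mh; have bh f : bmeas f -> bmeas (fun x => w x * f (h x)).
  by move=> bf; apply: bmeasM => //; exact: bmeas_comp bf.
split.
- move=> f g bf bg; rewrite -ED; [|exact: bh..].
  by apply: eq_Rintegral => x _; rewrite mulrDr.
- move=> r f bf; rewrite -EZ; last exact: bh.
  by apply: eq_Rintegral => x _; rewrite mulrCA.
- move=> f g bf bg fg; apply: le_E; [exact: bh..|].
  by move=> x; rewrite ler_wpM2l.
Qed.

(** * Measurability on the state space *)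

Section state_measurability.
Variable R : realType.
Implicit Types (X Y : state R).

Lemma state_ball_dist X Y e : ball X e Y = (state_dist X Y < e) :> Prop.
Proof. by []. Qed.

Lemma st_x_ge0 X : 0 <= st_x X.
Proof. by case: X => [[[k x] y] iX]; have /and3P[] := iX. Qed.

Lemma st_y_ge0 X : 0 <= st_y X.
Proof. by case: X => [[[k x] y] iX]; have /and3P[] := iX. Qed.

Lemma st_y_idle X : st_k X = 0%N -> st_y X = 0.
Proof.
case: X => [[[k x] y] iX]; have /and3P[/= _ _ /implyP h] := iX.
by rewrite /st_k /st_y /= => k0; apply/eqP/h/eqP.
Qed.

Lemma state_eq X Y :
  st_k X = st_k Y -> st_x X = st_x Y -> st_y X = st_y Y -> X = Y.
Proof.
case: X => [[[k x] y] iX]; case: Y => [[[k' x'] y'] iY].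
by rewrite /st_k /st_x /st_y /= => e1 e2 e3; apply: val_inj; rewrite /= e1 e2 e3.
Qed.

Lemma st_k_mk k (x y : R) : st_k (mkstate k x y) = k.
Proof. by []. Qed.

Lemma st_x_mk k (x y : R) : 0 <= x -> st_x (mkstate k x y) = x.
Proof. by move=> x0; rewrite /st_x /= max_r. Qed.

Lemma st_y_mk k (x y : R) : k != 0%N -> 0 <= y -> st_y (mkstate k x y) = y.
Proof. by move=> /negbTE k0 y0; rewrite /st_y /= k0 max_r. Qed.

Lemma mkstate_id X : mkstate (st_k X) (st_x X) (st_y X) = X.
Proof.
apply: state_eq => //; first by rewrite st_x_mk// st_x_ge0.
have [k0|k0] := eqVneq (st_k X) 0%N; last by rewrite st_y_mk// st_y_ge0.
by rewrite (st_y_idle k0) st_y_idle// st_k_mk.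
Qed.

Definition box (i : nat * rat * rat * rat) : set (state R) :=
  [set X | [/\ st_k X = i.1.1.1, `|st_x X - ratr i.1.1.2| < ratr i.2 &
    `|st_y X - ratr i.1.2| < ratr i.2]].

(** The rational boxes form a countable base. The half-side is taken below [e / 4] so that two
    points of a box differ by less than [e / 2] in each of [x] and [y], while [k] is constant on a
    box. *)
Lemma open_bigcup_box (U : set (state R)) : open U ->
  U = \bigcup_(i in [set i | box i `<=` U]) box i.
Proof.
move=> oU; apply/seteqP; split; last by move=> X [i iU]; exact: iU.
move=> X UX.
have /nbhs_ballP[e /= e0 eU] : nbhs X U by exact: open_nbhs_nbhs.
have e4 : 0 < e / 4 by rewrite divr_gt0.
have [r] := rat_in_itvoo e4; rewrite in_itv/= => /andP[r0 re].
have xr : st_x X - ratr r < st_x X + ratr r by lra.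
have yr : st_y X - ratr r < st_y X + ratr r by lra.
have [p] := rat_in_itvoo xr; rewrite in_itv/= => /andP[p1 p2].
have [q] := rat_in_itvoo yr; rewrite in_itv/= => /andP[q1 q2].
exists (st_k X, p, q, r); last first.
  by split => //=; rewrite ltr_norml; apply/andP; split; lra.
move=> Y [/= kY xY yY]; apply: eU; rewrite state_ball_dist /state_dist kY subrr normr0 add0r.
move: xY yY; rewrite !ltr_norml => /andP[? ?] /andP[? ?].
have : `|st_x X - st_x Y| < e / 2 by rewrite ltr_norml; apply/andP; split; lra.
have : `|st_y X - st_y Y| < e / 2 by rewrite ltr_norml; apply/andP; split; lra.
lra.
Qed.

(** Open sets are countable unions of boxes, so Borel measurability into the state space can be
    tested on the three coordinates. *)
Lemma measurable_stateP d (T : measurableType d) (h : T -> state R) :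
  measurable_fun setT (@st_k R \o h) -> measurable_fun setT (@st_x R \o h) ->
  measurable_fun setT (@st_y R \o h) -> measurable_fun setT h.
Proof.
move=> mk mx my.
apply: (measurability (@open (state R))) => //.
move=> _ [U oU <-]; rewrite setTI (open_bigcup_box oU) preimage_bigcup bigcup_mkcond.
apply: countable_bigcupT_measurable; [exact: countableP|move=> i; case: ifPn => // _].
have -> : h @^-1` box i = ((@st_k R \o h) @^-1` [set i.1.1.1]) `&`
  ((@st_x R \o h) @^-1` ball (ratr i.1.1.2 : R) (ratr i.2)) `&`
  ((@st_y R \o h) @^-1` ball (ratr i.1.2 : R) (ratr i.2)).
  apply/seteqP; split => t /=.
    by move=> [? ? ?]; rewrite /ball/= !(distrC (ratr _)).
  by rewrite /ball/= !(distrC (ratr _)) => -[[? ?] ?]; split.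
apply: measurableI; first apply: measurableI.
- by rewrite -[X in measurable X]setTI; exact: mk.
- by rewrite -[X in measurable X]setTI; apply: mx => //; exact: measurable_ball.
- by rewrite -[X in measurable X]setTI; apply: my => //; exact: measurable_ball.
Qed.

Lemma st_x_continuous : continuous (@st_x R).
Proof.
move=> X A /nbhs_ballP[e /= e0 eA]; apply/nbhs_ballP; exists e => //= Y XY.
apply: eA; move: XY; rewrite state_ball_dist /state_dist /ball/=; apply: le_lt_trans.
by rewrite -addrA addrCA lerDl addr_ge0.
Qed.

Lemma st_y_continuous : continuous (@st_y R).
Proof.
move=> X A /nbhs_ballP[e /= e0 eA]; apply/nbhs_ballP; exists e => //= Y XY.
apply: eA; move: XY; rewrite state_ball_dist /state_dist /ball/=; apply: le_lt_trans.
by rewrite lerDr addr_ge0.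
Qed.

(** Queue lengths are integers, so a distance below [1] leaves no room for a change of [k]; hence
    the levels are open and everything about [k] is locally constant. *)
Lemma state_ball_k X Y (e : R) : e <= 1 -> ball X e Y -> st_k Y = st_k X.
Proof.
move=> e1; rewrite state_ball_dist /state_dist => h.
have : `|(st_k X)%:R - (st_k Y)%:R| < (1 : R).
  apply: lt_le_trans e1; apply: le_lt_trans h.
  by rewrite -addrA lerDl addr_ge0.
case: (ltngtP (st_k X) (st_k Y)) => //.
- move=> h'; rewrite distrC -natrB; last exact: ltnW.
  by rewrite normr_nat (ltr_nat _ _ 1) ltnNge subn_gt0 h'.
- move=> h'; rewrite -natrB; last exact: ltnW.
  by rewrite normr_nat (ltr_nat _ _ 1) ltnNge subn_gt0 h'.
Qed.

Lemma nbhs_st_k X : \forall Y \near X, st_k Y = st_k X.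
Proof.
by apply/nbhs_ballP; exists 1 => //= Y XY; exact: (@state_ball_k X Y 1).
Qed.

Lemma open_measurable_state (U : set (state R)) : open U -> measurable U.
Proof. by move=> oU; exact: sub_sigma_algebra. Qed.

Lemma state_continuous_measurable (f : state R -> R) :
  continuous f -> measurable_fun setT f.
Proof.
move=> cf; apply: (measurability (RGenOInfty.G (R:=R))).
  exact: RGenOInfty.measurableE.
move=> _ [_ [r ->] <-]; rewrite setTI; apply: open_measurable_state.
apply: open_comp; first by move=> x _; exact: cf.
by rewrite set_itvE; exact: open_gt.
Qed.

Lemma measurable_st_x : measurable_fun setT (@st_x R).
Proof. exact: state_continuous_measurable st_x_continuous. Qed.

Lemma measurable_st_y : measurable_fun setT (@st_y R).
Proof. exact: state_continuous_measurable st_y_continuous. Qed.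

Lemma st_k_open (K : set nat) : open [set X : state R | K (st_k X)].
Proof.
rewrite openE => X KX; rewrite /interior.
by have := nbhs_st_k X; apply: filterS => Y /= ->.
Qed.

Lemma measurable_st_k : measurable_fun setT (@st_k R).
Proof. by move=> _ K _; rewrite setTI; exact: (open_measurable_state (@st_k_open K)). Qed.

Lemma measurable_mkstate d (T : measurableType d) (k : T -> nat) (x y : T -> R) :
  measurable_fun setT k -> measurable_fun setT x -> measurable_fun setT y ->
  measurable_fun setT (fun t => mkstate (k t) (x t) (y t)).
Proof.
move=> mk mx my; apply: measurable_stateP => //.
  by apply: measurable_maxr => //; exact: measurable_cst.
apply: (measurable_fun_ifT (f := fun t => k t == 0%N)).
- exact: measurable_fun_eqn.
- exact: measurable_cst.
- by apply: measurable_maxr => //; exact: measurable_cst.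
Qed.

Lemma measurable_st_up : measurable_fun setT (@st_up R).
Proof.
apply: (measurable_mkstate (k := fun X => (st_k X).+1) (x := fun=> 0) (y := @st_y R)).
- apply: (eq_measurable_fun (fun X => (st_k X + 1)%N)).
    by move=> X _; rewrite addn1.
  by apply: measurable_fun_addn => //; exact: measurable_st_k.
- exact: measurable_cst.
- exact: measurable_st_y.
Qed.

Lemma measurable_st_down : measurable_fun setT (@st_down R).
Proof.
apply: (measurable_mkstate (k := fun X => (st_k X).-1) (x := @st_x R) (y := fun=> 0)).
- apply: (eq_measurable_fun (fun X => (st_k X - 1)%N)).
    by move=> X _; rewrite subn1.
  by apply: measurable_fun_subn => //; exact: measurable_st_k.
- exact: measurable_st_x.
- exact: measurable_cst.
Qed.

Lemma measurable_flow : measurable_fun setT (fun z : state R * R => flow z.1 z.2).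
Proof.
apply: measurable_mkstate.
- exact: measurableT_comp measurable_st_k measurable_fst.
- apply: measurable_funD => //; exact: measurableT_comp measurable_st_x measurable_fst.
- apply: measurable_funD => //; exact: measurableT_comp measurable_st_y measurable_fst.
Qed.

Lemma measurable_flow_comp d (T : measurableType d) (X : T -> state R) (h : T -> R) :
  measurable_fun setT X -> measurable_fun setT h ->
  measurable_fun setT (fun t => flow (X t) (h t)).
Proof.
move=> mX mh.
exact: (measurableT_comp measurable_flow (measurable_fun_pair mX mh)).
Qed.

(** Along a convergent sequence the queue length is eventually constant; the other two coordinates
    are limits of real functions. *)
Lemma measurable_state_cvg d (T : measurableType d) (h : nat -> T -> state R)
    (f : T -> state R) :
  (forall n, measurable_fun setT (h n)) ->
  (forall t, h n t @[n --> \oo] --> f t) -> measurable_fun setT f.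
Proof.
move=> mh hf; apply: measurable_stateP.
- move=> _ K _; rewrite setTI.
  have -> : (@st_k R \o f) @^-1` K =
      \bigcup_n \bigcap_(m in [set m | (n <= m)%N]) ((@st_k R \o h m) @^-1` K).
    apply/seteqP; split => t /=.
      move=> Kt; have := hf t _ (nbhs_st_k (f t)); rewrite /= => -[N _ HN].
      by exists N => // m /= Nm; rewrite /= (HN m Nm).
    move=> [n _ H]; have := hf t _ (nbhs_st_k (f t)); rewrite /= => -[N _ HN].
    rewrite -(HN (maxn n N)); last by rewrite /= leq_maxr.
    by apply: H; rewrite /= leq_maxl.
  apply: bigcupT_measurable => n; apply: bigcap_measurable; first by exists n => /=.
  by move=> m _; rewrite -[X in measurable X]setTI; apply: measurableT_comp => //;
    exact: measurable_st_k.
- apply: (measurable_fun_cvg (h := fun n => @st_x R \o h n)) => //.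
    by move=> n; apply: measurableT_comp => //; exact: measurable_st_x.
  by move=> t _; apply: (cvg_comp _ _ (hf t)); exact: st_x_continuous.
- apply: (measurable_fun_cvg (h := fun n => @st_y R \o h n)) => //.
    by move=> n; apply: measurableT_comp => //; exact: measurable_st_y.
  by move=> t _; apply: (cvg_comp _ _ (hf t)); exact: st_y_continuous.
Qed.

(** The inequality on [st_k X], instead of an equality, makes the family stable under intersections.
    The strict lower bounds on [x] and [y] are the events that [laplace_stage] produces. *)
Definition corners : set_system (state R) :=
  [set A | exists (j : nat) (a b : R),
    A = [set X | [/\ (st_k X <= j)%N, a < st_x X & b < st_y X]]].

Lemma corners_setI : setI_closed corners.
Proof.
move=> _ _ [j [a [b ->]]] [j' [a' [b' ->]]].
exists (minn j j'), (Num.max a a'), (Num.max b b'); apply/seteqP; split => X /=.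
  by move=> [[h1 h2 h3] [h4 h5 h6]]; rewrite leq_min !gt_max h1 h2 h3 h4 h5 h6.
by rewrite leq_min !gt_max => -[/andP[? ?] /andP[? ?] /andP[? ?]].
Qed.

Lemma bigcup_corners :
  \bigcup_(n : nat) [set X : state R | [/\ (st_k X <= n)%N, -1 < st_x X & -1 < st_y X]] = setT.
Proof.
rewrite -subTset => X _; exists (st_k X) => //=; split => //.
  by have := st_x_ge0 X; lra.
by have := st_y_ge0 X; lra.
Qed.

Lemma measurable_corner (j : nat) (a b : R) :
  measurable [set X : state R | [/\ (st_k X <= j)%N, a < st_x X & b < st_y X]].
Proof.
have -> : [set X : state R | [/\ (st_k X <= j)%N, a < st_x X & b < st_y X]] =
    @st_k R @^-1` [set k | (k <= j)%N] `&` @st_x R @^-1` `]a, +oo[ `&` @st_y R @^-1` `]b, +oo[.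
  apply/seteqP; split => X /=; rewrite !in_itv/= !andbT; first by move=> [].
  by move=> [[]].
apply: measurableI; first apply: measurableI.
- by rewrite -[X in measurable X]setTI; exact: measurable_st_k.
- by rewrite -[X in measurable X]setTI; exact: measurable_st_x.
- by rewrite -[X in measurable X]setTI; exact: measurable_st_y.
Qed.

Lemma corners_generate : (@measurable _ (state R)) = <<s corners >>.
Proof.
apply/seteqP; split; last first.
  apply: smallest_sub; first exact: sigma_algebra_measurable.
  by move=> _ [j [a [b ->]]]; exact: measurable_corner.
pose T := g_sigma_algebraType corners.
have mc (j : nat) (a b : R) :
    @measurable _ T [set X | [/\ (st_k X <= j)%N, a < st_x X & b < st_y X]].
  by apply: sub_sigma_algebra; exists j, a, b.
(* The identity from the sigma-algebra of the corners to the Borel one is measurable coordinate by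
   coordinate. The bound [-1] is a void constraint, since [x] and [y] are non-negative. *)
have mid : measurable_fun setT (idfun : T -> state R).
  apply: measurable_stateP.
  - move=> _ K _; rewrite setTI.
    have -> : (@st_k R \o (idfun : T -> state R)) @^-1` K =
      \bigcup_(j in K) ([set X : T | [/\ (st_k X <= j)%N, -1 < st_x X & -1 < st_y X]]
          `\` \bigcup_(i in [set i | (i < j)%N]) [set X : T | [/\ (st_k X <= i)%N, -1 < st_x X & -1 < st_y X]]).
      apply/seteqP; split => X /=.
        move=> KX; exists (st_k X) => //; split.
          by split => //; [have := st_x_ge0 X|have := st_y_ge0 X]; lra.
        by move=> [i /= ij [ki _ _]]; move: ij; rewrite ltnNge ki.
      move=> [j Kj [[kj h2 h3] h]]; suff -> : st_k X = j by [].
      apply/eqP; rewrite eqn_leq kj leqNgt; apply/negP => jk; apply: h.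
      by exists (st_k X).
    apply: bigcup_measurable => j _; apply: measurableD; first exact: mc.
    by apply: bigcup_measurable => i _; exact: mc.
  - apply: (measurability (RGenOInfty.G (R:=R))); first exact: RGenOInfty.measurableE.
    move=> _ [_ [r ->] <-]; rewrite setTI.
    rewrite (_ : _ @^-1` _ = \bigcup_n [set X : T | [/\ (st_k X <= n)%N, r < st_x X & -1 < st_y X]]).
      by apply: bigcupT_measurable => n; exact: mc.
    apply/seteqP; split => X /=; rewrite in_itv/= andbT.
      by move=> h; exists (st_k X) => //; split => //; have := st_y_ge0 X; lra.
    by move=> [n _ []].
  - apply: (measurability (RGenOInfty.G (R:=R))); first exact: RGenOInfty.measurableE.
    move=> _ [_ [r ->] <-]; rewrite setTI.
    rewrite (_ : _ @^-1` _ = \bigcup_n [set X : T | [/\ (st_k X <= n)%N, -1 < st_x X & r < st_y X]]).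
      by apply: bigcupT_measurable => n; exact: mc.
    apply/seteqP; split => X /=; rewrite in_itv/= andbT.
      by move=> h; exists (st_k X) => //; split => //; have := st_x_ge0 X; lra.
    by move=> [n _ []].
move=> A mA.
by have := mid measurableT A mA; rewrite setTI.
Qed.

End state_measurability.

(** * Exponentials determine laws on the state space *)

Lemma measurable_preimageT d1 d2 (T1 : measurableType d1) (T2 : measurableType d2)
  (h : T1 -> T2) (A : set T2) :
  measurable_fun setT h -> measurable A -> measurable (h @^-1` A).
Proof. by move=> mh mA; rewrite -[X in measurable X]setTI; exact: mh. Qed.

Section exp_threshold.
Variable R : realType.
Implicit Types (a u : R) (n : nat).

(** About [n exp (n a)]: multiplied by [exp (- n u)] it is at least about [n] when [u <= a], and it
    tends to [0] when [a < u]. *)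
Definition threshold_power a n : nat := (Num.truncn (n%:R * expR (n%:R * a))).+1.

(** A polynomial in [exp (- n u)] that tends to the indicator of [a < u]; its integrals are linear
    combinations of values of a Laplace transform. *)
Definition threshold a n u : R := (1 - expR (- (n%:R * u))) ^+ threshold_power a n.

Lemma expR_neg_le1 (x : R) : 0 <= x -> expR (- x) <= 1.
Proof. by move=> x0; rewrite -expR0 ler_expR oppr_le0. Qed.

Lemma threshold_ge0 a n u : 0 <= u -> 0 <= threshold a n u <= 1.
Proof.
move=> u0; have e1 : expR (- (n%:R * u)) <= 1.
  by apply: expR_neg_le1; rewrite mulr_ge0.
have e0 := expR_gt0 (- (n%:R * u)).
apply/andP; split; first by rewrite exprn_ge0// subr_ge0.
by rewrite exprn_ile1 ?subr_ge0// lerBlDr lerDl ltW.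
Qed.

Lemma bernoulli_ineq (p : R) m : 0 <= p <= 1 -> 1 - m%:R * p <= (1 - p) ^+ m.
Proof.
move=> /andP[p0 p1]; elim: m => [|m IH]; first by rewrite mul0r subr0 expr0.
have q0 : 0 <= 1 - p by rewrite subr_ge0.
rewrite exprS; apply: le_trans (ler_wpM2l q0 IH).
rewrite -natr1; have : 0 <= m%:R * p * p by rewrite !mulr_ge0.
nra.
Qed.

Lemma threshold_cvg a u : 0 <= a -> 0 <= u ->
  threshold a n u @[n --> \oo] --> ((a < u)%R%:R : R).
Proof.
move=> a0 u0.
suff [C HC] : exists C : R, forall n, `|((a < u)%R%:R : R) - threshold a n u| <= C * n.+1%:R^-1.
  apply/cvgrPdist_le => e e0.
  have : C * n.+1%:R^-1 @[n --> \oo] --> C * 0.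
    by apply: cvgMl_tmp; exact: cvg_harmonic.
  rewrite mulr0 => /cvgrPdist_le/(_ e e0).
  apply: filterS => n; rewrite sub0r normrN => h.
  by apply: le_trans (HC n) _; apply: le_trans h; exact: ler_norm.
have pw n : n%:R * expR (n%:R * a) < (threshold_power a n)%:R <= n%:R * expR (n%:R * a) + 1.
  have := truncn_itv (_ : 0 <= n%:R * expR (n%:R * a)).
  rewrite mulr_ge0// ?expR_ge0// => /(_ isT) /andP[h1 h2].
  by rewrite h2 /= /threshold_power -natr1 lerD2r.
(* For [u <= a] the inequality [1 - p <= exp (- p)] leaves at most [exp (- n)]. For [a < u]
   Bernoulli's inequality bounds the distance to [1] by [threshold_power a n] times [p]. *)
have [ua|au] := leP u a.
  exists 1 => n; rewrite sub0r normrN mul1r.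
  have /andP[t0 _] := threshold_ge0 a n u0; rewrite ger0_norm// {t0}.
  set p := expR (- (n%:R * u)).
  have p0 : 0 < p by exact: expR_gt0.
  have p1 : p <= 1 by apply: expR_neg_le1; rewrite mulr_ge0.
  apply: (@le_trans _ _ (expR (- p) ^+ threshold_power a n)).
    rewrite ler_pXn2r ?nnegrE ?expR_ge0 ?subr_ge0//.
    by have := expR_ge1Dx (- p).
  rewrite -expRM_natr.
  apply: (@le_trans _ _ (expR (- n%:R))).
    rewrite ler_expR mulNr lerN2.
    have /andP[/ltW h _] := pw n.
    apply: (@le_trans _ _ (p * (n%:R * expR (n%:R * a)))); last by rewrite ler_wpM2l// ltW.
    rewrite mulrCA -expRD ler_peMr// -[leLHS]expR0 ler_expR.
    by rewrite addrC subr_ge0 ler_wpM2l.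
  rewrite expRN lef_pV2 ?posrE ?expR_gt0 ?ltr0n//.
  by have := expR_ge1Dx (n%:R : R); rewrite -natr1 addrC.
(* With [d = u - a] this gives [k (n + 1) <= 1 + n d / 2 <= exp (n d / 2)]. Squaring yields a decay
   of order [(n + 1) ^ -2], which absorbs the factor [n + 1]. *)
pose k := Num.min 1 ((u - a) / 2).
have k0 : 0 < k by rewrite lt_min ltr01 /= divr_gt0// subr_gt0.
exists (k ^- 2) => n; set p := expR (- (n%:R * u)).
have p0 : 0 < p by exact: expR_gt0.
have p1 : p <= 1 by apply: expR_neg_le1; rewrite mulr_ge0.
have /andP[_ t1] := threshold_ge0 a n u0.
rewrite ger0_norm ?subr_ge0//.
have b := @bernoulli_ineq p (threshold_power a n) (introT andP (conj (ltW p0) p1)).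
apply: (@le_trans _ _ ((threshold_power a n)%:R * p)).
  by rewrite lerBlDr -lerBlDl.
have /andP[_ h] := pw n.
apply: le_trans (ler_wpM2r (ltW p0) h) _.
set d := u - a; have d0 : 0 < d by rewrite subr_gt0.
have -> : (n%:R * expR (n%:R * a) + 1) * p = n%:R * expR (- (n%:R * d)) + p.
  rewrite mulrDl mul1r -mulrA /p -expRD; congr (_ * expR _ + _); rewrite /d; ring.
apply: (@le_trans _ _ (n.+1%:R * expR (- (n%:R * d)))).
  rewrite -natr1 mulrDl mul1r lerD2l ler_expR lerN2 ler_wpM2l// /d; lra.
have kn : k * n.+1%:R <= expR (n%:R * (d / 2)).
  apply: le_trans (expR_ge1Dx _).
  rewrite -natr1 mulrDr mulr1 addrC lerD//.
    by rewrite /k ge_min lexx.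
  by rewrite mulrC ler_wpM2l// /k ge_min lexx orbT.
have kn0 : 0 < k * n.+1%:R by rewrite mulr_gt0.
have -> : expR (- (n%:R * d)) = (expR (n%:R * (d / 2)) ^+ 2)^-1.
  by rewrite -expRM_natr -expRN; congr expR; field.
have : (expR (n%:R * (d / 2)) ^+ 2)^-1 <= ((k * n.+1%:R) ^+ 2)^-1.
  rewrite lef_pV2 ?posrE ?exprn_gt0 ?expR_gt0//.
  by rewrite ler_pXn2r ?nnegrE// ?expR_ge0// ltW.
move=> /(ler_wpM2l (ler0n R n.+1)) /le_trans; apply.
rewrite le_eqVlt; apply/orP; left; apply/eqP.
have n0 : n.+1%:R != 0 :> R by rewrite pnatr_eq0.
move: n0; move: (n.+1%:R : R) => N n0; rewrite exprMn.
by field; rewrite n0 gt_eqF.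
Qed.

End exp_threshold.

Section laplace_stage.
Context d1 d2 (T1 : measurableType d1) (T2 : measurableType d2) (R : realType).
Variables (P1 : {finite_measure set T1 -> \bar R}) (P2 : {finite_measure set T2 -> \bar R}).

Lemma bmeas_expN d (T : measurableType d) (al : R) (u : T -> R) : 0 <= al ->
  (forall t, 0 <= u t) -> measurable_fun setT u ->
  bmeas (fun t => expR (- (al * u t))).
Proof.
move=> al0 u0 mu; split.
  apply: measurableT_comp; first exact: measurable_expR.
  by apply: measurable_funN; apply: measurable_funM => //; exact: measurable_cst.
exists 1 => t; rewrite ger0_norm ?expR_ge0//.
by apply: expR_neg_le1; rewrite mulr_ge0.
Qed.

Lemma bmeas_gt d (T : measurableType d) (a : R) (u : T -> R) :
  measurable_fun setT u -> bmeas (fun t => ((a < u t)%R%:R : R)).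
Proof.
move=> mu; have -> : (fun t => ((a < u t)%R%:R : R)) = \1_(u @^-1` `]a, +oo[).
  apply/funext => t; rewrite indicE; congr (nat_of_bool _)%:R.
  by apply/idP/idP; rewrite inE/= in_itv/= andbT.
by apply: bmeas_indic; rewrite -[X in measurable X]setTI; exact: mu.
Qed.

(** By [threshold], a Laplace transform determines the tails. The weights [w1] and [w2] hold the
    part of the integrand that depends on other coordinates, so that coordinates can be treated one
    after the other. *)
Lemma laplace_stage (w1 : T1 -> R) (w2 : T2 -> R) (u1 : T1 -> R) (u2 : T2 -> R) :
  bmeas w1 -> bmeas w2 -> measurable_fun setT u1 -> measurable_fun setT u2 ->
  (forall t, 0 <= u1 t) -> (forall t, 0 <= u2 t) ->
  (forall al, 0 <= al -> \int[P1]_t (w1 t * expR (- (al * u1 t))) =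
                         \int[P2]_t (w2 t * expR (- (al * u2 t)))) ->
  forall a, \int[P1]_t (w1 t * ((a < u1 t)%R%:R : R)) =
            \int[P2]_t (w2 t * ((a < u2 t)%R%:R : R)).
Proof.
move=> bw1 bw2 mu1 mu2 u10 u20 H a.
have H0 : \int[P1]_t w1 t = \int[P2]_t w2 t.
  have := H 0 (lexx _).
  by under eq_Rintegral do rewrite mul0r oppr0 expR0 mulr1;
     under [in X in _ = X -> _]eq_Rintegral do rewrite mul0r oppr0 expR0 mulr1.
have [a0|a0] := ltP a 0.
  have e d (T : measurableType d) (P : {finite_measure set T -> \bar R}) (w u : T -> R) :
      (forall t, 0 <= u t) -> \int[P]_t (w t * ((a < u t)%R%:R : R)) = \int[P]_t w t.
    by move=> u0; apply: eq_Rintegral => t _; rewrite (lt_le_trans a0 (u0 t)) mulr1.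
  by rewrite (e _ _ P1 w1 u1 u10) (e _ _ P2 w2 u2 u20).
(* Removing one factor [1 - exp (- n u)] leaves two integrals, with exponents [al] and [al + n];
   hence the induction is over all [al] at once. *)
have K n m al : 0 <= al ->
    \int[P1]_t (w1 t * expR (- (al * u1 t)) * (1 - expR (- (n%:R * u1 t))) ^+ m) =
    \int[P2]_t (w2 t * expR (- (al * u2 t)) * (1 - expR (- (n%:R * u2 t))) ^+ m).
  elim: m al => [|m IH] al al0.
    under eq_Rintegral do rewrite expr0 mulr1.
    by under [in RHS]eq_Rintegral do rewrite expr0 mulr1; exact: H.
  have e d (T : measurableType d) (P : {finite_measure set T -> \bar R}) (w u : T -> R) :
     bmeas w -> measurable_fun setT u -> (forall t, 0 <= u t) ->
     \int[P]_t (w t * expR (- (al * u t)) * (1 - expR (- (n%:R * u t))) ^+ m.+1) =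
     \int[P]_t (w t * expR (- (al * u t)) * (1 - expR (- (n%:R * u t))) ^+ m) -
     \int[P]_t (w t * expR (- ((al + n%:R) * u t)) * (1 - expR (- (n%:R * u t))) ^+ m).
    move=> bw mu u0; rewrite -EB.
    - apply: eq_Rintegral => t _.
      by rewrite mulrDl opprD expRD exprS; ring.
    - apply: bmeasM; first by apply: bmeasM => //; exact: bmeas_expN.
      by apply: bmeasX; apply: bmeasB; [exact: bmeas_cst|exact: bmeas_expN].
    - apply: bmeasM; first by apply: bmeasM => //; apply: bmeas_expN => //; rewrite addr_ge0.
      by apply: bmeasX; apply: bmeasB; [exact: bmeas_cst|exact: bmeas_expN].
  rewrite (e _ _ P1 _ _ bw1 mu1 u10) (e _ _ P2 _ _ bw2 mu2 u20) (IH al al0).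
  by rewrite (IH (al + n%:R)) ?addr_ge0.
have lim d (T : measurableType d) (P : {finite_measure set T -> \bar R}) (w u : T -> R) :
    bmeas w -> measurable_fun setT u -> (forall t, 0 <= u t) ->
    \int[P]_t (w t * threshold a n (u t)) @[n --> \oo] -->
    \int[P]_t (w t * ((a < u t)%R%:R : R)).
  move=> [mw [C wC]] mu u0; apply: (@bounded_cvg_E _ _ _ _ _ _ C).
  - move=> n; apply: measurable_funM => //; apply: measurable_funX.
    by have [] := bmeasB (bmeas_cst _ 1) (bmeas_expN (ler0n R n) u0 mu).
  - move=> n t; rewrite normrM; have /andP[t0 t1] := threshold_ge0 a n (u0 t).
    rewrite -[leRHS]mulr1; apply: ler_pM => //.
    by rewrite ger0_norm.
  - by move=> t; apply: cvgMl_tmp; exact: threshold_cvg.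
have e n : \int[P1]_t (w1 t * threshold a n (u1 t)) = \int[P2]_t (w2 t * threshold a n (u2 t)).
  have := K n (threshold_power a n) 0 (lexx _).
  under eq_Rintegral do rewrite mul0r oppr0 expR0 mulr1.
  by under [in X in _ = X -> _]eq_Rintegral do rewrite mul0r oppr0 expR0 mulr1.
have l1 := lim _ _ P1 _ _ bw1 mu1 u10.
have l2 := lim _ _ P2 _ _ bw2 mu2 u20.
have E : (fun n => \int[P1]_t (w1 t * threshold a n (u1 t))) =
         (fun n => \int[P2]_t (w2 t * threshold a n (u2 t))).
  by apply/funext => n; exact: e.
by rewrite E in l1; exact: (cvg_unique _ l1 l2).
Qed.

End laplace_stage.

Definition expo (R : realType) (j : nat) (al be : R) (X : state R) : R :=
  (st_k X == j)%:R * expR (- (al * st_x X)) * expR (- (be * st_y X)).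

Section expo_determine.
Context d1 d2 (T1 : measurableType d1) (T2 : measurableType d2) (R : realType).
Variables (P1 : probability T1 R) (P2 : probability T2 R).
Variables (B1 : set T1) (B2 : set T2) (h1 : T1 -> state R) (h2 : T2 -> state R).
Hypotheses (mB1 : measurable B1) (mB2 : measurable B2).
Hypotheses (mh1 : measurable_fun setT h1) (mh2 : measurable_fun setT h2).
Hypothesis H : forall j (al be : R), 0 <= al -> 0 <= be ->
  \int[P1]_t (\1_B1 t * expo j al be (h1 t)) =
  \int[P2]_t (\1_B2 t * expo j al be (h2 t)).

Lemma bmeas_st_k_eq d (T : measurableType d) (h : T -> state R) j :
  measurable_fun setT h -> bmeas (fun t => ((st_k (h t) == j)%:R : R)).
Proof.
move=> mh.
have -> : (fun t => ((st_k (h t) == j)%:R : R)) = \1_((@st_k R \o h) @^-1` [set j]).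
  apply/funext => t; rewrite indicE; congr (nat_of_bool _)%:R.
  by apply/eqP/idP; rewrite inE.
apply: bmeas_indic; apply: measurable_preimageT => //.
exact: measurableT_comp (@measurable_st_k R) mh.
Qed.

Let corner_eq1 j a b :
  \int[P1]_t (\1_B1 t * (st_k (h1 t) == j)%:R * ((a < st_x (h1 t))%R%:R : R) * ((b < st_y (h1 t))%R%:R : R)) =
  \int[P2]_t (\1_B2 t * (st_k (h2 t) == j)%:R * ((a < st_x (h2 t))%R%:R : R) * ((b < st_y (h2 t))%R%:R : R)).
Proof.
have mx1 : measurable_fun setT (fun t => st_x (h1 t)).
  exact: measurableT_comp (@measurable_st_x R) mh1.
have mx2 : measurable_fun setT (fun t => st_x (h2 t)).
  exact: measurableT_comp (@measurable_st_x R) mh2.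
have my1 : measurable_fun setT (fun t => st_y (h1 t)).
  exact: measurableT_comp (@measurable_st_y R) mh1.
have my2 : measurable_fun setT (fun t => st_y (h2 t)).
  exact: measurableT_comp (@measurable_st_y R) mh2.
have bk1 := bmeasM (bmeas_indic R mB1) (bmeas_st_k_eq j mh1).
have bk2 := bmeasM (bmeas_indic R mB2) (bmeas_st_k_eq j mh2).
(* The stage in [y] comes first, with the event on [x] inside the weight. The transforms in [y] that
   it asks for come from a second stage in [x], with [exp (- be y)] inside the weight. *)
apply: (@laplace_stage _ _ _ _ _ P1 P2
  (fun t => \1_B1 t * (st_k (h1 t) == j)%:R * ((a < st_x (h1 t))%R%:R : R))
  (fun t => \1_B2 t * (st_k (h2 t) == j)%:R * ((a < st_x (h2 t))%R%:R : R))
  _ _ _ _ my1 my2) => //.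
- by apply: bmeasM => //; exact: bmeas_gt.
- by apply: bmeasM => //; exact: bmeas_gt.
- by move=> t; exact: st_y_ge0.
- by move=> t; exact: st_y_ge0.
move=> be be0.
under eq_Rintegral do rewrite mulrAC.
under [in RHS]eq_Rintegral do rewrite mulrAC.
apply: (@laplace_stage _ _ _ _ _ P1 P2
  (fun t => \1_B1 t * (st_k (h1 t) == j)%:R * expR (- (be * st_y (h1 t))))
  (fun t => \1_B2 t * (st_k (h2 t) == j)%:R * expR (- (be * st_y (h2 t))))
  _ _ _ _ mx1 mx2) => //.
- by apply: bmeasM => //; apply: bmeas_expN => // t; exact: st_y_ge0.
- by apply: bmeasM => //; apply: bmeas_expN => // t; exact: st_y_ge0.
- by move=> t; exact: st_x_ge0.
- by move=> t; exact: st_x_ge0.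
move=> al al0; have := H j al0 be0; rewrite /expo => h.
transitivity (\int[P1]_t (\1_B1 t * ((st_k (h1 t) == j)%:R * expR (- (al * st_x (h1 t))) *
       expR (- (be * st_y (h1 t)))))).
  by apply: eq_Rintegral => t _ /=; ring.
by rewrite h; apply: eq_Rintegral => t _ /=; ring.
Qed.

Lemma expo_determine_corner (A : set (state R)) : corners A ->
  P1 (B1 `&` h1 @^-1` A) = P2 (B2 `&` h2 @^-1` A).
Proof.
move=> [j [a [b ->]]].
pose C i := [set X : state R | [/\ st_k X = i, a < st_x X & b < st_y X]].
have mC i : measurable (C i).
  have -> : C i = [set X : state R | [/\ (st_k X <= i)%N, a < st_x X & b < st_y X]]
                  `&` @st_k R @^-1` [set i].
    apply/seteqP; split => X /=; first by move=> [-> h h']; split => //; split.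
    by move=> [[_ h h'] e]; split.
  apply: measurableI; first exact: measurable_corner.
  by rewrite -[X in measurable X]setTI; exact: measurable_st_k.
have mh d (T : measurableType d) (h : T -> state R) A0 :
    measurable_fun setT h -> measurable A0 -> measurable (h @^-1` A0).
  by move=> mf mA0; rewrite -[X in measurable X]setTI; exact: mf.
have eC i : P1 (B1 `&` h1 @^-1` C i) = P2 (B2 `&` h2 @^-1` C i).
  have e d (T : measurableType d) (P : probability T R) B (h : T -> state R) :
      measurable B -> measurable_fun setT h ->
      \int[P]_t (\1_B t * (st_k (h t) == i)%:R * ((a < st_x (h t))%R%:R : R) *
        ((b < st_y (h t))%R%:R : R)) = fine (P (B `&` h @^-1` C i)).
    move=> mB mf; rewrite -E_indic; last by apply: measurableI => //; exact: mh.
    apply: eq_Rintegral => t _; rewrite !indicE in_setI -!natrM !mulnb.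
    congr (nat_of_bool _)%:R; rewrite -!andbA.
    congr (_ && _).
    apply/idP/idP; first by move=> /and4P[_ /eqP ki ax bx]; apply/mem_set; split.
    by move=> /set_mem[/= -> -> ->]; rewrite eqxx.
  have := corner_eq1 i a b; rewrite (e _ _ P1)// (e _ _ P2)// => h.
  rewrite -[LHS]fineK; last by apply: fin_num_measure; apply: measurableI => //; exact: mh.
  rewrite -[RHS]fineK; last by apply: fin_num_measure; apply: measurableI => //; exact: mh.
  by rewrite h.
have -> : [set X : state R | [/\ (st_k X <= j)%N, a < st_x X & b < st_y X]] =
    \big[setU/set0]_(i < j.+1) C i.
  rewrite -bigcup_mkord; apply/seteqP; split => X /=.
    by move=> [kj ax bx]; exists (st_k X).
  by move=> [i /= ij [ki ax bx]]; split => //; rewrite ki.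
have tC d (T : measurableType d) (B : set T) (h : T -> state R) :
    trivIset setT (fun i => B `&` h @^-1` C i).
  by move=> i i' _ _ [t [[_ [e _ _]] [_ [e' _ _]]]]; rewrite -e -e'.
have e d (T : measurableType d) (P : probability T R) B (h : T -> state R) :
    measurable B -> measurable_fun setT h ->
    P (B `&` h @^-1` (\big[setU/set0]_(i < j.+1) C i)) =
    (\sum_(i < j.+1) P (B `&` h @^-1` C i))%E.
  move=> mB mf.
  transitivity (P (\big[setU/set0]_(i < j.+1) (B `&` h @^-1` C i))).
    congr (P _); rewrite -!bigcup_mkord preimage_bigcup setI_bigcupr.
    exact: (bigcup_mkord _ (fun i => B `&` h @^-1` C i)).
  apply: (@measure_bigsetU _ _ _ P (fun i => B `&` h @^-1` C i)); last exact: tC.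
  by move=> i; apply: measurableI => //; exact: mh.
by rewrite (e _ _ P1)// (e _ _ P2)//; apply: eq_bigr => i _; exact: eC.
Qed.

Lemma expo_determine_set (A : set (state R)) : measurable A ->
  P1 (B1 `&` h1 @^-1` A) = P2 (B2 `&` h2 @^-1` A).
Proof.
pose h1' : {mfun T1 >-> state R} :=
  MeasurableFun.Pack (MeasurableFun.Class (isMeasurableFun.Build _ _ _ _ _ mh1)).
pose h2' : {mfun T2 >-> state R} :=
  MeasurableFun.Pack (MeasurableFun.Class (isMeasurableFun.Build _ _ _ _ _ mh2)).
have K (m1 m2 : {measure set (state R) -> \bar R}) :
    (forall A, measurable A -> m1 A = P1 (h1 @^-1` A `&` B1)) ->
    (forall A, measurable A -> m2 A = P2 (h2 @^-1` A `&` B2)) ->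
    forall A, measurable A -> m1 A = m2 A.
  move=> m1E m2E; apply: (measure_unique (@corners R)
    (fun n => [set X : state R | [/\ (st_k X <= n)%N, -1 < st_x X & -1 < st_y X]])).
  - exact: corners_generate.
  - exact: corners_setI.
  - by move=> i; exists i, (-1), (-1).
  - exact: bigcup_corners.
  - move=> C cC; have mC : measurable C.
      by case: cC => [j [a [b ->]]]; exact: measurable_corner.
    by rewrite m1E// m2E// 2!(setIC (_ @^-1` _)); exact: expo_determine_corner.
  - move=> k; rewrite m1E; last exact: measurable_corner.
    apply: le_lt_trans (ltry 1); apply: probability_le1; apply: measurableI => //.
    by rewrite -[X in measurable X]setTI; apply: mh1 => //; exact: measurable_corner.
move=> mA; rewrite 2!(setIC _ (_ @^-1` _)).
exact: (K (pushforward (mrestr P1 mB1) h1') (pushforward (mrestr P2 mB2) h2')).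
Qed.

End expo_determine.

Lemma measurable_mem d (T : measurableType d) (B : set T) :
  measurable B -> measurable_fun setT (fun t => t \in B).
Proof.
move=> mB; apply: (measurable_fun_bool true); rewrite setTI (_ : _ @^-1` _ = B)//.
by apply/seteqP; split => t /=; [move/set_mem|move/mem_set].
Qed.

(** Redirecting each map to [point] outside its event reduces the claim to [E_law]. The redirected
    part contributes [f point] times the mass outside the event, which is the same on both sides. *)
Lemma E_restr_law d1 d2 (T1 : measurableType d1) (T2 : measurableType d2)
    d (T : measurableType d) (R : realType)
    (P1 : probability T1 R) (P2 : probability T2 R) (B1 : set T1) (B2 : set T2)
    (h1 : T1 -> T) (h2 : T2 -> T) (f : T -> R) :
  measurable B1 -> measurable B2 ->
  measurable_fun setT h1 -> measurable_fun setT h2 -> bmeas f ->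
  (forall A, measurable A -> P1 (B1 `&` h1 @^-1` A) = P2 (B2 `&` h2 @^-1` A)) ->
  \int[P1]_t (\1_B1 t * f (h1 t)) = \int[P2]_t (\1_B2 t * f (h2 t)).
Proof.
move=> mB1 mB2 mh1 mh2 bf H.
have mb d' (T' : measurableType d') (B : set T') : measurable B ->
    measurable_fun setT (fun t => t \in B).
  exact: measurable_mem.
have P12 : P1 B1 = P2 B2.
  by have := H setT measurableT; rewrite !preimage_setT !setIT.
pose k d' (T' : measurableType d') (B : set T') (h : T' -> T) t :=
  if t \in B then h t else point.
have mk d' (T' : measurableType d') (B : set T') (h : T' -> T) :
    measurable B -> measurable_fun setT h -> measurable_fun setT (k _ _ B h).
  by move=> mB mh; apply: measurable_fun_ifT => //; exact: mb.
have E d' (T' : measurableType d') (P : probability T' R) (B : set T') (h : T' -> T) :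
    measurable B -> measurable_fun setT h ->
    \int[P]_t (\1_B t * f (h t)) = \int[P]_t f (k _ _ B h t) - f point * (1 - fine (P B)).
  move=> mB mh.
  have -> : f point * (1 - fine (P B)) = \int[P]_t (f point * (1 - \1_B t)).
    rewrite EZ ?EB ?E_cst ?E_indic//.
    - exact: bmeas_cst.
    - exact: bmeas_indic.
    - by apply: bmeasB; [exact: bmeas_cst|exact: bmeas_indic].
  rewrite -EB.
  - apply: eq_Rintegral => t _; rewrite /k indicE; case: ifP => _ /=; ring.
  - by apply: bmeas_comp bf; exact: mk.
  - by apply: bmeasM; [exact: bmeas_cst|apply: bmeasB; [exact: bmeas_cst|exact: bmeas_indic]].
rewrite (E _ _ P1)// (E _ _ P2)// P12; congr (_ - _).
apply: E_law => //; [exact: mk|exact: mk|].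
move=> A mA.
have pre d' (T' : measurableType d') (B : set T') (h : T' -> T) :
    k _ _ B h @^-1` A = (B `&` h @^-1` A) `|` (~` B `&` [set _ | A point]).
  apply/seteqP; split => t /=; rewrite /k; case: ifP => [/set_mem Bt|/negbT/negP tB].
  - by left.
  - by move=> Ap; right; split => // /mem_set.
  - by move=> [[]|[]].
  - by move=> [[/mem_set//]|[]].
have PU d' (T' : measurableType d') (P : probability T' R) (B : set T') (h : T' -> T) :
    measurable B -> measurable_fun setT h ->
    P (k _ _ B h @^-1` A) = (P (B `&` h @^-1` A) + P (~` B `&` [set _ | A point]))%E.
  move=> mB mh; rewrite pre measureU//.
  - by apply: measurableI => //; rewrite -[X in measurable X]setTI; exact: mh.
  - apply: measurableI; first exact: measurableC.
    by have [Ap|Ap] := pselect (A point); [rewrite (_ : [set _ | _] = setT)|rewrite (_ : [set _ | _] = set0)] => //;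
      apply/seteqP; split.
  - by apply/seteqP; split => // t [[Bt _] [nB _]].
transitivity (P1 (B1 `&` h1 @^-1` A) + P1 (~` B1 `&` [set _ | A point]))%E.
  exact: PU.
rewrite H//; transitivity (P2 (B2 `&` h2 @^-1` A) + P2 (~` B2 `&` [set _ | A point]))%E; last first.
  by symmetry; exact: PU.
congr (_ + _)%E; have [Ap|Ap] := pselect (A point).
  have e d' (T' : measurableType d') (B : set T') : B `&` [set _ | A point] = B.
    by apply/seteqP; split => t; [case|].
  by rewrite !e 2?probability_setC// P12.
have e d' (T' : measurableType d') (B : set T') : B `&` [set _ | A point] = set0.
  by apply/seteqP; split => t //; case.
by rewrite !e !measure0.
Qed.

(** * The noise *)

Section real_laws.
Variable R : realType.

Lemma restr_law_rays d1 d2 (T1 : measurableType d1) (T2 : measurableType d2)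
    (P1 : probability T1 R) (P2 : probability T2 R) (B1 : set T1) (B2 : set T2)
    (h1 : T1 -> R) (h2 : T2 -> R) :
  measurable B1 -> measurable B2 ->
  measurable_fun setT h1 -> measurable_fun setT h2 ->
  (forall a, P1 (B1 `&` h1 @^-1` `]a, +oo[) = P2 (B2 `&` h2 @^-1` `]a, +oo[)) ->
  forall A, measurable A -> P1 (B1 `&` h1 @^-1` A) = P2 (B2 `&` h2 @^-1` A).
Proof.
move=> mB1 mB2 mh1 mh2 H.
pose h1' : {mfun T1 >-> R} :=
  MeasurableFun.Pack (MeasurableFun.Class (isMeasurableFun.Build _ _ _ _ _ mh1)).
pose h2' : {mfun T2 >-> R} :=
  MeasurableFun.Pack (MeasurableFun.Class (isMeasurableFun.Build _ _ _ _ _ mh2)).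
have K (m1 m2 : {measure set R -> \bar R}) :
    (forall A, measurable A -> m1 A = P1 (h1 @^-1` A `&` B1)) ->
    (forall A, measurable A -> m2 A = P2 (h2 @^-1` A `&` B2)) ->
    forall A, measurable A -> m1 A = m2 A.
  move=> m1E m2E; apply: (measure_unique (RGenOInfty.G (R:=R))
    (fun k : nat => `]- (k%:R), +oo[%classic)).
  - exact: RGenOInfty.measurableE.
  - move=> _ _ [a ->] [b ->]; exists (Num.max a b); apply/seteqP; split => x /=;
      rewrite !in_itv/= !andbT gt_max; first by move=> [-> ->].
    by move=> /andP[].
  - by move=> k; exists (- k%:R).
  - rewrite -subTset => x _; exists (Num.truncn `|x|).+1 => //=; rewrite in_itv/= andbT.
    have := truncn_itv (normr_ge0 x) => /andP[_]; rewrite ltr_norml => /andP[].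
    by rewrite ltrNl.
  - move=> _ [a ->]; rewrite m1E// m2E//.
    by rewrite 2!(setIC (_ @^-1` _)); exact: H.
  - move=> k; rewrite m1E//; apply: le_lt_trans (ltry 1); apply: probability_le1.
    by apply: measurableI => //; exact: measurable_preimageT.
move=> A mA; rewrite 2!(setIC _ (_ @^-1` _)).
exact: (K (pushforward (mrestr P1 mB1) h1') (pushforward (mrestr P2 mB2) h2')).
Qed.

(* The measures below live on [R] with its default measurable structure; the
   library states them on [measurableTypeR R], a convertible copy. *)
Definition unif (A : set R) : \bar R := uniform_prob (@ltr01 R) A.

Let unif0 : unif set0 = 0%E. Proof. exact: measure0. Qed.
Let unif_ge0 A : (0 <= unif A)%E. Proof. exact: measure_ge0. Qed.
Let unif_sigma_additive : semi_sigma_additive unif.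
Proof. exact: (@measure_semi_sigma_additive _ _ _ (uniform_prob (@ltr01 R))). Qed.
HB.instance Definition _ := isMeasure.Build _ R R unif unif0 unif_ge0 unif_sigma_additive.
Let unifT : unif setT = 1%E.
Proof. exact: (@probability_setT _ _ _ (uniform_prob (@ltr01 R))). Qed.
HB.instance Definition _ := Measure_isProbability.Build _ _ _ unif unifT.

Lemma unifE (A : set R) : measurable A -> unif A = lebesgue_measure (A `&` `[0, 1]%classic).
Proof.
move=> mA; have := @integral_uniform R 0 1 (@ltr01 R) (EFin \o \1_A).
rewrite (_ : (\int[_]_x _)%E = unif A); last by rewrite integral_indic// setIT.
move=> ->.
- rewrite subr0 invr1 mul1e (_ : (\int[_]_(x in _) _)%E = lebesgue_measure (A `&` `[0, 1]%classic))//.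
  by rewrite integral_indic.
- by apply/measurable_EFinP; exact: measurable_indic.
- by move=> x; rewrite lee_fin.
Qed.

Lemma unif_itv (a b : R) (ba bb : bool) : 0 <= a -> a <= b -> b <= 1 ->
  unif [set` Interval (BSide ba a) (BSide bb b)] = (b - a)%:E.
Proof.
move=> a0 ab b1; rewrite unifE; last exact: measurable_itv.
rewrite (_ : _ `&` _ = [set` Interval (BSide ba a) (BSide bb b)]); last first.
  apply/seteqP; split => x /=; first by case.
  move=> xab; split => //; move: xab; case: ba bb => -[];
  by rewrite !in_itv/= => /andP[h1 h2]; apply/andP; split; lra.
rewrite lebesgue_measure_itv/=; case: ba bb => -[]; rewrite lte_fin lt_neqAle ab andbT;
  by case: eqVneq => //= ->; rewrite subrr.
Qed.

Lemma unif_ray_lt0 a : a < 0 -> unif `]a, +oo[%classic = 1%E.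
Proof.
move=> a0; rewrite unifE//.
rewrite (_ : _ `&` _ = `[0, 1]%classic); last first.
  apply/seteqP; split => x /=; first by case.
  by move=> x01; split => //; move: x01; rewrite !in_itv/= andbT => /andP[? ?]; lra.
by rewrite lebesgue_measure_itv/= lte_fin ltr01 oppr0 adde0.
Qed.

Lemma unif_ray_ge1 a : 1 <= a -> unif `]a, +oo[%classic = 0%E.
Proof.
move=> a0; rewrite unifE//.
rewrite (_ : _ `&` _ = set0) ?measure0//.
apply/seteqP; split => x //= [].
by rewrite !in_itv/= andbT => ? /andP[? ?]; lra.
Qed.

Lemma unif_ray a : 0 <= a <= 1 -> unif `]a, +oo[%classic = (1 - a)%:E.
Proof.
move=> /andP[a0 a1]; rewrite -(@unif_itv a 1 false false)// !unifE//.
congr lebesgue_measure; apply/seteqP; split => x /= [].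
  rewrite !in_itv/= ?andbT => ? /andP[? ?].
  by split; apply/andP; split; lra.
rewrite !in_itv/= ?andbT => /andP[? ?] /andP[? ?].
by split; [|apply/andP; split]; lra.
Qed.

Lemma unif01 : unif `[0, 1]%classic = 1%E.
Proof. by rewrite unif_itv// subr0. Qed.

Lemma unif_setI (A : set R) : measurable A -> unif (A `&` `[0, 1]%classic) = unif A.
Proof. by move=> mA; rewrite !unifE//; [rewrite -setIA setIid|exact: measurableI]. Qed.

Lemma unif_eqI (A B : set R) : measurable A -> measurable B ->
  (forall x, 0 <= x <= 1 -> (A x <-> B x)) -> unif A = unif B.
Proof.
move=> mA mB AB; rewrite -(unif_setI mA) -(unif_setI mB).
congr unif; apply/seteqP; split => x /= [h h'].
  by split => //; apply/AB => //; move: h'; rewrite in_itv.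
by split => //; apply/AB => //; move: h'; rewrite in_itv.
Qed.

Lemma E_unif_lt (p : R) : 0 <= p <= 1 ->
  \int[unif]_v ((v < p)%R%:R : R) = p.
Proof.
move=> p01; have -> : (fun v => ((v < p)%R%:R : R)) = \1_(`]-oo, p[%classic : set R).
  apply/funext => v; rewrite indicE; congr (nat_of_bool _)%:R.
  by apply/idP/idP; rewrite inE/= in_itv/=.
have /andP[p0 p1] := p01.
transitivity (fine (unif `]-oo, p[%classic)); first exact: E_indic.
rewrite (@unif_eqI _ `[0, p[%classic)//; first by rewrite unif_itv//= subr0.
by move=> x /andP[x0 x1] /=; rewrite !in_itv/= x0.
Qed.

End real_laws.

(** * Independent uniform numbers from the binary digits of one number *)

Section bits.
Variable R : realType.
Local Notation U := (@unif R).

Definition bit (x : R) : bool := 1 / 2 <= x.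
Definition doubling (x : R) : R := 2 * x - (bit x)%:R.

Lemma measurable_bit : measurable_fun setT bit.
Proof. by apply: measurable_fun_ler => //; exact: measurable_cst. Qed.

Lemma measurable_bitR : measurable_fun setT (fun x => ((bit x)%:R : R)).
Proof.
rewrite (_ : (fun _ => _) = (fun x => if bit x then 1 else 0 : R)).
  by apply: measurable_fun_ifT; [exact: measurable_bit|exact: measurable_cst..].
by apply/funext => x; case: bit.
Qed.

Lemma measurable_doubling : measurable_fun setT doubling.
Proof.
apply: measurable_funB; last exact: measurable_bitR.
by apply: measurable_funM => //; exact: measurable_cst.
Qed.

Lemma measurable_bit_set (b : bool) : measurable [set x | bit x = b].
Proof. exact: (measurable_preimageT measurable_bit (A := [set b])). Qed.

(** Up to an endpoint, doubling maps each half of [[0, 1]] affinely onto [[0, 1]], so a ray pulls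
    back to a piece of half its measure: the first digit is a fair coin independent of the rest. *)
Lemma doubling_ray (b : bool) a :
  U ([set x | bit x = b] `&` doubling @^-1` `]a, +oo[%classic) =
  ((fine (U `]a, +oo[%classic)) / 2)%:E.
Proof.
have m1 : measurable ([set x | bit x = b] `&` doubling @^-1` `]a, +oo[%classic).
  apply: measurableI; first exact: measurable_bit_set.
  by apply: measurable_preimageT => //; exact: measurable_doubling.
have [a0|a0] := ltP a 0.
  rewrite unif_ray_lt0//=; case: b m1 => m1.
    rewrite (@unif_eqI _ _ `[1/2, 1]%classic)//; first by rewrite unif_itv//=; [congr EFin|..]; lra.
    move=> x /andP[x0 x1] /=; rewrite !in_itv/= andbT /doubling /bit; split.
      by move=> [-> _]; rewrite x1.
    by move=> /andP[h _]; rewrite h; split => //=; lra.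
  rewrite (@unif_eqI _ _ `[0, 1/2[%classic)//; first by rewrite unif_itv//=; [congr EFin|..]; lra.
  move=> x /andP[x0 x1] /=; rewrite !in_itv/= andbT /doubling /bit x0/=; split.
    by move=> [/negbT]; rewrite -ltNge.
  by rewrite ltNge => /negbTE h; rewrite h; split => //=; lra.
have [a1|a1] := leP a 1.
  rewrite unif_ray ?a0//=; case: b m1 => m1.
    rewrite (@unif_eqI _ _ `](1 + a)/2, 1]%classic)//; first by rewrite unif_itv//=; [congr EFin|..]; lra.
    move=> x /andP[x0 x1] /=; rewrite !in_itv/= andbT /doubling /bit; split.
      by move=> [-> /= ?]; rewrite x1 andbT; lra.
    move=> /andP[h _]; have h' : 1 / 2 <= x by lra.
    by rewrite h'; split => //=; lra.
  rewrite (@unif_eqI _ _ `]a/2, 1/2[%classic)//; first by rewrite unif_itv//=; [congr EFin|..]; lra.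
  move=> x /andP[x0 x1] /=; rewrite !in_itv/= andbT /doubling /bit; split.
    by move=> [h]; move/negbT : (h); rewrite -ltNge h => -> /= ?; rewrite andbT; lra.
  by move=> /andP[h h']; move: (h'); rewrite ltNge => /negbTE ->; split => //=; lra.
rewrite unif_ray_ge1 ?(ltW a1)//= mul0r.
rewrite (@unif_eqI _ _ set0)// ?measure0// => x /andP[x0 x1] /=; split => // -[].
rewrite in_itv/= andbT /doubling; case: b {m1} => e; rewrite e /=; first lra.
by move/negbT : e; rewrite -ltNge; lra.
Qed.

Lemma bit_indic (b : bool) x : \1_[set x | bit x = b] x = (bit x == b)%:R :> R.
Proof.
rewrite indicE; congr (nat_of_bool _)%:R.
by apply/idP/eqP => [/set_mem|e]; [|apply/mem_set].
Qed.

Lemma E_doubling (f : bool -> R -> R) : (forall b, bmeas (f b)) ->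
  \int[U]_x f (bit x) (doubling x) =
  2^-1 * \int[U]_x f false x + 2^-1 * \int[U]_x f true x.
Proof.
move=> bf.
have mD := measurable_doubling.
have halves (g : R -> R) : bmeas g ->
    \int[U]_x (\1_[set x | bit x = false] x * g (doubling x)) =
    \int[U]_x (\1_[set x | bit x = true] x * g (doubling x)).
  move=> bg; apply: E_restr_law => //; try exact: measurable_bit_set.
  apply: restr_law_rays => //; try exact: measurable_bit_set.
  by move=> a; exact: etrans (doubling_ray false a) (esym (doubling_ray true a)).
have whole (g : R -> R) : bmeas g -> \int[U]_x g (doubling x) = \int[U]_x g x.
  move=> bg; apply: E_law => //.
  move=> A mA.
  suff H0 a : U ([set: R] `&` doubling @^-1` `]a, +oo[%classic) =
              U ([set: R] `&` id @^-1` `]a, +oo[%classic).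
    have := @restr_law_rays R _ _ _ _ U U setT setT doubling id measurableT measurableT
      measurable_doubling (@measurable_id _ _ setT) H0 A mA.
    by rewrite !setTI.
  rewrite !setTI.
  rewrite (_ : doubling @^-1` `]a, +oo[%classic =
    ([set x | bit x = false] `&` doubling @^-1` `]a, +oo[%classic) `|`
    ([set x | bit x = true] `&` doubling @^-1` `]a, +oo[%classic)); last first.
    rewrite -setIUl (_ : _ `|` _ = setT) ?setTI//.
    by apply/seteqP; split => x //= _; case: (bit x); [right|left].
  rewrite measureU.
  - rewrite [X in (X + _)%E](doubling_ray false a) [X in (_ + X)%E](doubling_ray true a).
    by rewrite preimage_id -EFinD -splitr fineK// fin_num_measure.
  - apply: measurableI; first exact: measurable_bit_set.
    exact: measurable_preimageT.
  - apply: measurableI; first exact: measurable_bit_set.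
    exact: measurable_preimageT.
  - by apply/seteqP; split => // x [[/= -> _] [? _]].
have bi b : bmeas (\1_[set x | bit x = b] : R -> R).
  by apply: bmeas_indic; exact: measurable_bit_set.
have bd g : bmeas g -> bmeas (fun x => g (doubling x)) by move=> bg; exact: bmeas_comp bg.
have half (g : R -> R) b : bmeas g ->
    \int[U]_x (\1_[set x | bit x = b] x * g (doubling x)) = 2^-1 * \int[U]_x g x.
  move=> bg; rewrite -(whole g bg).
  have -> : \int[U]_x g (doubling x) =
     \int[U]_x (\1_[set x | bit x = false] x * g (doubling x)) +
     \int[U]_x (\1_[set x | bit x = true] x * g (doubling x)).
    rewrite -ED; [|by apply: bmeasM => //; exact: bd..].
    apply: eq_Rintegral => x _; rewrite -mulrDl -[LHS]mul1r; congr (_ * _).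
    by rewrite !bit_indic; case: (bit x); rewrite /= ?add0r ?addr0.
  by case: b; rewrite (halves g bg); field.
rewrite -(half _ false (bf false)) -(half _ true (bf true)) -ED.
- apply: eq_Rintegral => x _; rewrite !bit_indic.
  by case: (bit x); rewrite /= ?mul0r ?mul1r ?add0r ?addr0.
- by apply: bmeasM => //; exact: bd.
- by apply: bmeasM => //; exact: bd.
Qed.

End bits.

Section interleaving.
Variable R : realType.
Local Notation U := (@unif R).
Local Notation D := (@doubling R).

(* [psum N x] reads off the even-numbered binary digits of [x]. *)
Fixpoint psum (N : nat) (x : R) : R :=
  if N is N'.+1 then ((bit x)%:R + psum N' (D (D x))) / 2 else 0.

Lemma psum01 N x : 0 <= psum N x <= 1.
Proof.
elim: N x => [|N IH] x; first by rewrite /= lexx ler01.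
have /andP[h1 h2] := IH (D (D x)); rewrite /=; case: (bit x) => /=; apply/andP; split; lra.
Qed.

Lemma psum_nondecreasing x : nondecreasing_seq (psum ^~ x).
Proof.
apply/nondecreasing_seqP => n; elim: n x => [|n IH] x.
  by have /andP[] := psum01 1 x.
rewrite [leLHS]/= [leRHS]/= ler_pM2r ?invr_gt0// lerD2l; exact: IH.
Qed.

Lemma measurable_psum N : measurable_fun setT (psum N).
Proof.
elim: N => [|N IH]; first exact: measurable_cst.
apply: measurable_funM; last exact: measurable_cst.
apply: measurable_funD; first exact: measurable_bitR.
apply: (measurableT_comp IH).
exact: (measurableT_comp (@measurable_doubling R) (@measurable_doubling R)).
Qed.

(** The partial sums increase, so the series converges at every point, without exceptional set. *)
Definition psi (x : R) : R := sup (range (psum ^~ x)).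

Lemma psum_cvg x : psum N x @[N --> \oo] --> psi x.
Proof.
apply: nondecreasing_cvgn; first exact: psum_nondecreasing.
by exists 1 => _ [N _ <-]; have /andP[] := psum01 N x.
Qed.

Lemma measurable_psi : measurable_fun setT psi.
Proof.
apply: (measurable_fun_cvg (h := psum)); first by move=> n; exact: measurable_psum.
by move=> x _; exact: psum_cvg.
Qed.

Lemma psi01 x : 0 <= psi x <= 1.
Proof.
have cv := @psum_cvg x; rewrite -(cvg_lim _ cv)//; apply/andP; split.
  apply: limr_ge; first by apply/cvg_ex; eexists; exact: cv.
  by apply: nearW => n; have /andP[] := psum01 n x.
apply: limr_le; first by apply/cvg_ex; eexists; exact: cv.
by apply: nearW => n; have /andP[] := psum01 n x.
Qed.

Lemma psi_rec x : psi x = ((bit x)%:R + psi (D (D x))) / 2.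
Proof.
have cv1 : psum N.+1 x @[N --> \oo] --> psi x by rewrite (cvg_shiftS (psum ^~ x)); exact: psum_cvg.
have cv2 : psum N.+1 x @[N --> \oo] --> ((bit x)%:R + psi (D (D x))) / 2.
  rewrite /=; apply: cvgMr_tmp; apply: cvgD; first exact: cvg_cst.
  exact: psum_cvg.
exact: (cvg_unique _ cv1 cv2).
Qed.

Definition psi2 (x : R) : R := psi (D x).

Lemma measurable_psi2 : measurable_fun setT psi2.
Proof. exact: (measurableT_comp measurable_psi (@measurable_doubling R)). Qed.

Let tail (p : R) : R := if p < 0 then 1 else if p < 1 then 1 - p else 0.

Let tail_unif p : unif `]p, +oo[%classic = (tail p)%:E.
Proof.
rewrite /tail; case: ltP => p0; first by rewrite unif_ray_lt0.
by case: ltP => p1; [rewrite unif_ray// p0 ltW|rewrite unif_ray_ge1].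
Qed.

Let tail_rec p : tail p = 2^-1 * tail (2 * p) + 2^-1 * tail (2 * p - 1).
Proof.
rewrite /tail; case: (ltP p 0) => ?; case: (ltP p 1) => ?;
case: (ltP (2 * p) 0) => ?; case: (ltP (2 * p) 1) => ?;
case: (ltP (2 * p - 1) 0) => ?; case: (ltP (2 * p - 1) 1) => ?; lra.
Qed.

Let tail01 p : 0 <= tail p <= 1.
Proof. by rewrite /tail; case: ltP => ?; [|case: ltP => ?]; apply/andP; split; lra. Qed.

Let gt1 (p x : R) : R := (p < x)%R%:R.

Let bgt1 (h : R -> R) p : measurable_fun setT h -> bmeas (fun x => gt1 p (h x)).
Proof. exact: bmeas_gt. Qed.

Let G p q := \int[U]_x (gt1 p (psi x) * gt1 q (psi2 x)).

Let bG p q : bmeas (fun x => gt1 p (psi x) * gt1 q (psi2 x)).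
Proof.
by apply: bmeasM; apply: bgt1; [exact: measurable_psi|exact: measurable_psi2].
Qed.

Let gt1_lt0 p x : p < 0 -> 0 <= x -> gt1 p x = 1.
Proof. by move=> p0 x0; rewrite /gt1 (lt_le_trans p0 x0). Qed.

Let gt1_ge1 p x : 1 <= p -> x <= 1 -> gt1 p x = 0.
Proof. by move=> p1 x1; rewrite /gt1 ltNge (le_trans x1 p1). Qed.

(** Conditioning on the first digit: it is the leading digit of [psi x], and in [D x] the two
    subsequences of digits have exchanged their roles. Hence [q] moves to the first place on the
    right. *)
Let G_rec p q : G p q = 2^-1 * G q (2 * p) + 2^-1 * G q (2 * p - 1).
Proof.
pose f (b : bool) y := gt1 p ((b%:R + psi2 y) / 2) * gt1 q (psi y).
have bf b : bmeas (f b).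
  apply: bmeasM; apply: bgt1; last exact: measurable_psi.
  apply: measurable_funM => //; apply: measurable_funD => //.
  exact: measurable_psi2.
have -> : G p q = \int[U]_x f (bit x) (D x).
  by apply: eq_Rintegral => x _; rewrite /f /psi2 -psi_rec.
rewrite E_doubling//; congr (_ * _ + _ * _); apply: eq_Rintegral => x _; rewrite /f mulrC;
  congr (_ * _); rewrite /gt1; congr (nat_of_bool _)%:R; apply/idP/idP => /=; lra.
Qed.

Let G_ge1l p q : 1 <= p -> G p q = 0.
Proof.
move=> p1; rewrite /G -[RHS](E_cst U); apply: eq_Rintegral => x _.
by rewrite gt1_ge1 ?mul0r//; have /andP[] := psi01 x.
Qed.

Let G_ge1r p q : 1 <= q -> G p q = 0.
Proof.
move=> p1; rewrite /G -[RHS](E_cst U); apply: eq_Rintegral => x _.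
by rewrite (@gt1_ge1 q) ?mulr0//; have /andP[] := psi01 (D x).
Qed.

Let G_lt0r p q : q < 0 -> G p q = G p (-1).
Proof.
move=> q0; apply: eq_Rintegral => x _.
by rewrite !(@gt1_lt0 _ (psi2 x))//; have /andP[] := psi01 (D x).
Qed.

Let G_lt0l p q : p < 0 -> G p q = G (-1) q.
Proof.
move=> q0; apply: eq_Rintegral => x _.
by rewrite !(@gt1_lt0 _ (psi x))//; have /andP[] := psi01 x.
Qed.

Let G_lt0 : G (-1) (-1) = 1.
Proof.
rewrite -[RHS](E_cst U); apply: eq_Rintegral => x _.
have /andP[? _] := psi01 x; have /andP[? _] := psi01 (D x).
by rewrite !gt1_lt0 ?mulr1//; lra.
Qed.

Let G01 p q : 0 <= G p q <= 1.
Proof.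
apply/andP; split.
  by apply: Rintegral_ge0 => x _; rewrite mulr_ge0.
rewrite -[leRHS](E_cst U); apply: le_E => //; first exact: bmeas_cst.
by move=> x; rewrite /gt1; case: (_ < _); case: (_ < _); rewrite /= ?mul0r ?mulr0 ?mulr1.
Qed.

(** The defect of being two independent uniform numbers. [G] and the product of the tails obey the
    same recursion, and therefore so does their difference. *)
Let d p q := G p q - tail p * tail q.

Let d_rec p q : d p q = 2^-1 * d q (2 * p) + 2^-1 * d q (2 * p - 1).
Proof. by rewrite /d G_rec (tail_rec p); ring. Qed.

Let tail_ge1 p : 1 <= p -> tail p = 0.
Proof. by rewrite /tail => p1; case: ltP => ?; [lra|case: ltP => ?]; lra. Qed.

Let tail_lt0 p : p < 0 -> tail p = 1.
Proof. by rewrite /tail => ->. Qed.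

Let d_ge1r p q : 1 <= q -> d p q = 0.
Proof. by move=> q1; rewrite /d G_ge1r// (tail_ge1 q1) mulr0 subrr. Qed.

Let d_lt0r p q : q < 0 -> d p q = d p (-1).
Proof. by move=> q0; rewrite /d G_lt0r// (tail_lt0 q0) (@tail_lt0 (-1))//; lra. Qed.

Let d_bound p q : `|d p q| <= 2.
Proof.
have /andP[? ?] := G01 p q; have /andP[? ?] := tail01 p; have /andP[? ?] := tail01 q.
rewrite ler_norml /d; apply/andP; split; nra.
Qed.

Let half01 : 0 <= (2^-1 : R) < 1.
Proof. apply/andP; split; lra. Qed.

(** Two steps of the recursion bring the marginal of [psi] back to itself with a factor one half:
    either [2 p - 1 < 0] or [2 p >= 1], and the corresponding term vanishes. *)
Let d_marginal p : d p (-1) = 0.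
Proof.
apply: (@contraction0 R R (fun=> True) (fun p => d p (-1)) 2^-1 2 half01) => //.
move=> E E0 H {}p _; rewrite d_rec.
have [ph|ph] := ltP p (1 / 2).
  rewrite (@d_lt0r _ (2 * p - 1)); last by lra.
  have -> : d (-1) (-1) = 0 by rewrite /d G_lt0 tail_lt0 ?mulr1 ?subrr//; lra.
  rewrite mulr0 addr0 d_rec (@d_lt0r _ (2 * -1)); last by lra.
  rewrite (@d_lt0r _ (2 * -1 - 1)); last by lra.
  have -> : 2^-1 * (2^-1 * d (2 * p) (-1) + 2^-1 * d (2 * p) (-1)) = 2^-1 * d (2 * p) (-1) by lra.
  rewrite normrM ger0_norm; last by lra.
  by apply: ler_wpM2l; [lra|exact: H].
rewrite (@d_ge1r _ (2 * p)); last by lra.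
rewrite mulr0 add0r d_rec (@d_lt0r _ (2 * -1)); last by lra.
rewrite (@d_lt0r _ (2 * -1 - 1)); last by lra.
have -> : 2^-1 * (2^-1 * d (2 * p - 1) (-1) + 2^-1 * d (2 * p - 1) (-1)) = 2^-1 * d (2 * p - 1) (-1) by lra.
rewrite normrM ger0_norm; last by lra.
by apply: ler_wpM2l; [lra|exact: H].
Qed.

(** One of the two terms of the recursion is always zero: [2 p >= 1] makes the event empty, and
    [2 p - 1 < 0] reduces to the marginal. The other term carries the factor one half. *)
Let d_zero p q : d p q = 0.
Proof.
apply: (@contraction0 R (R * R)%type (fun=> True) (fun pq => d pq.1 pq.2) 2^-1 2 half01 _ _ (p, q)) => //.
move=> E E0 H {}p _; rewrite d_rec.
have [ph|ph] := ltP p.1 (1 / 2).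
  rewrite (@d_lt0r _ (2 * p.1 - 1)); last by lra.
  rewrite d_marginal mulr0 addr0 normrM ger0_norm; last by lra.
  by apply: ler_wpM2l; [lra|exact: (H (_, _))].
rewrite (@d_ge1r _ (2 * p.1)); last by lra.
rewrite mulr0 add0r normrM ger0_norm; last by lra.
by apply: ler_wpM2l; [lra|exact: (H (_, _))].
Qed.

Let law_rays p q :
  U (psi2 @^-1` `]q, +oo[%classic `&` psi @^-1` `]p, +oo[%classic) = (tail p * tail q)%:E.
Proof.
have m : measurable (psi2 @^-1` `]q, +oo[%classic `&` psi @^-1` `]p, +oo[%classic).
  apply: measurableI; apply: measurable_preimageT => //; [exact: measurable_psi2|exact: measurable_psi].
rewrite -[LHS]fineK; last exact: fin_num_measure.
congr EFin; rewrite -[X in _ = X](subrK (G p q)) -opprB -/(d p q) d_zero oppr0 add0r /G.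
rewrite -(E_indic U m); apply: eq_Rintegral => x _.
rewrite /gt1 -natrM mulnb indicE; congr (nat_of_bool _)%:R.
apply/idP/andP => [/set_mem[]|[h1 h2]]; first by rewrite /= !in_itv/= !andbT.
by apply/mem_set; split; rewrite /= in_itv/= andbT.
Qed.

(** Rays are replaced by measurable sets in one coordinate at a time, while the other coordinate is
    kept as a conditioning event. *)
Let law_rect A B : measurable A -> measurable B ->
  U (psi @^-1` A `&` psi2 @^-1` B) = (U A * U B)%E.
Proof.
move=> mA mB.
have mp := measurable_psi; have mp2 := measurable_psi2.
pose P2 : {measure set (R * R)%type -> \bar R} := (U \x U)%E.
have mfst : measurable_fun setT (fst : R * R -> R) by exact: measurable_fst.
have msnd : measurable_fun setT (snd : R * R -> R) by exact: measurable_snd.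
have P2E A' B' : measurable A' -> measurable B' ->
    P2 (fst @^-1` A' `&` snd @^-1` B') = (U A' * U B')%E.
  move=> mA' mB'; transitivity (P2 (A' `*` B')); last exact: product_measure1E.
  by congr (P2 _); apply/seteqP; split => -[x y].
have s1 q : U (psi2 @^-1` `]q, +oo[%classic `&` psi @^-1` A) =
    (U \x U)%E (snd @^-1` `]q, +oo[%classic `&` fst @^-1` A).
  apply: restr_law_rays => //; first exact: measurable_preimageT.
    exact: measurable_preimageT.
  move=> p; apply: etrans (law_rays p q) _; rewrite EFinM -!tail_unif.
  by rewrite setIC; exact: esym (P2E _ _ _ _).
have : U (psi @^-1` A `&` psi2 @^-1` B) = (U \x U)%E (fst @^-1` A `&` snd @^-1` B).
  apply: restr_law_rays => //; first exact: measurable_preimageT.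
    exact: measurable_preimageT.
  by move=> q; rewrite 2!(setIC (_ @^-1` A)); exact: s1.
by move=> ->; exact: P2E.
Qed.

Lemma E_interleave (f : R * R -> R) : bmeas f ->
  \int[U]_x f (psi x, psi2 x) = \int[U]_v \int[U]_w f (v, w).
Proof.
move=> bf; rewrite -E_prod//.
have mh : measurable_fun setT (fun x => (psi x, psi2 x)).
  by apply: measurable_fun_pair; [exact: measurable_psi|exact: measurable_psi2].
pose h' : {mfun R >-> (R * R)%type} :=
  MeasurableFun.Pack (MeasurableFun.Class (isMeasurableFun.Build _ _ _ _ _ mh)).
have K (m : {measure set (R * R)%type -> \bar R}) :
    (forall A, measurable A -> m A = U (h' @^-1` A)) ->
    forall A, measurable A -> (U \x U)%E A = m A.
  move=> mE; apply: product_measure_unique => A B mA mB.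
  by rewrite mE; [exact: law_rect|exact: measurableX].
pose P2 : probability (R * R)%type R := (U \x U)%E.
apply: (@E_law _ _ _ R _ _ _ U P2 (fun x => (psi x, psi2 x)) id f) => // A mA.
rewrite preimage_id; apply: esym.
exact: (K (pushforward U h')).
Qed.

End interleaving.

Section null_sets.
Context d (T : measurableType d) (R : realType).
Variable P : {finite_measure set T -> \bar R}.

Lemma E_null (B : set T) (f : T -> R) : measurable B -> P B = 0%E -> bmeas f ->
  \int[P]_x (\1_B x * f x) = 0.
Proof.
move=> mB PB bf; have [mf [C fC]] := bf.
apply/eqP; rewrite -normr_le0.
have -> : 0 = \int[P]_x (C * \1_B x) by rewrite EZ ?E_indic ?PB ?mulr0//; exact: bmeas_indic.
apply: norm_E_le.
- by apply: bmeasM => //; exact: bmeas_indic.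
- by apply: bmeasM; [exact: bmeas_cst|exact: bmeas_indic].
- by move=> x; rewrite normrM mulrC (ger0_norm (_ : 0 <= \1_B x))// ler_wpM2r.
Qed.

Lemma E_ae (B : set T) (f g : T -> R) : measurable B -> P (~` B) = 0%E ->
  bmeas f -> bmeas g -> (forall x, B x -> f x = g x) ->
  \int[P]_x f x = \int[P]_x g x.
Proof.
move=> mB PB bf bg fg.
apply/eqP; rewrite -subr_eq0 -EB//; apply/eqP.
rewrite -[RHS](E_null (measurableC mB) PB (bmeasB bf bg)).
apply: eq_Rintegral => x _; rewrite indicE.
have [nBx|/negP nBx] := boolP (x \in ~` B); first by rewrite mul1r.
rewrite mul0r fg ?subrr//; apply: contrapT => Bx; apply: nBx; exact/mem_set.
Qed.

End null_sets.

(** * Exponential waiting times and Lebesgue measure on segments *)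

Section exponential_law.
Variable R : realType.
Variable c : {posnum R}.

Definition expl (A : set R) : \bar R := exponential_prob c%:num A.

Let expl0 : expl set0 = 0%E. Proof. by rewrite /expl /exponential_prob integral_set0. Qed.
Let expl_ge0 A : (0 <= expl A)%E.
Proof.
apply: integral_ge0 => x _.
by rewrite lee_fin exponential_pdf_ge0.
Qed.
Let expl_sigma_additive : semi_sigma_additive expl.
Proof.
have c0 : 0 < c%:num by [].
have H := @measure_semi_sigma_additive _ _ _ (exponential_prob c%:num).
exact: (H c0).
Qed.
HB.instance Definition _ := isMeasure.Build _ R R expl expl0 expl_ge0 expl_sigma_additive.
Let explT : expl setT = 1%E.
Proof. exact: integral_exponential_pdf. Qed.
HB.instance Definition _ := Measure_isProbability.Build _ _ _ expl explT.

(** A finite measure on the whole line, so that the rules for [bmeas] apply to time integrals; it is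
    null for [T < 0]. *)
Definition lebI (T : R) (A : set R) : \bar R := lebesgue_measure (A `&` `[0, T]%classic).

Let lebI0 T : lebI T set0 = 0%E. Proof. by rewrite /lebI set0I measure0. Qed.
Let lebI_ge0 T A : (0 <= lebI T A)%E. Proof. exact: measure_ge0. Qed.
Let lebI_sigma_additive T : semi_sigma_additive (lebI T).
Proof.
exact: (@measure_semi_sigma_additive _ _ _ (mrestr lebesgue_measure (@measurable_itv R `[0, T]))).
Qed.
HB.instance Definition _ T := isMeasure.Build _ R R (lebI T) (lebI0 T) (lebI_ge0 T) (@lebI_sigma_additive T).
Let lebI_fin T : fin_num_fun (lebI T).
Proof.
move=> A mA; rewrite ge0_fin_numE; last exact: lebI_ge0.
apply: (@le_lt_trans _ _ (lebesgue_measure `[0, T]%classic)).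
  by apply: le_measure; rewrite ?inE//; apply: measurableI => //; exact: measurable_itv.
by rewrite lebesgue_measure_itv/=; case: ifP => _; rewrite ltry.
Qed.
HB.instance Definition _ T := Measure_isFinite.Build _ _ _ (lebI T) (@lebI_fin T).

Lemma leb_fin T : (lebesgue_measure (`[0%R, T]%classic : set R) < +oo)%E.
Proof. by rewrite lebesgue_measure_itv/=; case: ifP => _; rewrite ltry. Qed.

Lemma bmeas_leb_integrable T (f : R -> R) : bmeas f ->
  lebesgue_measure.-integrable (`[0, T]%classic : set R) (EFin \o f).
Proof.
move=> [mf [C fC]]; apply: measurable_bounded_integrable => //.
- exact: leb_fin.
- exact: measurable_funTS.
- exists C; split; first exact: num_real.
  by move=> y Cy x _; apply: le_trans (fC x) (ltW Cy).
Qed.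

Lemma lebIE T (f : R -> R) : bmeas f ->
  \int[lebesgue_measure]_(q in `[0, T]) f q = \int[lebI T]_q f q.
Proof.
apply: (@bmeas_ext _ _ R (fun f => \int[lebesgue_measure]_(q in `[0, T]) f q)
  (fun f => \int[lebI T]_q f q)); last 1 first.
- move=> A mA; transitivity (fine (lebI T A)); last by rewrite E_indic.
  by rewrite /lebI /Rintegral integral_indic//; exact: measurable_itv.
- split.
  + by move=> f1 f2 b1 b2; rewrite RintegralD//; exact: bmeas_leb_integrable.
  + by move=> r f1 b1; rewrite RintegralZl//; exact: bmeas_leb_integrable.
  + by move=> f1 f2 b1 b2 f12; apply: le_Rintegral => //; exact: bmeas_leb_integrable.
- by have := @E_functional _ _ R (lebI T).
Qed.

Lemma expl_itv0c T : 0 <= T -> expl `[0, T]%classic = (1 - expR (- (c%:num * T)))%:E.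
Proof.
rewrite le_eqVlt => /predU1P[<-|T0].
  by rewrite mulr0 oppr0 expR0 subrr set_itv1 /expl /exponential_prob integral_set1.
by rewrite /expl exponential_prob_itv0c// mulNr.
Qed.

Lemma expl_lt0 : expl `]-oo, 0[%classic = 0%E.
Proof.
rewrite /expl /exponential_prob; apply: integral0_eq => x /=.
by rewrite in_itv/= => x0; rewrite lt0_exponential_pdf.
Qed.

Lemma expl_le T : 0 <= T -> expl `]-oo, T]%classic = (1 - expR (- (c%:num * T)))%:E.
Proof.
move=> T0; rewrite -(expl_itv0c T0) (_ : `]-oo, T]%classic = `]-oo, 0[%classic `|` `[0, T]%classic).
  rewrite measureU//= ?expl_lt0 ?add0e//.
  by apply/seteqP; split => // x /= []; rewrite !in_itv/= => ? /andP[? ?]; lra.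
apply/seteqP; split => x /=; rewrite !in_itv/=.
  by move=> xT; case: (ltP x 0) => x0; [left|right].
by move=> [?|/andP[? ?]]//; lra.
Qed.

Lemma expl_ray a : 0 <= a -> expl `]a, +oo[%classic = (expR (- (c%:num * a)))%:E.
Proof.
move=> a0; have -> : `]a, +oo[%classic = ~` `]-oo, a]%classic.
  by rewrite setCitvl.
by rewrite probability_setC// [X in (1 - X)%E](expl_le a0) -EFinD; congr EFin; lra.
Qed.

Lemma expl_ray_lt0 a : a < 0 -> expl `]a, +oo[%classic = 1%E.
Proof.
move=> a0; have -> : `]a, +oo[%classic = ~` `]-oo, a]%classic.
  by rewrite setCitvl.
rewrite probability_setC// (_ : measure_function.Measure.sort _ _ = 0%E) ?sube0//.
apply: (@subset_measure0 _ _ _ expl _ `]-oo, 0[%classic) => //; last exact: expl_lt0.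
by move=> x /=; rewrite !in_itv/= => ?; lra.
Qed.

Lemma expl_pos : expl (~` `]0, +oo[%classic) = 0%E.
Proof. by rewrite probability_setC// [X in (1 - X)%E](expl_ray (lexx 0)) mulr0 oppr0 expR0 subee. Qed.

Lemma bmeas_le (T : R) : bmeas (fun t : R => ((t <= T)%R%:R : R)).
Proof.
have -> : (fun t => ((t <= T)%R%:R : R)) = \1_(`]-oo, T]%classic : set R).
  apply/funext => v; rewrite indicE; congr (nat_of_bool _)%:R.
  by apply/idP/idP; rewrite inE/= in_itv/=.
exact: bmeas_indic.
Qed.

Lemma E_expl_le T : 0 <= T -> \int[expl]_t ((t <= T)%R%:R : R) = 1 - expR (- (c%:num * T)).
Proof.
move=> T0; have -> : (fun t => ((t <= T)%R%:R : R)) = \1_(`]-oo, T]%classic : set R).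
  apply/funext => v; rewrite indicE; congr (nat_of_bool _)%:R.
  by apply/idP/idP; rewrite inE/= in_itv/=.
by transitivity (fine (expl `]-oo, T]%classic)); [exact: E_indic|rewrite expl_le].
Qed.

(** Truncated at [0] in order to be bounded on the whole line; it is integrated only against
    measures that do not charge negative numbers. *)
Definition decay (q : R) : R := expR (- (c%:num * Num.max 0 q)).

Lemma bmeas_decay : bmeas decay.
Proof.
apply: (bmeas_expN (u := fun q : R => Num.max 0 q)) => //.
- by move=> q; rewrite le_max lexx.
- by apply: measurable_maxr => //; exact: measurable_cst.
Qed.

Lemma decayE q : 0 <= q -> decay q = expR (- (c%:num * q)).
Proof. by move=> q0; rewrite /decay max_r. Qed.

Lemma E_expl_density T (f : R -> R) : bmeas f ->
  \int[expl]_t (\1_(`[0, T]%classic) t * f t) = c%:num * \int[lebI T]_q (decay q * f q).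
Proof.
have bI : bmeas (\1_(`[0, T]%classic : set R) : R -> R) by apply: bmeas_indic; exact: measurable_itv.
have c0 : 0 <= c%:num by [].
have e (f0 : R -> R) : bmeas f0 -> c%:num * \int[lebI T]_q (decay q * f0 q) =
    \int[lebI T]_q (c%:num * decay q * f0 q).
  move=> b0; rewrite -EZ; last by apply: bmeasM => //; exact: bmeas_decay.
  by apply: eq_Rintegral => q _; rewrite mulrA.
have bcd : bmeas (fun q => c%:num * decay q) by apply: bmeasM; [exact: bmeas_cst|exact: bmeas_decay].
move=> bf; rewrite e//; move: f bf.
apply: (@bmeas_ext _ _ R (fun f => \int[expl]_t (\1_(`[0, T]%classic) t * f t))
  (fun f => \int[lebI T]_q (c%:num * decay q * f q))).
- by apply: (@EM_functional _ _ R R R expl _ id).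
- apply: (@EM_functional _ _ R R R (lebI T) _ id) => // q.
  by rewrite mulr_ge0// expR_ge0.
move=> A mA; rewrite -lebIE; last by apply: bmeasM => //; exact: bmeas_indic.
rewrite -[RHS]/(fine (\int[lebesgue_measure]_(q in (`[0%R, T]%classic : set R)) (c%:num * decay q * \1_A q)%:E)%E).
transitivity (fine (expl (A `&` `[0, T]%classic))).
  rewrite -E_indic; last by apply: measurableI => //; exact: measurable_itv.
  by apply: eq_Rintegral => t _; rewrite indicI mulrC.
congr fine; rewrite /expl /exponential_prob integral_mkcondl.
apply: eq_integral => q; rewrite inE/= in_itv/= => /andP[q0 _].
rewrite patchE indicE; case: ifP => qA; last by rewrite mulr0.
by rewrite exponential_pdfE// decayE// mulr1 mulNr.
Qed.

Lemma E_lebI_cond T (f : R -> R) : bmeas f ->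
  \int[lebI T]_q f q = \int[lebI T]_q (\1_(`[0, T]%classic) q * f q).
Proof.
move=> bf; apply: (@E_ae _ _ _ _ `[0, T]%classic) => //.
- transitivity (lebesgue_measure (~` `[0, T]%classic `&` `[0, T]%classic : set R)); first by [].
  by rewrite setICl measure0.
- by apply: bmeasM => //; apply: bmeas_indic; exact: measurable_itv.
- by move=> q qT; rewrite indicE mem_set// mul1r.
Qed.

Lemma bmeas_lt2 : bmeas (fun z : R * R => ((z.2 < z.1)%R%:R : R)).
Proof.
have -> : (fun z : R * R => ((z.2 < z.1)%R%:R : R)) = (fun z => ((0 < z.1 - z.2)%R%:R : R)).
  by apply/funext => z; rewrite subr_gt0.
by apply: bmeas_gt; apply: measurable_funB.
Qed.

(** The density [c exp (- c q)] of the waiting time is [c] times its tail at [q]. This identity is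
    the source of the jump part of the generator, both in Dynkin's formula and in [forward_expo]. *)
Lemma compensator T (j : R -> R) : 0 <= T -> bmeas j ->
  \int[expl]_t ((t <= T)%R%:R * j t) =
  c%:num * \int[expl]_t \int[lebI T]_q ((q < t)%R%:R * j q).
Proof.
move=> T0 bj.
have bI : bmeas (\1_(`[0, T]%classic : set R) : R -> R) by apply: bmeas_indic; exact: measurable_itv.
transitivity (\int[expl]_t (\1_(`[0, T]%classic) t * j t)).
  apply: (E_ae (measurable_itv `]0, +oo[) expl_pos).
  - by apply: bmeasM => //; exact: bmeas_le.
  - exact: bmeasM.
  - move=> t /=; rewrite in_itv/= andbT => t0; congr (_ * _); rewrite indicE.
    congr (nat_of_bool _)%:R; apply/idP/idP => [tT|/set_mem/=]; first by apply/mem_set; rewrite /= in_itv/= ltW.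
    by rewrite in_itv/= => /andP[].
rewrite E_expl_density//; congr (_ * _).
have b2 : bmeas (fun z : R * R => (z.2 < z.1)%R%:R * j z.2).
  apply: bmeasM; first exact: bmeas_lt2.
  exact: (bmeas_comp (h := snd)).
rewrite (E_fubini expl (lebI T) b2) E_lebI_cond; last by apply: bmeasM => //; exact: bmeas_decay.
rewrite [RHS]E_lebI_cond; last exact: (bmeas_E1 expl (lebI T) b2).
apply: eq_Rintegral => q _; rewrite indicE; have [|_] := boolP (q \in _); last by rewrite !mul0r.
rewrite inE/= in_itv/= => /andP[q0 qT]; rewrite !mul1r.
transitivity (\int[expl]_t (j q * (q < t)%R%:R)); last first.
  by apply: eq_Rintegral => t _; rewrite mulrC.
have bq : bmeas (fun t : R => ((q < t)%R%:R : R)) by exact: bmeas_gt.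
rewrite EZ// mulrC; congr (_ * _).
have -> : (fun t => ((q < t)%R%:R : R)) = \1_(`]q, +oo[%classic : set R).
  apply/funext => v; rewrite indicE; congr (nat_of_bool _)%:R.
  by apply/idP/idP; rewrite inE/= in_itv/= andbT.
transitivity (fine (expl `]q, +oo[%classic)); last by rewrite E_indic.
by rewrite expl_ray// decayE.
Qed.

Lemma memoryless r (f : R -> R) : 0 <= r -> bmeas f ->
  \int[expl]_t ((r < t)%R%:R * f (t - r)) =
  expR (- (c%:num * r)) * \int[expl]_t f t.
Proof.
move=> r0 bf; set p := expR _.
have p0 : 0 <= p by exact: expR_ge0.
have p1 : p <= 1 by apply: expR_neg_le1; rewrite mulr_ge0.
(* The factor [p] is realised as the probability of an independent event, so that both sides are
   laws restricted to an event of a probability space and can be compared on rays. *)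
pose P2 : probability (R * R)%type R := (expl \x @unif R)%E.
have ms : measurable_fun setT (fun t : R => t - r).
  by apply: measurable_funB => //; exact: measurable_cst.
have P2E A : measurable A -> P2 (snd @^-1` `[0, p[%classic `&` fst @^-1` A) = (expl A * p%:E)%E.
  move=> mA; transitivity (P2 (A `*` `[0, p[%classic)).
    by congr (P2 _); apply/seteqP; split => -[x y] [].
  transitivity (expl A * @unif R (`[0%R, p[%classic : set R))%E; first exact: product_measure1E.
  by rewrite unif_itv// subr0.
have mB2 : measurable (snd @^-1` `[0, p[%classic : set (R * R)%type).
  exact: measurable_preimageT.
transitivity (\int[expl]_t (\1_(`]r, +oo[%classic) t * f (t - r))).
  apply: eq_Rintegral => v _; rewrite indicE; congr ((nat_of_bool _)%:R * _).
  by apply/idP/idP; rewrite inE/= in_itv/= andbT.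
transitivity (\int[P2]_z (\1_(snd @^-1` `[0, p[%classic) z * f z.1)).
  apply: (@E_restr_law _ _ R (R * R)%type _ R R expl P2 `]r, +oo[%classic
    (snd @^-1` `[0, p[%classic) (fun t => t - r) fst f) => //.
  apply: restr_law_rays => // a; rewrite [RHS]P2E//.
  have [a0|a0] := ltP a 0.
    rewrite expl_ray_lt0// mul1e -expl_ray//; congr expl.
    by apply/seteqP; split => x /=; rewrite !in_itv/= ?andbT; [case|move=> ?; split => //; lra].
  rewrite expl_ray// -EFinM.
  have -> : expR (- (c%:num * a)) * p = expR (- (c%:num * (a + r))).
    by rewrite /p -expRD; congr expR; ring.
  rewrite -expl_ray; last exact: addr_ge0.
    congr expl; apply/seteqP; split => x /=; rewrite !in_itv/= ?andbT; first by case=> ? ?; lra.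
    by move=> ?; split; lra.
have bz : bmeas (fun z : R * R => \1_(snd @^-1` `[0, p[%classic) z * f z.1).
  by apply: bmeasM; [exact: bmeas_indic|exact: (bmeas_comp (h := fst))].
rewrite (E_prod expl (@unif R) bz).
have bp : bmeas (fun w : R => ((w < p)%R%:R : R)).
  have -> : (fun w => ((w < p)%R%:R : R)) = \1_(`]-oo, p[%classic : set R).
    apply/funext => v; rewrite indicE; congr (nat_of_bool _)%:R.
    by apply/idP/idP; rewrite inE/= in_itv/=.
  exact: bmeas_indic.
rewrite -EZ//; apply: eq_Rintegral => t _.
transitivity (\int[@unif R]_w (f t * ((w < p)%R%:R : R))); last first.
  by rewrite EZ// E_unif_lt ?p0// mulrC.
apply: (@E_ae _ _ _ _ (`[0, 1]%classic : set R)) => //.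
- transitivity (@unif R (~` `[0, 1]%classic)); first by [].
  by rewrite probability_setC// [X in (1 - X)%E]unif01 subee.
- exact: (bmeas_pair1 bz).
- by apply: bmeasM => //; exact: bmeas_cst.
- move=> w /=; rewrite in_itv/= => /andP[w0 _]; rewrite mulrC indicE; congr (_ * (nat_of_bool _)%:R).
  apply/idP/idP => [/set_mem/=|wp]; first by rewrite in_itv/= => /andP[].
  by apply/mem_set; rewrite /= in_itv/= w0.
Qed.

Lemma expl_laplace_small e : 0 < e ->
  exists2 K : R, 0 <= K & \int[expl]_t expR (- (K * Num.max 0 t)) <= e.
Proof.
move=> e0.
have c0 : 0 < c%:num by [].
(* [c eta = e / 2] bounds the probability of a time below [eta] by [e / 2], and [K eta = 2 / e]
   makes the exponential at most [e / 2] beyond [eta]. *)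
pose eta := e / 2 / c%:num.
have eta0 : 0 < eta by rewrite !divr_gt0.
pose K := 2 / e / eta.
have K0 : 0 <= K by rewrite !divr_ge0 ?ltW.
exists K => //.
have bm : bmeas (fun t : R => expR (- (K * Num.max 0 t))).
  apply: (bmeas_expN (u := fun q : R => Num.max 0 q)) => //.
  - by move=> q; rewrite le_max lexx.
  - by apply: measurable_maxr => //; exact: measurable_cst.
apply: (@le_trans _ _ (\int[expl]_t ((t <= eta)%R%:R + e / 2))).
  apply: le_E => //; first by apply: bmeasD; [exact: bmeas_le|exact: bmeas_cst].
  move=> t; have [te|te] := leP t eta.
    have h : expR (- (K * Num.max 0 t)) <= 1.
      by apply: expR_neg_le1; rewrite mulr_ge0// le_max lexx.
    by apply: (le_trans h); rewrite /= lerDl; lra.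
  rewrite /= add0r max_r; last by apply: le_trans (ltW te); exact: ltW.
  rewrite expRN -[leRHS]invrK lef_pV2 ?posrE ?expR_gt0 ?invr_gt0 ?divr_gt0//.
  apply: le_trans (expR_ge1Dx _).
  have -> : (e / 2)^-1 = K * eta by rewrite /K; field; rewrite !gt_eqF.
  have : K * eta <= K * t by rewrite ler_wpM2l// ltW.
  lra.
rewrite ED; [|exact: bmeas_le|exact: bmeas_cst].
rewrite E_cst (E_expl_le (ltW eta0)).
have := expR_ge1Dx (- (c%:num * eta)).
have -> : c%:num * eta = e / 2 by rewrite /eta; field; rewrite gt_eqF.
lra.
Qed.

End exponential_law.

(** * Waiting times and marks driven by one uniform number *)

Section noise.
Variable R : realType.
Variable c : {posnum R}.
Local Notation U := (@unif R).

(** Inversion of the exponential tail at the uniform number [psi w]. The remaining digits [psi2 w]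
    are split once more, into the mark and the noise of the later jumps. *)
Let tau0 (w : R) : R := - ln (psi w) / c%:num.
Let mark (w : R) : R := psi (psi2 w).
Let rest (w : R) : R := psi2 (psi2 w).

Let measurable_tau0 : measurable_fun setT tau0.
Proof.
apply: measurable_funM; last exact: measurable_cst.
apply: measurable_funN; apply: measurableT_comp; first exact: measurable_ln.
exact: measurable_psi.
Qed.

Let measurable_mark : measurable_fun setT mark.
Proof. exact: (measurableT_comp (@measurable_psi R) (@measurable_psi2 R)). Qed.

Let measurable_rest : measurable_fun setT rest.
Proof. exact: (measurableT_comp (@measurable_psi2 R) (@measurable_psi2 R)). Qed.

Let E_neg_ln (f : R -> R) : bmeas f ->
  \int[U]_v f (- ln v / c%:num) = \int[expl c]_t f t.
Proof.
move=> bf; have mh : measurable_fun setT (fun v : R => - ln v / c%:num).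
  apply: measurable_funM; last exact: measurable_cst.
  by apply: measurable_funN; exact: measurable_ln.
have c0 : 0 < c%:num by [].
apply: (@E_law _ _ _ _ _ _ _ U (expl c) (fun v => - ln v / c%:num) id f) => // A mA.
have H0 a : U ([set: R] `&` (fun v => - ln v / c%:num) @^-1` `]a, +oo[%classic) =
            expl c ([set: R] `&` id @^-1` `]a, +oo[%classic).
  rewrite !setTI preimage_id; have m := measurable_preimageT mh (measurable_itv `]a, +oo[).
  have key x : 0 < x -> (a < - ln x / c%:num) = (x < expR (- (c%:num * a))).
    by move=> x0; rewrite ltr_pdivlMr// ltrNr -ltr_expR lnK ?posrE// mulrC.
  have [a0|a0] := ltP a 0.
    rewrite expl_ray_lt0//; transitivity (U `]0, 1]%classic); last first.
      by rewrite unif_itv// subr0.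
    transitivity (U `[0, 1]%classic); last by rewrite !unif_itv.
    apply: unif_eqI; [exact: m|exact: measurable_itv|].
    move=> x /andP[x0 x1] /=; rewrite !in_itv/= andbT x0 x1; split => // _.
    apply: lt_le_trans a0 _; rewrite divr_ge0// ?(ltW c0)// oppr_ge0.
    by rewrite ln_le0.
  rewrite expl_ray//; set p := expR _.
  have p0 : 0 <= p by exact: expR_ge0.
  have p1 : p <= 1 by apply: expR_neg_le1; rewrite mulr_ge0.
  transitivity (U `]0, p[%classic); last by rewrite unif_itv// subr0.
  apply: unif_eqI => // x /andP[x0 x1] /=; rewrite !in_itv/= andbT.
  move: x0; rewrite le_eqVlt => /predU1P[<-|x0].
    by rewrite ln0// oppr0 mul0r ltNge a0 ltxx.
  by rewrite key// x0.
have := @restr_law_rays R _ _ _ _ U (expl c) setT setT (fun v => - ln v / c%:num) id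
  measurableT measurableT mh (@measurable_id _ _ setT) H0 A mA.
by rewrite !setTI.
Qed.

Let law0 (f : R * R * R -> R) : bmeas f ->
  \int[U]_w f (tau0 w, mark w, rest w) =
  \int[expl c]_t \int[U]_v \int[U]_w f (t, v, w).
Proof.
move=> bf.
have b1 : bmeas (fun z : R * R => f (- ln z.1 / c%:num, psi z.2, psi2 z.2)).
  apply: (bmeas_comp (h := fun z : R * R => (- ln z.1 / c%:num, psi z.2, psi2 z.2)) _ bf).
  apply: measurable_fun_pair; first apply: measurable_fun_pair.
  - apply: measurable_funM; last exact: measurable_cst.
    by apply: measurable_funN; apply: (measurableT_comp (@measurable_ln R)).
  - exact: (measurableT_comp (@measurable_psi R)).
  - exact: (measurableT_comp (@measurable_psi2 R)).
rewrite (E_interleave b1) /=.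
have b2 : bmeas (fun z : R * (R * R) => f (z.1, z.2.1, z.2.2)).
  apply: (bmeas_comp (h := fun z : R * (R * R) => (z.1, z.2.1, z.2.2)) _ bf).
  apply: measurable_fun_pair; first apply: measurable_fun_pair => //.
    exact: (measurableT_comp (@measurable_fst _ _ R R) (@measurable_snd _ _ R _)).
  exact: (measurableT_comp (@measurable_snd _ _ R R) (@measurable_snd _ _ R _)).
have b3 : bmeas (fun z : R * R * R => f z) by [].
transitivity (\int[U]_v0 \int[U]_v \int[U]_w f (- ln v0 / c%:num, v, w)).
  apply: eq_Rintegral => v0 _.
  exact: (E_interleave (bmeas_pair1 b2 (- ln v0 / c%:num))).
have bg : bmeas (fun t => \int[U]_v \int[U]_w f (t, v, w)).
  pose UU : probability (R * R)%type R := (U \x U)%E.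
  exact: (bmeas_E2 U U (bmeas_E2 UU U b3)).
exact: (E_neg_ln bg).
Qed.

Let partial (w : R) n := \sum_(i < n) tau0 (iter i rest w).

(** What a path needs in order to have well-ordered potential jumps, finitely many on each bounded
    interval. *)
Let good (w : R) : Prop :=
  (forall n, 0 < tau0 (iter n rest w)) /\ (forall N : nat, exists n, N%:R < partial w n).

Let measurable_iter n : measurable_fun setT (iter n rest).
Proof.
elim: n => [|n IH]; first exact: measurable_id.
exact: (measurableT_comp measurable_rest IH).
Qed.

Let measurable_partial n : measurable_fun setT (partial ^~ n).
Proof.
rewrite /partial; elim: n => [|n IH].
  by under eq_fun do rewrite big_ord0; exact: measurable_cst.
under eq_fun do rewrite big_ord_recr /=; apply: measurable_funD => //.
exact: (measurableT_comp measurable_tau0 (measurable_iter n)).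
Qed.

Let measurable_good : measurable (good : set R).
Proof.
have -> : good = (\bigcap_n ((tau0 \o iter n rest) @^-1` `]0, +oo[%classic)) `&`
  \bigcap_N \bigcup_n ((partial ^~ n) @^-1` `]N%:R, +oo[%classic).
  apply/seteqP; split => w /=.
    move=> [h1 h2]; split => [n _|N _] /=; first by rewrite in_itv/= andbT.
    by have [n h] := h2 N; exists n => //=; rewrite in_itv/= andbT.
  move=> [h1 h2]; split => [n|N].
    by have := h1 n Logic.I; rewrite /= in_itv/= andbT.
  by have [n _] := h2 N Logic.I; rewrite /= in_itv/= andbT => h; exists n.
apply: measurableI.
  apply: bigcapT_measurable => n; apply: measurable_preimageT => //.
  exact: (measurableT_comp measurable_tau0 (measurable_iter n)).
apply: bigcapT_measurable => N; apply: bigcupT_measurable => n.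
by apply: measurable_preimageT => //; exact: measurable_partial.
Qed.

Let E_rest (f : R -> R) : bmeas f -> \int[U]_w f (rest w) = \int[U]_w f w.
Proof.
move=> bf; have b : bmeas (fun z : R * R * R => f z.2) by exact: (bmeas_comp (h := snd)).
rewrite (law0 b) /=; by under eq_Rintegral do rewrite E_cst; rewrite E_cst.
Qed.

Let E_tau0 (f : R -> R) : bmeas f -> \int[U]_w f (tau0 w) = \int[expl c]_t f t.
Proof.
move=> bf; have b : bmeas (fun z : R * R * R => f z.1.1).
  exact: (bmeas_comp (h := fun z : R * R * R => z.1.1) (measurableT_comp measurable_fst measurable_fst)).
rewrite (law0 b) /=; apply: eq_Rintegral => t _.
by under eq_Rintegral do rewrite E_cst; rewrite E_cst.
Qed.

Let E_iter n (f : R -> R) : bmeas f -> \int[U]_w f (iter n rest w) = \int[U]_w f w.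
Proof.
move=> bf; elim: n => [//|n IH].
have b : bmeas (fun w => f (iter n rest w)) by exact: (bmeas_comp (measurable_iter n) bf).
by rewrite -IH -(E_rest b); apply: eq_Rintegral => w _; rewrite iterSr.
Qed.

Let U_set (A : set R) : measurable A -> \int[U]_w \1_A w = 0 -> U A = 0%E.
Proof.
move=> mA; rewrite E_indic// => h.
by rewrite -[LHS]fineK ?h// fin_num_measure.
Qed.

Let tau0_pos n : U (~` ((tau0 \o iter n rest) @^-1` `]0, +oo[%classic)) = 0%E.
Proof.
have m1 : measurable ((tau0 \o iter n rest) @^-1` `]0, +oo[%classic).
  apply: measurable_preimageT => //.
  exact: (measurableT_comp measurable_tau0 (measurable_iter n)).
apply: U_set; first exact: measurableC.
have bB : bmeas (\1_(~` `]0, +oo[%classic) : R -> R).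
  by apply: bmeas_indic; exact: measurableC.
transitivity (\int[U]_w (\1_(~` `]0, +oo[%classic) (tau0 (iter n rest w)) : R)).
  by apply: eq_Rintegral => w _; rewrite !indicE.
rewrite (E_iter n (bmeas_comp measurable_tau0 bB)) (E_tau0 bB).
transitivity (fine (expl c (~` `]0, +oo[%classic))); last by rewrite expl_pos.
by rewrite E_indic//; exact: measurableC.
Qed.

Let partialS w n : partial w n.+1 = tau0 w + partial (rest w) n.
Proof.
rewrite /partial big_ord_recl; congr (_ + _); apply: eq_bigr => i _.
by rewrite -iterSr.
Qed.

Let mle n (x : R) : measurable [set w | partial w n <= x].
Proof.
have -> : [set w | partial w n <= x] = (partial ^~ n) @^-1` `]-oo, x]%classic.
  by apply/seteqP; split => w /=; rewrite in_itv.
by apply: measurable_preimageT => //; exact: measurable_partial.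
Qed.

(** On this event the first waiting time is at most [N] and the remaining noise lies in the event
    again. Independence bounds its probability by [q < 1] times itself. *)
Let partial_bounded (N : nat) :
  U [set w | (forall n, 0 < tau0 (iter n rest w)) /\ forall n, partial w n <= N%:R] = 0%E.
Proof.
set B := [set w | _].
have mB : measurable B.
  have -> : B = (\bigcap_n ((tau0 \o iter n rest) @^-1` `]0, +oo[%classic)) `&`
     \bigcap_n [set w | partial w n <= N%:R].
    apply/seteqP; split => w /=.
      by move=> [h1 h2]; split => [n _|n _] //=; rewrite in_itv/= andbT.
    move=> [h1 h2]; split => n; last exact: h2.
    by have := h1 n Logic.I; rewrite /= in_itv/= andbT.
  apply: measurableI; apply: bigcapT_measurable => n; last exact: mle.
  apply: measurable_preimageT => //.
  exact: (measurableT_comp measurable_tau0 (measurable_iter n)).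
pose q := 1 - expR (- (c%:num * N%:R)).
have q0 : 0 <= q by rewrite subr_ge0; apply: expR_neg_le1; rewrite mulr_ge0.
have q1 : q < 1 by rewrite ltrBlDr ltrDl expR_gt0.
have bB : bmeas (\1_B : R -> R) by exact: bmeas_indic.
apply: U_set => //.
have rec : \int[U]_w (\1_B w : R) <= q * \int[U]_w \1_B w.
  have bl := @bmeas_le R N%:R.
  have b : bmeas (fun z : R * R * R => (z.1.1 <= N%:R)%R%:R * \1_B z.2 : R).
    apply: bmeasM; last exact: (bmeas_comp (h := snd)).
    exact: (bmeas_comp (h := fun z : R * R * R => z.1.1) (measurableT_comp measurable_fst measurable_fst) bl).
  have -> : q * \int[U]_w \1_B w = \int[U]_w ((tau0 w <= N%:R)%R%:R * \1_B (rest w)).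
    rewrite (law0 b) /=.
    transitivity (\int[expl c]_t ((\int[U]_w \1_B w) * (t <= N%:R)%R%:R)).
      by rewrite EZ// E_expl_le// mulrC.
    apply: eq_Rintegral => t _; rewrite mulrC -EZ//.
    by rewrite -[LHS](E_cst U).
  apply: le_E => //.
    by apply: bmeasM; [exact: (bmeas_comp measurable_tau0 bl)|exact: (bmeas_comp measurable_rest bB)].
  move=> w; rewrite indicE; have [|_] := boolP (w \in B); last by rewrite mulr_ge0.
  rewrite inE => -[h1 h2].
  have p0 n : 0 <= partial (rest w) n.
    by apply: sumr_ge0 => i _; rewrite -iterSr; exact/ltW/h1.
  have tN : tau0 w <= N%:R by have := h2 1%N; rewrite /partial big_ord1.
  rewrite tN mul1r indicE mem_set//; split => n; first by rewrite -iterSr; exact: h1.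
  have := h2 n.+1; rewrite partialS => h; apply: le_trans h.
  by rewrite lerDr; exact: ltW (h1 0%N).
apply/eqP; rewrite eq_le; apply/andP; split; last by apply: Rintegral_ge0 => w _.
have I0 : 0 <= \int[U]_w (\1_B w : R) by apply: Rintegral_ge0 => w _.
rewrite leNgt; apply/negP => Ip; move: rec.
by rewrite leNgt -[ltRHS]mul1r ltr_pM2r// q1.
Qed.

Let U_bad : U (~` good) = 0%E.
Proof.
pose B1 n := ~` ((tau0 \o iter n rest) @^-1` `]0, +oo[%classic).
pose B2 N := [set w | (forall n, 0 < tau0 (iter n rest w)) /\ forall n, partial w n <= N%:R].
apply: (measure_negligible (measurableC measurable_good)).
apply: (negligibleS (A := (\bigcup_n B1 n) `|` (\bigcup_N B2 N))); last first.
  apply: negligibleU; apply: negligible_bigcup => n.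
  - exists (B1 n); split => //; last exact: tau0_pos.
    apply: measurableC; apply: measurable_preimageT => //.
    exact: (measurableT_comp measurable_tau0 (measurable_iter n)).
  - have mB : measurable (B2 n).
      have -> : B2 n = (\bigcap_i ((tau0 \o iter i rest) @^-1` `]0, +oo[%classic)) `&`
         \bigcap_i [set w | partial w i <= n%:R].
        apply/seteqP; split => w /=.
          by move=> [h1 h2]; split => [i _|i _] //=; rewrite in_itv/= andbT.
        move=> [h1 h2]; split => i; last exact: h2.
        by have := h1 i Logic.I; rewrite /= in_itv/= andbT.
      apply: measurableI; apply: bigcapT_measurable => i; last exact: mle.
      apply: measurable_preimageT => //.
      exact: (measurableT_comp measurable_tau0 (measurable_iter i)).
    by exists (B2 n); split => //; exact: partial_bounded.
move=> w ngood.
have [h1|h1] := pselect (forall n, 0 < tau0 (iter n rest w)); last first.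
  left; move/existsNP : h1 => [n hn]; exists n => //.
  by move=> /=; rewrite in_itv/= andbT.
right; apply: contrapT => h2; apply: ngood; split => // N.
apply: contrapT => h3; apply: h2; exists N => //; split => // n.
by rewrite leNgt; apply/negP => h4; apply: h3; exists n.
Qed.

(** Admissibility is asked of every path, so waiting times are set to [1] off the good set; the law
    does not change, as that set has full measure. *)
Let tau (w : R) : R := if w \in (good : set R) then tau0 w else 1.

Let good_iter w n : good w -> good (iter n rest w).
Proof.
elim: n w => [//|n IH] w gw; rewrite iterSr; apply: IH.
have [h1 h2] := gw; split => [m|N]; first by rewrite -iterSr; exact: h1.
have [M hM] := h2 (N + (Num.truncn (tau0 w)).+1)%N.
have t0 := h1 0%N; have /andP[_ ht] := truncn_itv (ltW t0).
case: M hM => [|M].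
  by rewrite /partial big_ord0 ltNge ler0n.
rewrite partialS natrD => hM; exists M.
have e : iter 0 rest w = w by [].
rewrite e in t0 ht; lra.
Qed.

(** The interface of the noise for all that follows. The last clause says that waiting time, mark
    and remaining noise are independent, the last one being distributed like the whole noise. *)
Lemma noise_exists : exists (d : measure_display) (W : measurableType d)
    (Q : probability W R) (tau mark : W -> R) (rest : W -> W),
  [/\ [/\ measurable_fun setT tau, measurable_fun setT mark & measurable_fun setT rest],
      (forall w, 0 < tau w),
      (forall w (x : R), exists n, x < \sum_(i < n) tau (iter i rest w)) &
      forall f : R * R * W -> R, bmeas f ->
        \int[Q]_w f (tau w, mark w, rest w) =
        \int[expl c]_t \int[U]_v \int[Q]_w f (t, v, w)].
Proof.
exists _, R, U, tau, mark, rest.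
have mtau : measurable_fun setT tau.
  apply: measurable_fun_ifT => //; first exact: measurable_mem.
have tau_gt0 w : 0 < tau w.
  by rewrite /tau; case: ifP => // /set_mem[h _]; exact: (h 0%N).
split => //.
- move=> w x.
  (* A point that is not good may become good after [m] shifts, and then remains so; otherwise every
     waiting time along its orbit is [1]. The sums are unbounded in both cases. *)
  have [[m gm]|nog] := pselect (exists m, good (iter m rest w)).
    have [_ h2] := gm.
    have [n hn] := h2 (Num.truncn `|x|).+1.
    exists (m + n)%N; rewrite big_split_ord /=.
    have -> : \sum_(i < n) tau (iter (m + i) rest w) = partial (iter m rest w) n.
      apply: eq_bigr => i _; rewrite addnC iterD /tau mem_set//.
      exact: good_iter.
    have : 0 <= \sum_(i < m) tau (iter i rest w) by apply: sumr_ge0 => i _; exact: ltW.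
    have /andP[_ ht] := truncn_itv (normr_ge0 x).
    have := ler_norm x; lra.
  exists (Num.truncn `|x|).+1.
  rewrite (eq_bigr (fun=> 1)); last first.
    move=> i _; rewrite /tau memNset// => gi; apply: nog; by exists i.
  rewrite sumr_const card_ord; have /andP[_ ht] := truncn_itv (normr_ge0 x).
  by apply: le_lt_trans ht; exact: ler_norm.
- move=> f bf; rewrite -law0//.
  apply: (E_ae measurable_good U_bad).
  + apply: (bmeas_comp (h := fun w => (tau w, mark w, rest w)) _ bf).
    by apply: measurable_fun_pair => //; exact: measurable_fun_pair.
  + apply: (bmeas_comp (h := fun w => (tau0 w, mark w, rest w)) _ bf).
    by apply: measurable_fun_pair => //; exact: measurable_fun_pair.
  + by move=> w gw; rewrite /tau mem_set.
Qed.

End noise.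

(** * Piecewise linear paths *)

Section flow_theory.
Variable R : realType.
Implicit Types (X : state R) (h : R).

Lemma flow0 X : flow X 0 = X.
Proof. by rewrite /flow !addr0 mkstate_id. Qed.

Lemma st_k_flow X h : st_k (flow X h) = st_k X.
Proof. by []. Qed.

Lemma st_x_flow X h : 0 <= h -> st_x (flow X h) = st_x X + h.
Proof. by move=> h0; rewrite st_x_mk// addr_ge0// st_x_ge0. Qed.

Lemma st_y_flow X h : 0 <= h ->
  st_y (flow X h) = if st_k X == 0%N then 0 else st_y X + h.
Proof.
move=> h0; rewrite /flow; case: ifPn => k0; last by rewrite st_y_mk// addr_ge0// st_y_ge0.
by rewrite /st_y /= k0.
Qed.

Lemma flow_flow X h h' : 0 <= h -> 0 <= h' -> flow (flow X h) h' = flow X (h + h').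
Proof.
move=> h0 h'0; apply: state_eq => //.
  by rewrite !st_x_flow ?addr_ge0// addrA.
rewrite !st_y_flow ?addr_ge0// st_k_flow.
by case: (st_k X == 0%N); rewrite // addrA.
Qed.

Lemma normr_max_dist (a b : R) : `|Num.max 0 a - Num.max 0 b| <= `|a - b|.
Proof.
have h1 := ler_norm (a - b); have h2 := ler_norm (- (a - b)); rewrite normrN in h2.
rewrite ler_norml; move: (`|a - b|) h1 h2 => r h1 h2.
by case: (ltP 0 a) => ?; case: (ltP 0 b) => ?; apply/andP; split; lra.
Qed.

Lemma flow_dist X h h' : state_dist (flow X h) (flow X h') <= 2 * `|h - h'|.
Proof.
rewrite /state_dist subrr normr0 add0r mulr_natl mulr2n; apply: lerD.
  apply: le_trans (normr_max_dist _ _) _.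
  by rewrite opprD addrACA subrr add0r.
rewrite /st_y /=; case: ifP => _; first by rewrite subrr normr0.
apply: le_trans (normr_max_dist _ _) _.
by rewrite opprD addrACA subrr add0r.
Qed.

Lemma flow_continuous X : continuous (flow X).
Proof.
move=> h A /nbhs_ballP[e /= e0 eA]; apply/nbhs_ballP; exists (e / 2) => /=.
  by rewrite divr_gt0.
move=> h' hh'; apply: eA; rewrite state_ball_dist.
apply: le_lt_trans (flow_dist X h h') _.
by move: hh'; rewrite /ball/= => ?; lra.
Qed.

Lemma flow_shift_continuous X a : continuous (fun t : R => flow X (t - a)).
Proof.
move=> t; apply: (@continuous_comp _ _ _ (fun t => t - a) (flow X)).
  by apply: cvgB; [exact: cvg_id|exact: cvg_cst].
exact: flow_continuous.
Qed.

Lemma state_hausdorff : hausdorff_space (state R).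
Proof. exact: metric_hausdorff. Qed.

End flow_theory.

Section jump_paths.
Variable R : realType.
Variables (T : nat -> R) (X : nat -> state R) (w : R -> state R).
Hypothesis T0 : T 0%N = 0.
Hypothesis T_incr : forall n, T n < T n.+1.
Hypothesis T_unb : forall x, exists n, x < T n.
Hypothesis w_on : forall n t, T n <= t -> t < T n.+1 -> w t = flow (X n) (t - T n).
Hypothesis X_next : forall n, let Z := flow (X n) (T n.+1 - T n) in
  [\/ X n.+1 = Z, X n.+1 = st_up Z | (0 < st_k Z)%N /\ X n.+1 = st_down Z].

Let T_le m n : (m <= n)%N -> T m <= T n.
Proof.
by move=> mn; rewrite -(subnK mn); elim: (n - m)%N => [//|k IH]; rewrite addSn;
  apply: le_trans IH _; exact: ltW.
Qed.

Let index_right t : 0 <= t -> exists n, T n <= t < T n.+1.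
Proof.
move=> t0; have ex : exists n, t < T n by exact: T_unb.
case: (ex_minnP ex) => -[|n] tn mn; first by move: tn; rewrite T0 ltNge t0.
exists n; rewrite tn andbT leNgt; apply/negP => /mn; by rewrite ltnn.
Qed.

Let index_left t : 0 < t -> exists n, T n < t <= T n.+1.
Proof.
move=> t0; have ex : exists n, t <= T n by have [n h] := T_unb t; exists n; exact: ltW.
case: (ex_minnP ex) => -[|n] tn mn; first by move: tn; rewrite T0 leNgt t0.
exists n; rewrite tn andbT ltNge; apply/negP => /mn; by rewrite ltnn.
Qed.

Let left_limit n t : T n < t -> t <= T n.+1 -> w @ t^'- --> flow (X n) (t - T n).
Proof.
move=> nt tn.
have : (fun s => flow (X n) (s - T n)) @ t^'- --> flow (X n) (t - T n).
  by apply: cvg_at_left_filter; exact: flow_shift_continuous.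
apply: cvg_trans; apply: near_eq_cvg; near=> s.
have h1 : T n <= s by near: s; exact: nbhs_left_ge.
have h2 : s < T n.+1 by apply: lt_le_trans tn; near: s; exact: nbhs_left_lt.
by rewrite (w_on h1 h2).
Unshelve. all: by end_near. Qed.

Let w_at n : w (T n) = X n.
Proof. by rewrite (@w_on n)// subrr flow0. Qed.

Lemma jump_path_cadlag : cadlag w.
Proof.
split=> t t0; last first.
  by have [n /andP[nt tn]] := index_left t0; exists (flow (X n) (t - T n)); exact: left_limit.
have [n /andP[nt tn]] := index_right t0; rewrite (@w_on n)//.
have : (fun s => flow (X n) (s - T n)) @ t^'+ --> flow (X n) (t - T n).
  by apply: cvg_at_right_filter; exact: flow_shift_continuous.
apply: cvg_trans; apply: near_eq_cvg; near=> s.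
have h1 : T n <= s by apply: le_trans nt _; apply: ltW; near: s; exact: nbhs_right_gt.
have h2 : s < T n.+1 by near: s; exact: nbhs_right_lt.
by rewrite (w_on h1 h2).
Unshelve. all: by end_near. Qed.

Let jump_timeP t : jump_time w t -> exists n, t = T n.+1.
Proof.
move=> [t0 nj]; have [n /andP[nt tn]] := index_left t0; exists n.
move: tn; rewrite le_eqVlt => /predU1P[//|tn]; exfalso; apply: nj.
rewrite (@w_on n)//; last exact: ltW.
by apply: left_limit => //; exact: ltW.
Qed.

Lemma jump_path_admissible : admissible_path w.
Proof.
split; first exact: jump_path_cadlag.
move=> t; have [N tN] := T_unb t.
apply: (@sub_finite_set _ _ (T @` `I_N.+1)); last exact/finite_image/finite_II.
move=> s [st /jump_timeP[n sn]]; exists n.+1 => //=.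
rewrite ltnS ltnNge; apply/negP => Nn; move: tN; apply/negP; rewrite -leNgt.
by apply: le_trans st; rewrite sn; apply: T_le; exact: leqW.
Qed.

(** A rejected potential jump gives a breakpoint that is not a jump time. There continuity forces
    the next state to prolong the flow, and consecutive segments are merged by [flow_flow]. *)
Lemma jump_path_piecewise_linear : piecewise_linear w.
Proof.
split; last first.
  move=> t jt; have [n tn] := jump_timeP jt.
  set Z := flow (X n) (T n.+1 - T n).
  have cl : w @ t^'- --> Z by rewrite /Z tn; exact: left_limit.
  exists Z => //; rewrite tn w_at; case: (X_next n) => [e|e|[k0 e]].
  (* A rejected potential jump: the value equals the left limit, which contradicts [jump_time]. *)
  - by case: jt => _ []; rewrite {2}tn w_at e.
  - by left.
  - by right.
move=> s t s0 st nj.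
have [i /andP[is_ si]] := index_right s0.
have [j /andP[jt tj]] := index_right (le_trans s0 st).
have nojump n : (i <= n)%N -> T n.+1 <= t -> X n.+1 = flow (X n) (T n.+1 - T n).
  move=> i_n nt; rewrite -w_at; apply: contrapT => ne.
  apply: (nj (T n.+1)) => //.
    by apply: lt_le_trans si _; exact: T_le.
  split; first by apply: le_lt_trans (T_incr n); rewrite -T0; exact: T_le.
  move=> cl; apply: ne; apply: (@cvg_unique _ (@state_hausdorff R) _ _ _ _ cl).
  exact: left_limit.
have key n : (i <= n)%N -> T n.+1 <= t -> X n.+1 = flow (w s) (T n.+1 - s).
  move=> i_n; rewrite -(subnK i_n); elim: (n - i)%N => [|k IH] kt.
    rewrite add0n in kt *; rewrite nojump// (@w_on i)// flow_flow ?subr_ge0//; last exact: ltW.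
    by congr flow; ring.
  rewrite addSn nojump//; last by rewrite -addSn leq_addl.
  rewrite IH; last by apply: le_trans kt; exact/ltW/T_incr.
  rewrite flow_flow ?subr_ge0//.
  - by congr flow; rewrite ?addSn; ring.
  - by apply: ltW; apply: lt_le_trans si _; apply: T_le; rewrite ltnS leq_addl.
  - exact/ltW/T_incr.
have ij : (i <= j)%N.
  rewrite leqNgt; apply/negP => ji; have := T_le ji => h.
  by move: (lt_le_trans tj h); rewrite ltNge (le_trans is_ st).
rewrite (@w_on j t)//; move: ij; rewrite leq_eqVlt => /predU1P[ij|ij].
  rewrite (@w_on i s)// ij flow_flow ?subr_ge0// -?ij//.
  by congr flow; ring.
case: j jt tj ij => [//|j] jt tj ij.
rewrite key// flow_flow ?subr_ge0//.
  by congr flow; ring.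
by apply: ltW; apply: lt_le_trans si _; exact: T_le.
Qed.

End jump_paths.

(** * The jump process driven by the noise *)

Section process.
Variable R : realType.
Context dW (W : measurableType dW).
Variables (tau mark : W -> R) (rest : W -> W).
Hypotheses (mtau : measurable_fun setT tau) (mmark : measurable_fun setT mark)
  (mrest : measurable_fun setT rest).
Hypothesis tau_gt0 : forall w, 0 < tau w.
Hypothesis tau_unb : forall w (x : R), exists n, x < \sum_(i < n) tau (iter i rest w).
Variable J : R -> state R -> R -> state R.
Hypothesis mJ : measurable_fun setT (fun z : R * state R * R => J z.1.1 z.1.2 z.2).

(* [z] consists of the current time, the current state and the remaining noise;
   [J] decides, by the mark, whether a potential jump is an actual one. *)
Definition next (z : R * state R * W) : R * state R * W :=
  (z.1.1 + tau z.2, J (z.1.1 + tau z.2) (flow z.1.2 (tau z.2)) (mark z.2), rest z.2).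

Definition epoch n z : R := (iter n next z).1.1.
Definition skeleton n z : state R := (iter n next z).1.2.

Lemma epochS n z : epoch n.+1 z = epoch n (next z).
Proof. by rewrite /epoch iterSr. Qed.

Lemma skeletonS n z : skeleton n.+1 z = skeleton n (next z).
Proof. by rewrite /skeleton iterSr. Qed.

Lemma iter_next_rest n z : (iter n next z).2 = iter n rest z.2.
Proof. by elim: n => [//|n IH]; rewrite !iterS /= IH. Qed.

Lemma epoch_next n z : epoch n.+1 z = epoch n z + tau (iter n rest z.2).
Proof. by rewrite /epoch iterS /= iter_next_rest. Qed.

Lemma epoch_lt n z : epoch n z < epoch n.+1 z.
Proof. by rewrite epoch_next ltrDl. Qed.

Lemma epochE n z : epoch n z = z.1.1 + \sum_(i < n) tau (iter i rest z.2).
Proof.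
elim: n => [|n IH]; first by rewrite big_ord0 addr0.
by rewrite epoch_next IH big_ord_recr /= addrA.
Qed.

Lemma epoch_unb z x : exists n, x < epoch n z.
Proof.
by have [n h] := tau_unb z.2 (x - z.1.1); exists n; rewrite epochE -ltrBlDl.
Qed.

Lemma epoch_ex t z : exists n, t < epoch n.+1 z.
Proof.
by have [n h] := epoch_unb z t; exists n; apply: lt_trans h (epoch_lt n z).
Qed.

(** The least such index also exists when [t] precedes the starting time, and is then [0]. *)
Definition njumps t z : nat := ex_minn (epoch_ex t z).

Lemma epoch_le m n z : (m <= n)%N -> epoch m z <= epoch n z.
Proof.
move=> mn; rewrite -(subnK mn); elim: (n - m)%N => [//|k IH].
by rewrite addSn; apply: le_trans IH _; exact/ltW/epoch_lt.
Qed.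

Lemma njumps_eq n t z : t < epoch n.+1 z -> (n = 0%N \/ epoch n z <= t) ->
  njumps t z = n.
Proof.
move=> tn h; rewrite /njumps; case: ex_minnP => m tm mmin.
apply/eqP; rewrite eqn_leq mmin//=; case: h => [->//|nt].
rewrite leqNgt; apply/negP => mn.
by have := lt_le_trans tm (le_trans (epoch_le z mn) nt); rewrite ltxx.
Qed.

Lemma njumpsP t z : t < epoch (njumps t z).+1 z /\
  (njumps t z = 0%N \/ epoch (njumps t z) z <= t).
Proof.
rewrite /njumps; case: ex_minnP => -[|m] tm mmin; first by split => //; left.
split => //; right; rewrite leNgt; apply/negP => /mmin; by rewrite ltnn.
Qed.

Definition Phi t z : state R :=
  flow (skeleton (njumps t z) z) (t - epoch (njumps t z) z).

Lemma PhiE n t z : t < epoch n.+1 z -> (n = 0%N \/ epoch n z <= t) ->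
  Phi t z = flow (skeleton n z) (t - epoch n z).
Proof. by move=> h1 h2; rewrite /Phi (njumps_eq h1 h2). Qed.

(** Dropping the first potential jump shifts all epochs by one index. This renewal identity
    underlies every argument that conditions on the first potential jump. *)
Lemma Phi_rec t z : z.1.1 <= t ->
  Phi t z = if t < z.1.1 + tau z.2 then flow z.1.2 (t - z.1.1) else Phi t (next z).
Proof.
move=> zt; have e1 : epoch 1 z = z.1.1 + tau z.2 by [].
case: ltP => h; first by rewrite (@PhiE 0 t z)//; left.
have [h1 h2] := njumpsP t (next z).
have c1 : t < epoch (njumps t (next z)).+2 z by rewrite epochS.
have c2 : (njumps t (next z)).+1 = 0%N \/ epoch (njumps t (next z)).+1 z <= t.
  by right; rewrite epochS; case: h2 => [->|//]; exact: h.
by rewrite (PhiE c1 c2) epochS skeletonS.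
Qed.

Lemma measurable_next : measurable_fun setT next.
Proof.
have m11 : measurable_fun setT (fun z : R * state R * W => z.1.1).
  exact: measurableT_comp measurable_fst measurable_fst.
have m12 : measurable_fun setT (fun z : R * state R * W => z.1.2).
  exact: measurableT_comp measurable_snd measurable_fst.
have mt : measurable_fun setT (fun z : R * state R * W => tau z.2).
  exact: measurableT_comp mtau measurable_snd.
apply: measurable_fun_pair; first apply: measurable_fun_pair.
- exact: measurable_funD.
- apply: (measurableT_comp mJ (g := fun z : R * state R * W =>
    (z.1.1 + tau z.2, flow z.1.2 (tau z.2), mark z.2))).
  apply: measurable_fun_pair; first apply: measurable_fun_pair.
  + exact: measurable_funD.
  + exact: measurable_flow_comp.
  + exact: measurableT_comp mmark measurable_snd.
- exact: measurableT_comp mrest measurable_snd.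
Qed.

Lemma measurable_iter_next n : measurable_fun setT (iter n next).
Proof.
elim: n => [|n IH]; first exact: measurable_id.
exact: (measurableT_comp measurable_next IH).
Qed.

Lemma measurable_epoch n : measurable_fun setT (epoch n).
Proof.
apply: (measurableT_comp (_ : measurable_fun setT (fun z : R * state R * W => z.1.1)) (measurable_iter_next n)).
exact: measurableT_comp measurable_fst measurable_fst.
Qed.

Lemma measurable_skeleton n : measurable_fun setT (skeleton n).
Proof.
apply: (measurableT_comp (_ : measurable_fun setT (fun z : R * state R * W => z.1.2)) (measurable_iter_next n)).
exact: measurableT_comp measurable_snd measurable_fst.
Qed.

Lemma measurable_Phi :
  measurable_fun setT (fun p : R * (R * state R * W) => Phi p.1 p.2).
Proof.
(* On each of these countably many pieces the path is an explicit function of time and noise. *)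
pose E n := [set p : R * (R * state R * W) | njumps p.1 p.2 = n].
have mep n : measurable_fun setT (fun p : R * (R * state R * W) => epoch n p.2).
  exact: measurableT_comp (measurable_epoch n) measurable_snd.
have mE n : measurable (E n).
  have -> : E n = (fun p : R * (R * state R * W) => epoch n.+1 p.2 - p.1) @^-1` `]0, +oo[%classic `&`
     (if n is m.+1 then (fun p : R * (R * state R * W) => p.1 - epoch n p.2) @^-1` `[0, +oo[%classic
      else setT).
    apply/seteqP; split => p /=.
      move=> <-; have [h1 h2] := njumpsP p.1 p.2; rewrite in_itv/= andbT subr_gt0; split => //.
      by case: (njumps p.1 p.2) h2 => [//|m] [//|h2] /=; rewrite in_itv/= andbT subr_ge0.
    rewrite in_itv/= andbT subr_gt0 => -[h1 h2]; apply: njumps_eq => //.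
    case: n h1 h2 => [|m] h1 h2; first by left.
    by right; move: h2; rewrite /= in_itv/= andbT subr_ge0.
  apply: measurableI.
    by apply: measurable_preimageT => //; apply: measurable_funB.
  case: n => [//|n]; apply: measurable_preimageT => //; exact: measurable_funB.
rewrite (_ : setT = \bigcup_n E n); last first.
  by apply/seteqP; split => p // _; exists (njumps p.1 p.2).
apply/(measurable_fun_bigcup _ mE) => n.
have ph : {in E n, (fun p => flow (skeleton n p.2) (p.1 - epoch n p.2)) =1 (fun p => Phi p.1 p.2)}.
  by move=> p; rewrite inE => <-.
apply: (eq_measurable_fun _ ph).
apply: measurable_funTS; apply: measurable_flow_comp.
  exact: measurableT_comp (measurable_skeleton n) measurable_snd.
exact: measurable_funB.
Qed.

Hypothesis J_next : forall r X u,
  [\/ J r X u = X, J r X u = st_up X | (0 < st_k X)%N /\ J r X u = st_down X].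

Lemma Phi_path X w :
  admissible_path (fun t => Phi t (0, X, w)) /\ piecewise_linear (fun t => Phi t (0, X, w)).
Proof.
set z := (0, X, w).
have h1 n t : epoch n z <= t -> t < epoch n.+1 z ->
    Phi t z = flow (skeleton n z) (t - epoch n z).
  by move=> h h'; apply: PhiE => //; right.
have h2 n : let Z := flow (skeleton n z) (epoch n.+1 z - epoch n z) in
  [\/ skeleton n.+1 z = Z, skeleton n.+1 z = st_up Z |
      (0 < st_k Z)%N /\ skeleton n.+1 z = st_down Z].
  have e : epoch n.+1 z - epoch n z = tau (iter n next z).2.
    by rewrite epoch_next iter_next_rest addrAC subrr add0r.
  by rewrite e /skeleton iterS; exact: J_next.
split.
- by apply: (@jump_path_admissible R (epoch ^~ z) (skeleton ^~ z)) => //;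
    [exact: (epoch_lt ^~ z)|exact: epoch_unb].
- by apply: (@jump_path_piecewise_linear R (epoch ^~ z) (skeleton ^~ z)) => //;
    [exact: (epoch_lt ^~ z)|exact: epoch_unb].
Qed.

End process.

(** * Test functions along the flow *)

Section test_functions.
Variable R : realType.
Implicit Types (g : state R -> R) (X Y : state R).

Definition flow_deriv g X : R := pdx g X + (0 < st_k X)%N%:R * pdy g X.

Lemma is_derive_quot (f : R -> R) (u l : R) :
  (fun h => h^-1 * (f (u + h) - f u)) @ 0^' --> l -> is_derive u 1 f l.
Proof.
move=> fl.
have E : (fun h : R => h^-1 *: ((f \o shift u) (h *: 1) - f u)) =
         (fun h => h^-1 * (f (u + h) - f u)).
  by apply/funext => h; rewrite /= /GRing.scale/= mulr1 addrC [u + h]addrC addrC.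
apply: DeriveDef; first by rewrite /derivable E; apply/cvg_ex; exists l.
by rewrite /derive E; exact: cvg_lim.
Qed.

Lemma increments_interior (a : R) (f : R -> R) (l : R) : 0 < a ->
  f @ increments a --> l -> f @ 0^' --> l.
Proof.
move=> a0 fl A Al; have := fl A Al; rewrite /increments /= => h.
have n0 : \forall h \near 0^', 0 <= a + h.
  have : \forall h \near (0 : R), 0 <= a + h.
    near=> h'; have : ball (0 : R) a h' by near: h'; exact: nbhsx_ballx.
    by rewrite /ball/= sub0r normrN ltr_norml => /andP[? _]; lra.
  exact: cvg_within.
have h2 : (0 : R)^' (fun x => 0 <= a + x -> A (f x)) := h.
by apply: filterS2 h2 n0 => x hx n; exact: hx.
Unshelve. all: by end_near. Qed.

(** Here [h] may be negative, as a two-sided derivative requires: both sides truncate the same sums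
    at [0]. *)
Lemma flow_add X (q h : R) : 0 <= q -> flow X (q + h) = flow (flow X q) h.
Proof.
move=> q0; apply: state_eq => //.
  by rewrite {2}/flow {1}/st_x /= st_x_flow// addrA.
transitivity (if st_k X == 0%N then 0 else Num.max 0 (st_y X + (q + h))) => //.
transitivity (if st_k X == 0%N then 0 else Num.max 0 (st_y (flow X q) + h)) => //.
by rewrite st_y_flow//; case: (st_k X == 0%N); rewrite // addrA.
Qed.

Lemma mkstate_dist k (x x' y y' : R) :
  state_dist (mkstate k x y) (mkstate k x' y') <= `|x - x'| + `|y - y'|.
Proof.
rewrite /state_dist subrr normr0 add0r; apply: lerD; first exact: normr_max_dist.
rewrite /st_y /=; case: ifP => _; first by rewrite subrr normr0.
exact: normr_max_dist.
Qed.

Lemma MVT_between (f df : R -> R) (a b : R) :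
  (forall u, `|u - a| <= `|b - a| -> is_derive u 1 f (df u)) ->
  exists xi, `|xi - a| <= `|b - a| /\ f b - f a = df xi * (b - a).
Proof.
move=> H.
have gen (x y : R) : x <= y -> (forall u, x <= u <= y -> is_derive u 1 f (df u)) ->
    exists2 xi, x <= xi <= y & f y - f x = df xi * (y - x).
  move=> xy D; have [||xi] := @MVT_segment R f df x y xy.
  - by move=> u; rewrite in_itv/= => /andP[u1 u2]; apply: D; rewrite !ltW.
  - apply: derivable_within_continuous => u; rewrite in_itv/= => uxy.
    by have [] := D u uxy.
  - by rewrite in_itv/= => xixy e; exists xi.
have [ab|ba] := leP a b.
  have [u /andP[u1 u2]|xi /andP[x1 x2] e] := gen a b ab _.
    by apply: H; rewrite !ger0_norm ?subr_ge0//; lra.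
  by exists xi; rewrite !ger0_norm ?subr_ge0//; split => //; lra.
have [u /andP[u1 u2]|xi /andP[x1 x2] e] := gen b a (ltW ba) _.
  by apply: H; rewrite !ler0_norm; lra.
by exists xi; rewrite !ler0_norm; try lra; split; lra.
Qed.

Section with_test_function.
Variable g : state R -> R.
Hypothesis tg : test_function g.

Lemma test_x_derive k (u y : R) : 0 < u ->
  is_derive u 1 (fun u => g (mkstate k u y)) (pdx g (mkstate k u y)).
Proof.
move=> u0; apply: is_derive_quot.
have xu : st_x (mkstate k u y) = u by rewrite st_x_mk// ltW.
have : quot_x g (mkstate k u y) @ 0^' --> pdx g (mkstate k u y).
  apply: (@increments_interior u) => //; rewrite -{2}xu.
  exact: (test_derivable_x tg).
apply: cvg_trans; apply: near_eq_cvg; apply: nearW => h.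
rewrite /quot_x xu st_k_mk; congr (_ * (g _ - _)).
apply: state_eq => //; rewrite /st_y /=; case: ifP => // k0.
by rewrite /st_y /= k0 maxA maxxx.
Qed.

(** For [q > 0] the point lies off the boundary, where the quotients are two-sided. The diagonal
    increment is the sum of one in [x] at height [y + h] and one in [y] at fixed [x]. *)
Lemma test_flow_derive X (q : R) : 0 < q ->
  is_derive q 1 (fun q => g (flow X q)) (flow_deriv g (flow X q)).
Proof.
move=> q0; apply: is_derive_quot; set Y := flow X q.
have xY : 0 < st_x Y by rewrite /Y st_x_flow ?ltW// ltr_wpDl// st_x_ge0.
have qx : quot_x g Y @ 0^' --> pdx g Y.
  by apply: (increments_interior xY); exact: (test_derivable_x tg).
under eq_fun do rewrite flow_add ?(ltW q0)//.
rewrite -/Y; have [k0|k0] := posnP (st_k Y).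
  rewrite /flow_deriv k0 ltnn mul0r addr0.
  move: qx; apply: cvg_trans; apply: near_eq_cvg; apply: nearW => h.
  rewrite /quot_x; congr (_ * (g _ - _)).
  by apply: state_eq => //; rewrite /st_y /= k0.
have kY : busy Y by [].
have yY : 0 < st_y Y.
  rewrite /Y st_y_flow ?ltW//; move: k0; rewrite /Y st_k_flow lt0n => /negbTE ->.
  by rewrite ltr_wpDl// st_y_ge0.
have qy : quot_y g Y @ 0^' --> pdy g Y.
  by apply: (increments_interior yY); exact: (test_derivable_y tg).
pose k := st_k Y; pose x := st_x Y; pose y := st_y Y.
(* By the mean value theorem this is [pdx] at a point within [2 |h|] of [Y]; continuity of [pdx]
   gives the limit. *)
pose Q1 (h : R) := h^-1 * (g (mkstate k (x + h) (y + h)) - g (mkstate k x (y + h))).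
have q1 : Q1 @ 0^' --> pdx g Y.
  apply/cvgrPdist_lt => e e0.
  have cpx : continuous (pdx g) by exact: (test_pdx_continuous tg).
  have /cvgrPdist_lt/(_ e e0)/nbhs_ballP[dl /= dl0 Hdl] := cpx Y.
  have hn : \forall h \near (0 : R)^', h != 0 by exact: nbhs_dnbhs_neq.
  have hs (r : R) : 0 < r -> \forall h \near (0 : R)^', `|h| < r.
    move=> r0; have : \forall h \near (0 : R), `|h| < r.
      near=> h'; have : ball (0 : R) r h' by near: h'; exact: nbhsx_ballx.
      by rewrite /ball/= sub0r normrN.
    exact: cvg_within.
  near=> h.
  have h0 : h != 0 by near: h.
  have hd : `|h| < dl / 2 by near: h; apply: hs; rewrite divr_gt0.
  have hx : `|h| < x by near: h; exact: hs.
  have hy : `|h| < y by near: h; exact: hs.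
  have D u : `|u - x| <= `|x + h - x| ->
      is_derive u 1 (fun u => g (mkstate k u (y + h))) (pdx g (mkstate k u (y + h))).
    rewrite addrAC subrr add0r => ux; apply: test_x_derive.
    have : `|u - x| < x by exact: le_lt_trans hx.
    by rewrite ltr_norml => /andP[? _]; lra.
  have [xi [xi1 xi2]] := MVT_between D.
  rewrite /Q1 xi2 addrAC subrr add0r mulrC -mulrA divff// mulr1.
  apply: Hdl; rewrite state_ball_dist -[Y]mkstate_id.
  apply: le_lt_trans (mkstate_dist _ _ _ _ _) _.
  rewrite opprD addrA subrr add0r normrN distrC.
  move: xi1; rewrite addrAC subrr add0r => xi1; rewrite -/x.
  lra.
have s : (fun h => Q1 h + quot_y g Y h) @ 0^' --> pdx g Y + pdy g Y by exact: cvgD.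
rewrite /flow_deriv k0 mul1r; move: s; apply: cvg_trans; apply: near_eq_cvg.
apply: nearW => h; rewrite /Q1 /quot_y -mulrDr; congr (_ * _).
by rewrite -/k -/x -/y /flow addrA subrK.
Unshelve. all: by end_near. Qed.

Lemma flow_deriv_continuous : continuous (flow_deriv g).
Proof.
have cpx : continuous (pdx g) by exact: (test_pdx_continuous tg).
move=> X; have c1 : pdx g @ X --> pdx g X by exact: cpx.
suff c2 : (fun Y => (0 < st_k Y)%N%:R * pdy g Y) @ X --> (0 < st_k X)%N%:R * pdy g X.
  exact: (cvgD c1 c2).
case: (ltnP 0 (st_k X)) => k0.
  have nz : \forall Y \near X, pdy g Y = (0 < st_k Y)%N%:R * pdy g Y :> R.
    by have := @nbhs_st_k R X; apply: filterS => Y /= ->; rewrite k0 mul1r.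
  rewrite mul1r; apply: cvg_trans (near_eq_cvg nz) _.
  have := test_pdy_continuous tg.
  rewrite continuous_open_subspace; last exact: (@st_k_open R (fun k => (0 < k)%N)).
  by apply; exact/mem_set.
have nz : \forall Y \near X, 0 = (0 < st_k Y)%N%:R * pdy g Y :> R.
  by have := @nbhs_st_k R X; apply: filterS => Y /= ->; rewrite ltnNge k0 mul0r.
rewrite mul0r; apply: cvg_trans (near_eq_cvg nz) _; exact: cvg_cst.
Qed.

Lemma bmeas_test : bmeas g.
Proof.
split; first by apply: state_continuous_measurable; exact: (test_continuous tg).
by have [C HC] := test_bounded tg; exists C => X; exact: HC.
Qed.

Lemma bmeas_flow_deriv : bmeas (flow_deriv g).
Proof.
split; first exact: (state_continuous_measurable flow_deriv_continuous).
have [C HC] := test_pdx_bounded tg; have [C' HC'] := test_pdy_bounded tg.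
exists (C + `|C'|) => X; apply: le_trans (ler_normD _ _) _.
apply: lerD; first exact: HC.
case: (ltnP 0 (st_k X)) => k0; last by rewrite mul0r normr0.
by rewrite mul1r; apply: le_trans (HC' X k0) (ler_norm _).
Qed.

Lemma test_flow_FTC X T : 0 <= T ->
  g (flow X T) - g X = \int[lebI T]_q flow_deriv g (flow X q).
Proof.
rewrite le_eqVlt => /predU1P[<-|T0].
  rewrite flow0 subrr -lebIE; first by rewrite set_itv1 Rintegral_set1.
  apply: (bmeas_comp (h := flow X)); last exact: bmeas_flow_deriv.
  by apply: measurable_flow_comp; [exact: measurable_cst|exact: measurable_id].
have bm : bmeas (fun q => flow_deriv g (flow X q)).
  apply: (bmeas_comp (h := flow X)); last exact: bmeas_flow_deriv.
  by apply: measurable_flow_comp; [exact: measurable_cst|exact: measurable_id].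
have cg : continuous (fun q => g (flow X q)).
  move=> q; apply: (@continuous_comp _ _ _ (flow X) g); first exact: flow_continuous.
  exact: (test_continuous tg).
rewrite -lebIE// /Rintegral (@continuous_FTC2 R _ (fun q => g (flow X q)) 0 T T0).
- by rewrite /= flow0.
- apply: continuous_subspaceT => q; apply: (@continuous_comp _ _ _ (flow X) (flow_deriv g)).
    exact: flow_continuous.
  exact: flow_deriv_continuous.
- split.
  + move=> q; rewrite in_itv/= => /andP[q0 _].
    by have [] := test_flow_derive X q0.
  + by apply: cvg_at_right_filter; exact: cg.
  + by apply: cvg_at_left_filter; exact: cg.
- move=> q; rewrite in_itv/= => /andP[q0 _]; rewrite derive1E.
  by have [_ ->] := test_flow_derive X q0.
Qed.

End with_test_function.
End test_functions.

(** * Thinning *)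

Section thinning.
Variable R : realType.
Variables (lp lm : R -> state R -> R) (c : {posnum R}).
Hypotheses (mlp : measurable_fun setT (fun z : R * state R => lp z.1 z.2))
  (mlm : measurable_fun setT (fun z : R * state R => lm z.1 z.2)).
Hypotheses (lp0 : forall r X, 0 <= lp r X) (lm0 : forall r X, 0 <= lm r X).
Hypothesis lc : forall r X, lp r X + lm r X <= c%:num.

(* With [u] uniform on [0, 1], potential jumps at rate [c] become upward and
   downward jumps at rates [lp] and [lm]. *)
Definition thin (r : R) (X : state R) (u : R) : state R :=
  if u < lp r X / c%:num then st_up X
  else if (u < (lp r X + lm r X) / c%:num) && (0 < st_k X)%N then st_down X else X.

Definition jump_op (g : state R -> R) (r : R) (X : state R) : R :=
  lp r X * (g (st_up X) - g X) +
  (0 < st_k X)%N%:R * (lm r X * (g (st_down X) - g X)).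

Lemma thin_next r X u :
  [\/ thin r X u = X, thin r X u = st_up X | (0 < st_k X)%N /\ thin r X u = st_down X].
Proof.
rewrite /thin; case: ifP => _; first by constructor 2.
by case: ifP => [/andP[_ k0]|_]; [constructor 3|constructor 1].
Qed.

Lemma measurable_thin :
  measurable_fun setT (fun z : R * state R * R => thin z.1.1 z.1.2 z.2).
Proof.
have mX : measurable_fun setT (fun z : R * state R * R => z.1.2).
  exact: measurableT_comp measurable_snd measurable_fst.
have mlp' : measurable_fun setT (fun z : R * state R * R => lp z.1.1 z.1.2).
  exact: measurableT_comp mlp measurable_fst.
have mlm' : measurable_fun setT (fun z : R * state R * R => lm z.1.1 z.1.2).
  exact: measurableT_comp mlm measurable_fst.
apply: measurable_fun_ifT.
- apply: measurable_fun_ltr => //.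
  by apply: measurable_funM => //; exact: measurable_cst.
- exact: measurableT_comp (@measurable_st_up R) mX.
apply: measurable_fun_ifT => //.
- apply: measurable_and.
    apply: measurable_fun_ltr => //.
    apply: measurable_funM; last exact: measurable_cst.
    exact: measurable_funD.
  apply: measurable_fun_ltn; first exact: measurable_cst.
  exact: measurableT_comp (@measurable_st_k R) mX.
- exact: measurableT_comp (@measurable_st_down R) mX.
Qed.

Lemma bmeas_ltr (p : R) : bmeas (fun u : R => ((u < p)%R%:R : R)).
Proof.
have -> : (fun w => ((w < p)%R%:R : R)) = \1_(`]-oo, p[%classic : set R).
  apply/funext => v; rewrite indicE; congr (nat_of_bool _)%:R.
  by apply/idP/idP; rewrite inE/= in_itv/=.
exact: bmeas_indic.
Qed.

(** The unit interval is cut at [lp / c] and at [(lp + lm) / c], which is at most [1] by [lc]. On an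
    empty queue the second band changes nothing, whence the factor [1(k > 0)] in [jump_op]. *)
Lemma E_thin (g : state R -> R) r X :
  \int[@unif R]_u g (thin r X u) = g X + c%:num^-1 * jump_op g r X.
Proof.
have c0 : 0 < c%:num by [].
set p := lp r X / c%:num; set q := (lp r X + lm r X) / c%:num.
have pq : p <= q by rewrite ler_pM2r ?invr_gt0// lerDl.
have p0 : 0 <= p by rewrite divr_ge0.
have q1 : q <= 1 by rewrite ler_pdivrMr// mul1r.
pose a := g (st_up X) - g X; pose b := (0 < st_k X)%N%:R * (g (st_down X) - g X).
have bp := bmeas_ltr p; have bq := bmeas_ltr q.
transitivity (\int[@unif R]_u (g X + (a * ((u < p)%R%:R : R) + b * (((u < q)%R%:R : R) - ((u < p)%R%:R : R))))).
  apply: eq_Rintegral => u _; rewrite /thin -/p -/q /a /b.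
  have [up|pu] := ltP u p.
    by rewrite (lt_le_trans up pq) /=; ring.
  have [uq|qu] := ltP u q => /=; last by ring.
  by case: (0 < st_k X)%N => /=; ring.
have b1 : bmeas (fun u : R => a * ((u < p)%R%:R : R)) by apply: bmeasM => //; exact: bmeas_cst.
have b2 : bmeas (fun u : R => (((u < q)%R%:R : R) - ((u < p)%R%:R : R))) by exact: bmeasB.
have b3 : bmeas (fun u : R => b * (((u < q)%R%:R : R) - ((u < p)%R%:R : R))).
  by apply: bmeasM => //; exact: bmeas_cst.
rewrite ED; [|exact: bmeas_cst|exact: bmeasD].
rewrite E_cst ED// EZ// EZ// EB//.
rewrite !E_unif_lt; [|apply/andP; split; lra..].
by rewrite /jump_op /a /b /p /q; field; rewrite gt_eqF.
Qed.

Lemma bmeas_jump_op g : bmeas g -> bmeas (fun z : R * state R => jump_op g z.1 z.2).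
Proof.
move=> bg.
have bl (l : R -> state R -> R) : measurable_fun setT (fun z : R * state R => l z.1 z.2) ->
    (forall r X, 0 <= l r X <= c%:num) -> bmeas (fun z : R * state R => l z.1 z.2).
  move=> ml lb; split => //; exists c%:num => z.
  by have /andP[h1 h2] := lb z.1 z.2; rewrite ger0_norm.
have bX (h : state R -> state R) : measurable_fun setT h ->
    bmeas (fun z : R * state R => g (h z.2) - g z.2).
  move=> mh; apply: bmeasB; last exact: bmeas_comp measurable_snd bg.
  apply: (bmeas_comp (h := fun z : R * state R => h z.2) _ bg).
  exact: measurableT_comp mh measurable_snd.
have bk : bmeas (fun z : R * state R => ((0 < st_k z.2)%N%:R : R)).
  split; last by exists 1 => z; case: (0 < st_k z.2)%N; rewrite ?normr1 ?normr0.
  have -> : (fun z : R * state R => ((0 < st_k z.2)%N%:R : R)) =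
      (fun z => if (0 < st_k z.2)%N then 1 else 0).
    by apply/funext => z; case: (0 < st_k z.2)%N.
  apply: measurable_fun_ifT; [|exact: measurable_cst..].
  apply: measurable_fun_ltn; first exact: measurable_cst.
  exact: measurableT_comp (@measurable_st_k R) measurable_snd.
apply: bmeasD; apply: bmeasM => //.
- by apply: bl => // r X; rewrite lp0 (le_trans _ (lc r X))// lerDl.
- by apply: bX; exact: measurable_st_up.
- apply: bmeasM; first by apply: bl => // r X; rewrite lm0 (le_trans _ (lc r X))// lerDr.
  by apply: bX; exact: measurable_st_down.
Qed.

End thinning.

Section lebesgue_segments.
Variable R : realType.

Lemma lebI_sub (T' T : R) (f : R -> R) : T' <= T -> bmeas f ->
  \int[lebI T]_q (\1_(`[0, T']%classic) q * f q) = \int[lebI T']_q f q.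
Proof.
move=> TT; have bI : bmeas (\1_(`[0, T']%classic : set R) : R -> R).
  by apply: bmeas_indic; exact: measurable_itv.
move: f; apply: (@bmeas_ext _ _ R (fun f => \int[lebI T]_q (\1_(`[0, T']%classic) q * f q))
   (fun f => \int[lebI T']_q f q)).
- by apply: (@EM_functional _ _ R R R (lebI T) _ id).
- by have := @E_functional _ _ R (lebI T').
move=> A mA; transitivity (\int[lebI T]_q (\1_(`[0, T']%classic `&` A) q : R)).
  by apply: eq_Rintegral => q _; rewrite indicI.
have mI : measurable (`[0, T']%classic `&` A) by apply: measurableI => //; exact: measurable_itv.
transitivity (fine (lebI T (`[0, T']%classic `&` A))); first by rewrite E_indic.
transitivity (fine (lebI T' A)); last by rewrite E_indic.
congr fine; rewrite /lebI; congr lebesgue_measure; apply/seteqP; split => x /=.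
  by move=> [[]].
move=> [Ax xT]; split => //; move: xT; rewrite !in_itv/= => /andP[-> h].
exact: le_trans TT.
Qed.

Lemma lebesgue_measure_translate (s : R) (A : set R) : measurable A ->
  lebesgue_measure ((fun x => s + x) @^-1` A) = lebesgue_measure A.
Proof.
move=> mA.
have ms : measurable_fun [set: measurableTypeR R] ((fun x => s + x) : measurableTypeR R -> measurableTypeR R).
  by apply: measurable_funD => //; exact: measurable_cst.
pose h : {mfun measurableTypeR R >-> measurableTypeR R} :=
  MeasurableFun.Pack (MeasurableFun.Class (isMeasurableFun.Build _ _ _ _ _ ms)).
have K (m : {measure set (measurableTypeR R) -> \bar R}) :
    (forall A, measurable A -> m A = lebesgue_measure (h @^-1` A)) ->
    forall A, measurable A -> lebesgue_measure A = m A.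
  move=> mE; apply: lebesgue_measure_unique => X [[a b] _ <-].
  rewrite mE; last exact: measurable_itv.
  rewrite (_ : h @^-1` _ = `]a - s, b - s]%classic); last first.
    apply/seteqP; split => x /=; rewrite !in_itv/= => /andP[? ?]; apply/andP; split; lra.
  rewrite !lebesgue_measure_itv /= !lte_fin ltrD2r.
  by case: ifP => // _; rewrite -!EFinB; congr EFin; ring.
by apply: esym; apply: (K (pushforward lebesgue_measure h)).
Qed.

Lemma lebI_shift (s T : R) (f : R -> R) : 0 <= s -> s <= T -> bmeas f ->
  \int[lebI T]_r f r = \int[lebI s]_r f r + \int[lebI (T - s)]_q f (s + q).
Proof.
move=> s0 sT.
have ms : measurable_fun setT (fun q : R => s + q).
  by apply: measurable_funD => //; exact: measurable_cst.
have bs (g : R -> R) : bmeas g -> bmeas (fun q => g (s + q)) by move=> bg; exact: bmeas_comp bg.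
move: f; apply: (@bmeas_ext _ _ R (fun f => \int[lebI T]_r f r)
   (fun f => \int[lebI s]_r f r + \int[lebI (T - s)]_q f (s + q))).
- by have := @E_functional _ _ R (lebI T).
- split.
  + by move=> f g bf bg; rewrite !ED//; [ring|exact: bs..].
  + by move=> r f bf; rewrite !EZ//; [ring|exact: bs].
  + by move=> f g bf bg fg; apply: lerD; apply: le_E => //; exact: bs.
move=> A mA.
have mA' : measurable ((fun q => s + q) @^-1` A) by exact: measurable_preimageT.
transitivity (fine (lebI T A)); first by rewrite E_indic.
have -> : \int[lebI s]_r (\1_A r : R) = fine (lebI s A) by rewrite E_indic.
have -> : \int[lebI (T - s)]_q (\1_A (s + q) : R) = fine (lebI (T - s) ((fun q => s + q) @^-1` A)).
  by rewrite -E_indic.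
have ok (U : R) : lebesgue_measure (A `&` `[0, U]%classic) \is a fin_num.
  exact: (@fin_num_measure _ _ _ (lebI U)).
have ok2 : lebesgue_measure (A `&` `]s, T]%classic) \is a fin_num.
  rewrite ge0_fin_numE//; apply: le_lt_trans (leb_fin T).
  have mAs : measurable (A `&` `]s, T]%classic) by apply: measurableI => //; exact: measurable_itv.
  apply: le_measure; rewrite ?inE//.
  move=> x [_]; rewrite /= !in_itv/= => /andP[sx ->]; rewrite andbT.
  by apply: le_trans s0 _; exact: ltW.
have e1 : lebI T A = (lebI s A + lebesgue_measure (A `&` `]s, T]%classic))%E.
  rewrite /lebI -measureU.
  - congr lebesgue_measure; rewrite -setIUr; congr (_ `&` _).
    apply/seteqP; split => x /=; rewrite !in_itv/=.
      by move=> /andP[x0 xT]; rewrite x0 xT /=; case: leP => ?; [left|right].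
    by move=> [/andP[-> xs]|/andP[sx ->]]; [apply: le_trans sT|rewrite andbT; apply: le_trans s0 _; exact: ltW].
  - by apply: measurableI => //; exact: measurable_itv.
  - by apply: measurableI => //; exact: measurable_itv.
  - apply/seteqP; split => // x /= [[_]]; rewrite !in_itv/= => /andP[_ xs] [_ /andP[sx _]].
    by move: sx; rewrite ltNge xs.
have e2 : lebI (T - s) ((fun q => s + q) @^-1` A) = lebesgue_measure (A `&` `]s, T]%classic).
  rewrite /lebI -(@lebesgue_measure_translate s (A `&` `]s, T]%classic)); last first.
    by apply: measurableI => //; exact: measurable_itv.
  have -> : (fun q => s + q) @^-1` (A `&` `]s, T]%classic) =
      (fun q => s + q) @^-1` A `&` `]0, T - s]%classic.
    apply/seteqP; split => x /= [Ax]; rewrite !in_itv/= => /andP[? ?]; split => //; apply/andP; split; lra.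
  have -> : (fun q => s + q) @^-1` A `&` `[0, T - s]%classic =
      ((fun q => s + q) @^-1` A `&` `]0, T - s]%classic) `|`
      ((fun q => s + q) @^-1` A `&` [set 0]).
    rewrite -setIUr; congr (_ `&` _); apply/seteqP; split => x /=; rewrite !in_itv/=.
      by move=> /andP[]; rewrite le_eqVlt => /predU1P[<- _|-> ->]; [right|left].
    by move=> [/andP[/ltW -> ->]//|->]; rewrite lexx subr_ge0.
  rewrite measureU.
  - rewrite [X in (_ + X)%E](_ : _ = 0%E) ?adde0//.
    apply: (@subset_measure0 _ _ _ lebesgue_measure _ [set 0]) => //.
    + by apply: measurableI => //; exact: measurable_set1.
    + exact: lebesgue_measure_set1.
  - by apply: measurableI => //; exact: measurable_itv.
  - by apply: measurableI => //; exact: measurable_set1.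
  - apply/seteqP; split => // x /= [[_]]; rewrite in_itv/= => /andP[x0 _] [_ x00].
    by rewrite x00 ltxx in x0.
by rewrite e1 e2 fineD//; exact: ok.
Qed.

End lebesgue_segments.

(** * Joint measurability of right-continuous processes *)

Section joint_measurability.
Context (R : realType) d (Om : measurableType d).
Variables (X : R -> Om -> state R) (t : R).
Hypothesis t0 : 0 <= t.
Hypothesis mX : forall r, 0 <= r -> r <= t -> measurable_fun setT (X r).
Hypothesis rcX : forall o r, 0 <= r -> r < t -> X s o @[s --> r^'+] --> X r o.

Definition clip (r : R) : R := Num.min t (Num.max 0 r).

Lemma clip01 r : 0 <= clip r <= t.
Proof. by rewrite /clip ge_min lexx /= andbT le_min t0 le_max lexx. Qed.

Lemma clip_id r : 0 <= r -> r <= t -> clip r = r.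
Proof. by move=> r0 rt; rewrite /clip max_r// min_r. Qed.

Lemma measurable_clip : measurable_fun setT clip.
Proof.
apply: measurable_minr; first exact: measurable_cst.
by apply: measurable_maxr => //; exact: measurable_cst.
Qed.

Let grid n (j : nat) : R := Num.min t (j.+1%:R / n.+1%:R).

Let cell n (r : R) : nat := Num.truncn (n.+1%:R * clip r).

Let cell_bounds n r : (cell n r)%:R <= n.+1%:R * clip r < (cell n r).+1%:R.
Proof. by apply: truncn_itv; rewrite mulr_ge0//; have /andP[] := clip01 r. Qed.

Let grid_cvg r : clip r < t -> grid n (cell n r) @[n --> \oo] --> (clip r)^'+.
Proof.
move=> rt A; rewrite /at_right => hA.
have [e /= e0 He] : exists2 e : R, 0 < e & forall x, clip r < x -> x < clip r + e -> A x.
  have /nbhs_ballP[e /= e0 He] : nbhs (clip r) (fun x => x > clip r -> A x) by exact: hA.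
  exists e => // x rx xe; apply: He => //.
  by rewrite /ball/= distrC gtr0_norm ?subr_gt0//; lra.
have c1 : n.+1%:R^-1 @[n --> \oo] --> (0 : R) by exact: cvg_harmonic.
have /cvgrPdist_lt/(_ e e0) := c1; apply: filterS => n.
rewrite sub0r normrN ger0_norm// => ne.
have n0 : 0 < n.+1%:R :> R by rewrite ltr0n.
have /andP[b1 b2] := cell_bounds n r.
have g1 : clip r < (cell n r).+1%:R / n.+1%:R by rewrite ltr_pdivlMr// mulrC.
have g2 : (cell n r).+1%:R / n.+1%:R <= clip r + n.+1%:R^-1.
  rewrite -natr1 mulrDl mul1r lerD2r ler_pdivrMr// mulrC; exact: b1.
apply: He; rewrite /grid; first by rewrite lt_min rt.
by rewrite gt_min; apply/orP; right; apply: le_lt_trans g2 _; rewrite ltrD2l.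
Qed.

(** The process is the limit of its values at the next grid point to the right. Grid points are cut
    at [t], so only times up to [t] are consulted; over the sigma-algebra of the past at [t] this is
    progressive measurability. *)
Lemma joint_measurable_process :
  measurable_fun setT (fun z : R * Om => X (clip z.1) z.2).
Proof.
apply: (@measurable_state_cvg R _ _ (fun n z => X (grid n (cell n z.1)) z.2)).
- move=> n; pose E j := [set z : R * Om | cell n z.1 = j].
  have mE j : measurable (E j).
    have -> : E j = (fun z : R * Om => n.+1%:R * clip z.1) @^-1` `[j%:R, j.+1%:R[%classic.
      apply/seteqP; split => z /=; rewrite in_itv/=.
        by move=> <-; exact: cell_bounds.
      by move=> h; apply: truncn_def.
    apply: measurable_preimageT; last exact: measurable_itv.
    apply: measurable_funM; first exact: measurable_cst.
    exact: (measurableT_comp measurable_clip measurable_fst).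
  rewrite (_ : setT = \bigcup_j E j); last first.
    by apply/seteqP; split => z // _; exists (cell n z.1).
  apply/(measurable_fun_bigcup _ mE) => j.
  have ph : {in E j, (fun z : R * Om => X (grid n j) z.2) =1 (fun z => X (grid n (cell n z.1)) z.2)}.
    by move=> z; rewrite inE => <-.
  apply: (eq_measurable_fun _ ph); apply: measurable_funTS.
  apply: (measurableT_comp _ measurable_snd); apply: mX.
    by rewrite /grid le_min t0 divr_ge0.
  by rewrite /grid ge_min lexx.
- move=> z; have /andP[c0 ct] := clip01 z.1.
  (* At the right end [t] right continuity gives nothing, but there the grid point is [t] itself. *)
  move: ct; rewrite le_eqVlt => /predU1P[ct|ct]; last first.
    have := rcX (o := z.2) c0 ct; apply: cvg_comp; exact: grid_cvg.
  have e n : grid n (cell n z.1) = clip z.1.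
    rewrite /grid ct min_l// -ct; have /andP[_ b2] := cell_bounds n z.1.
    by rewrite ler_pdivlMr ?ltr0n// mulrC ltW.
  by under eq_fun do rewrite e; exact: cvg_cst.
Qed.

End joint_measurability.

Section pi_lambda.
Context (R : realType) d (Om : measurableType d) (P : {finite_measure set Om -> \bar R}).
Variables (G : set_system Om) (K : Om -> R).
Hypotheses (GI : setI_closed G) (GT : G setT) (Gm : G `<=` measurable).
Hypothesis bK : bmeas K.

(** The events over which [K] integrates to zero form a lambda-system: complements use that [setT]
    is in [G], disjoint unions use bounded convergence along partial unions. *)
Lemma pi_lambda_E : (forall B, G B -> \int[P]_o (\1_B o * K o) = 0) ->
  forall B, <<s G >> B -> \int[P]_o (\1_B o * K o) = 0.
Proof.
move=> HG.
have sG B : <<s G >> B -> measurable B.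
  by apply: smallest_sub => //; exact: sigma_algebra_measurable.
apply: (@dynkin_induction _ (g_sigma_algebraType G) G
  (fun B => \int[P]_o (\1_B o * K o) = 0)) => //.
- exact: HG.
- move=> B mB HB; have mB' := sG B mB.
  have -> : \int[P]_o (\1_(~` B) o * K o) =
      \int[P]_o (\1_setT o * K o) - \int[P]_o (\1_B o * K o).
    rewrite -EB; [|by apply: bmeasM => //; exact: bmeas_indic..].
    apply: eq_Rintegral => o _; rewrite -mulrBl; congr (_ * _).
    rewrite !indicE in_setC mem_setT; case: (o \in B) => /=; ring.
  by rewrite HB HG// subrr.
- move=> F0 mF tF HF; pose F : nat -> set Om := F0.
  change (\int[P]_o (\1_(\bigcup_k F k) o * K o) = 0).
  have mF' k : measurable (F k) := sG (F k) (mF k).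
  pose Un n := \bigcup_(k < n) F k.
  have mU n : measurable (Un n) by apply: bigcup_measurable => k _; exact: mF'.
  have HU n : \int[P]_o (\1_(Un n) o * K o) = 0.
    elim: n => [|n IH].
      rewrite -[RHS](mul0r (\int[P]_o K o)) -EZ//; apply: eq_Rintegral => o _.
      by rewrite /Un bigcup_mkord big_ord0 indic0.
    have -> : \int[P]_o (\1_(Un n.+1) o * K o) =
        \int[P]_o (\1_(Un n) o * K o) + \int[P]_o (\1_(F n) o * K o).
      rewrite -ED; [|by apply: bmeasM => //; exact: bmeas_indic..].
      apply: eq_Rintegral => o _; rewrite -mulrDl; congr (_ * _).
      rewrite !indicE -natrD; congr (_%:R).
      have -> : (o \in Un n.+1) = (o \in Un n) || (o \in F n).
        apply/idP/orP.
          move=> /set_mem[k /= kn Fk]; move: kn; rewrite ltnS leq_eqVlt => /predU1P[e|kn].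
            by right; apply/mem_set; rewrite -e.
          by left; apply/mem_set; exists k.
        move=> [/set_mem[k /= kn Fk]|/set_mem Fn]; apply/mem_set.
          by exists k => //=; exact: ltnW.
        by exists n => /=.
      have [/set_mem[k /= kn Fk]|//] := boolP (o \in Un n).
      have [/set_mem Fn|//] := boolP (o \in F n).
      have : k = n by apply: tF => //; exists o.
      by move=> e; rewrite e ltnn in kn.
    by rewrite IH HF addr0.
  have [mK [C KC]] := bK.
  have cv : \int[P]_o (\1_(Un n) o * K o) @[n --> \oo] --> \int[P]_o (\1_(\bigcup_k F k) o * K o).
    apply: (@bounded_cvg_E _ _ _ _ _ _ C).
    + by move=> n; have [] := bmeasM (bmeas_indic R (mU n)) bK.
    + move=> n o; rewrite normrM -[leRHS]mul1r; apply: ler_pM => //.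
      by rewrite indicE; case: (_ \in _); rewrite /= ?normr1 ?normr0.
    + move=> o; apply: cvgMr_tmp.
      have [/set_mem[k _ Fk]|no] := boolP (o \in \bigcup_k F k).
        apply: cvg_near_cst; exists k.+1 => // n /= kn.
        by rewrite !indicE !mem_set//; [exists k|exists k].
      apply: cvg_near_cst; apply: nearW => n; rewrite !indicE (negbTE no).
      rewrite memNset// => -[k _ Fk]; move/negP : no; apply; apply/mem_set.
      by exists k.
  have cz : \int[P]_o (\1_(Un n) o * K o) @[n --> \oo] --> (0 : R).
    rewrite (_ : (fun n => _) = fun=> 0); first exact: cvg_cst.
    by apply/funext.
  by rewrite -(cvg_lim (@Rhausdorff R) cv); exact: cvg_lim.
Qed.

End pi_lambda.

(** * Dynkin's formula *)

Section markov.
Variable R : realType.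
Context dW (W : measurableType dW) (Q : probability W R).
Variables (tau mark : W -> R) (rest : W -> W).
Hypotheses (mtau : measurable_fun setT tau) (mmark : measurable_fun setT mark)
  (mrest : measurable_fun setT rest).
Hypothesis tau_gt0 : forall w, 0 < tau w.
Hypothesis tau_unb : forall w (x : R), exists n, x < \sum_(i < n) tau (iter i rest w).
Variable c : {posnum R}.
Hypothesis law : forall f : R * R * W -> R, bmeas f ->
  \int[Q]_w f (tau w, mark w, rest w) =
  \int[expl c]_t \int[@unif R]_v \int[Q]_w f (t, v, w).
Variables (lp lm : R -> state R -> R).
Hypotheses (mlp : measurable_fun setT (fun z : R * state R => lp z.1 z.2))
  (mlm : measurable_fun setT (fun z : R * state R => lm z.1 z.2)).
Hypotheses (lp0 : forall r X, 0 <= lp r X) (lm0 : forall r X, 0 <= lm r X).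
Hypothesis lc : forall r X, lp r X + lm r X <= c%:num.

Local Notation U := (@unif R).
Local Notation J := (thin lp lm c).
Local Notation Z := (R * state R * W)%type.
Local Notation Phi := (Phi mark tau_gt0 tau_unb J).

Let mJ := measurable_thin c mlp mlm.
Let mPhi : measurable_fun setT (fun p : R * Z => Phi p.1 p.2) :=
  measurable_Phi mtau mmark mrest tau_gt0 tau_unb mJ.

Lemma measurable_Phi_comp d (T : measurableType d) (r : T -> R) (z : T -> Z) :
  measurable_fun setT r -> measurable_fun setT z ->
  measurable_fun setT (fun x => Phi (r x) (z x)).
Proof. by move=> mr mz; exact: (measurableT_comp mPhi (measurable_fun_pair mr mz)). Qed.

(* [y] consists of the first waiting time, the first mark and the remaining
   noise. *)
Definition Phi0 (a : R) (X : state R) (y : R * R * W) (t : R) : state R :=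
  if t < a + y.1.1 then flow X (t - a)
  else Phi t (a + y.1.1, J (a + y.1.1) (flow X y.1.1) y.1.2, y.2).

Lemma Phi_Phi0 a X w t : a <= t ->
  Phi t (a, X, w) = Phi0 a X (tau w, mark w, rest w) t.
Proof. by move=> at_; rewrite Phi_rec. Qed.

Lemma Phi_start a X w : Phi a (a, X, w) = X.
Proof. by rewrite Phi_Phi0// /Phi0 /= ltrDl tau_gt0 subrr flow0. Qed.

(** Without a potential jump up to [s], the clock may be restarted there from the flowed state with
    the residual waiting time; [memoryless] then makes the residual time a fresh one. *)
Lemma Phi0_restart a s X t v w r : a <= s -> s <= r -> s - a < t ->
  Phi0 a X (t, v, w) r = Phi0 s (flow X (s - a)) (t - (s - a), v, w) r.
Proof.
move=> as_ sr st; rewrite /Phi0 /=.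
have -> : s + (t - (s - a)) = a + t by ring.
case: ifP => _.
  by rewrite flow_flow ?subr_ge0//; congr flow; ring.
rewrite flow_flow ?subr_ge0// ?(ltW st)//.
by have -> : s - a + (t - (s - a)) = t by ring.
Qed.

Lemma Phi0_next a X t v w r : a + t <= r ->
  Phi0 a X (t, v, w) r = Phi r (a + t, J (a + t) (flow X t) v, w).
Proof. by rewrite /Phi0 /= ltNge => ->. Qed.

Lemma measurable_after (a : R) (X : state R) :
  measurable_fun setT (fun y : R * R * W => (a + y.1.1, J (a + y.1.1) (flow X y.1.1) y.1.2, y.2)).
Proof.
have m11 : measurable_fun setT (fun y : R * R * W => y.1.1).
  exact: measurableT_comp measurable_fst measurable_fst.
have m12 : measurable_fun setT (fun y : R * R * W => y.1.2).
  exact: measurableT_comp measurable_snd measurable_fst.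
have ma : measurable_fun setT (fun y : R * R * W => a + y.1.1).
  by apply: measurable_funD => //; exact: measurable_cst.
apply: measurable_fun_pair => //; apply: measurable_fun_pair => //.
apply: (measurableT_comp mJ (g := fun y : R * R * W => (a + y.1.1, flow X y.1.1, y.1.2))).
apply: measurable_fun_pair => //; apply: measurable_fun_pair => //.
by apply: measurable_flow_comp => //; exact: measurable_cst.
Qed.

Lemma measurable_Phi0 a X : measurable_fun setT (fun p : (R * R * W) * R => Phi0 a X p.1 p.2).
Proof.
have m1 : measurable_fun setT (fun p : (R * R * W) * R => p.1.1.1).
  apply: (measurableT_comp _ measurable_fst (f := fun y : R * R * W => y.1.1)).
  exact: measurableT_comp measurable_fst measurable_fst.
apply: measurable_fun_ifT.
- by apply: measurable_fun_ltr => //; apply: measurable_funD => //; exact: measurable_cst.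
- apply: measurable_flow_comp; first exact: measurable_cst.
  by apply: measurable_funB => //; exact: measurable_cst.
- apply: measurable_Phi_comp => //.
  exact: (measurableT_comp (measurable_after a X) measurable_fst).
Qed.

Lemma bmeas_E23 (f : R * R * W -> R) : bmeas f ->
  bmeas (fun t => \int[U]_v \int[Q]_w f (t, v, w)).
Proof.
move=> bf; pose eU : probability (R * R)%type R := (expl c \x U)%E.
exact: (bmeas_E2 (expl c) U (bmeas_E2 eU Q bf)).
Qed.

Lemma bmeas_E3 (f : R * R * W -> R) t : bmeas f ->
  bmeas (fun v => \int[Q]_w f (t, v, w)).
Proof.
move=> bf; pose eU : probability (R * R)%type R := (expl c \x U)%E.
exact: (bmeas_pair1 (bmeas_E2 eU Q bf) t).
Qed.

Lemma norm_E23_le (f : R * R * W -> R) t D : bmeas f ->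
  (forall v, `|\int[Q]_w f (t, v, w)| <= D) -> `|\int[U]_v \int[Q]_w f (t, v, w)| <= D.
Proof.
move=> bf fD; rewrite -[leRHS](E_cst U); apply: norm_E_le => //.
- exact: bmeas_E3.
- exact: bmeas_cst.
Qed.

(* [1 - expR (- (c * T))] is the probability that the first waiting time is at
   most [T]; it is the contraction factor in the arguments by induction on the
   first potential jump. *)
Lemma first_jump_damping (f : R * R * W -> R) (T D : R) : 0 <= T -> 0 <= D -> bmeas f ->
  \int[expl c]_t ((T < t)%R%:R * \int[U]_v \int[Q]_w f (t, v, w)) = 0 ->
  (forall t v, 0 < t -> t <= T -> `|\int[Q]_w f (t, v, w)| <= D) ->
  `|\int[Q]_w f (tau w, mark w, rest w)| <= (1 - expR (- (c%:num * T))) * D.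
Proof.
move=> T0 D0 bf tail0 small; rewrite law//.
have b2 := bmeas_E23 bf.
have bT : bmeas (fun t : R => ((t <= T)%R%:R : R)) by exact: bmeas_le.
have -> : \int[expl c]_t \int[U]_v \int[Q]_w f (t, v, w) =
    \int[expl c]_t ((t <= T)%R%:R * \int[U]_v \int[Q]_w f (t, v, w)).
  rewrite -[RHS]addr0 -[X in _ = _ + X]tail0 -ED.
  - apply: eq_Rintegral => t _; rewrite -mulrDl ltNge.
    by case: (t <= T) => /=; rewrite ?addr0 ?add0r mul1r.
  - exact: bmeasM.
  - by apply: bmeasM => //; exact: bmeas_gt.
have -> : \int[expl c]_t ((t <= T)%R%:R * \int[U]_v \int[Q]_w f (t, v, w)) =
    \int[expl c]_t (\1_(`]0, +oo[%classic) t * ((t <= T)%R%:R * \int[U]_v \int[Q]_w f (t, v, w))).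
  apply: (E_ae (measurable_itv `]0, +oo[) (expl_pos c)).
  - exact: bmeasM.
  - by apply: bmeasM; [exact: bmeas_indic|exact: bmeasM].
  - by move=> t t0; rewrite indicE mem_set// mul1r.
rewrite mulrC -(E_expl_le c T0) -EZ//; apply: norm_E_le.
- by apply: bmeasM; [exact: bmeas_indic|exact: bmeasM].
- by apply: bmeasM => //; exact: bmeas_cst.
move=> t; rewrite indicE; have [|_] := boolP (t \in _); last first.
  by rewrite mul0r normr0 mulr_ge0.
rewrite inE/= in_itv/= andbT => t0; rewrite mul1r.
have [tT|_] := leP t T; last by rewrite mul0r normr0 mulr0.
rewrite mul1r mulr1; apply: norm_E23_le => // v; exact: small.
Qed.

Section dynkin_formula.
Variable g : state R -> R.
Hypothesis tg : test_function g.
Variable t : R.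
Hypothesis t0 : 0 <= t.

Definition gen (r : R) (X : state R) : R := jump_op lp lm g r X + flow_deriv g X.

Lemma bmeas_gen : bmeas (fun z : R * state R => gen z.1 z.2).
Proof.
apply: bmeasD; first exact: (bmeas_jump_op mlp mlm lp0 lm0 lc (bmeas_test tg)).
exact: (bmeas_comp measurable_snd (bmeas_flow_deriv tg)).
Qed.

(** The increment over [[s, t]] of the process of the martingale problem. Integrating an indicator
    against the fixed [lebI t], rather than using [lebI (t - s)], makes measurability in [s] a case
    of Fubini. *)
Definition compensated (s : R) (p : R -> state R) : R :=
  g (p t) - g (p s) - \int[lebI t]_q (\1_(`[0, t - s]%classic) q * gen (s + q) (p (s + q))).

Lemma compensated_eq s p p' : s <= t -> (forall r, s <= r -> p r = p' r) ->
  compensated s p = compensated s p'.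
Proof.
move=> st pp; rewrite /compensated (pp t st) (pp s (lexx s)); congr (_ - _); apply: eq_Rintegral => q _.
rewrite indicE; have [|_] := boolP (q \in _); last by rewrite !mul0r.
by rewrite inE/= in_itv/= => /andP[q0 _]; rewrite pp// lerDl.
Qed.

Lemma bmeas_compensated d (T : measurableType d) (s : T -> R) (p : T -> R -> state R) :
  measurable_fun setT s -> measurable_fun setT (fun z : T * R => p z.1 z.2) ->
  bmeas (fun x => compensated (s x) (p x)).
Proof.
move=> ms mp.
have mpt (r : T -> R) : measurable_fun setT r -> measurable_fun setT (fun x => p x (r x)).
  by move=> mr; exact: (measurableT_comp mp (measurable_fun_pair (@measurable_id _ _ setT) mr)).
have bg := bmeas_test tg.
apply: bmeasB; first by apply: bmeasB; apply: bmeas_comp bg; apply: mpt => //; exact: measurable_cst.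
have mq : measurable_fun setT (fun z : T * R => s z.1 + z.2).
  by apply: measurable_funD => //; exact: measurableT_comp ms measurable_fst.
(* The Dirac mass supplies the finite measure on the first factor with which [bmeas_E2] is
   stated. *)
pose m0 : probability T R := dirac point.
apply: (bmeas_E2 m0 (lebI t) (f := fun z : T * R => \1_(`[0, t - s z.1]%classic) z.2 * gen (s z.1 + z.2) (p z.1 (s z.1 + z.2)))).
apply: bmeasM; last first.
  apply: (bmeas_comp (h := fun z : T * R => (s z.1 + z.2, p z.1 (s z.1 + z.2))) _ bmeas_gen).
  apply: measurable_fun_pair => //.
  exact: (measurableT_comp mp (measurable_fun_pair measurable_fst mq)).
have -> : (fun z : T * R => (\1_(`[0, t - s z.1]%classic) z.2 : R)) =
   \1_([set z : T * R | 0 <= z.2] `&` [set z | 0 <= t - s z.1 - z.2]).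
  apply/funext => z; rewrite !indicE; congr (nat_of_bool _)%:R.
  apply/idP/idP => /set_mem/=; rewrite ?in_itv/=.
    by move=> /andP[h1 h2]; apply/mem_set; split => //=; rewrite subr_ge0.
  by rewrite subr_ge0 => -[h1 h2]; apply/mem_set; rewrite /= in_itv/= h1.
have pos (h : T * R -> R) : measurable_fun setT h -> measurable [set z | 0 <= h z].
  move=> mh; have -> : [set z | 0 <= h z] = h @^-1` `[0, +oo[%classic.
    by apply/seteqP; split => z /=; rewrite in_itv/= andbT.
  exact: measurable_preimageT.
apply: bmeas_indic; apply: measurableI; first exact: pos.
apply: pos; apply: measurable_funB => //; apply: measurable_funB; first exact: measurable_cst.
exact: measurableT_comp ms measurable_fst.
Qed.

Let path (z : Z) (r : R) : state R := Phi r z.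

Let mpath : measurable_fun setT (fun p : Z * R => path p.1 p.2).
Proof. by apply: measurable_Phi_comp. Qed.

Let mPhi0 := measurable_Phi0.

Let bcomp s X : bmeas (fun w => compensated s (path (s, X, w))).
Proof.
apply: (bmeas_compensated (measurable_cst _)).
apply: measurable_Phi_comp => //.
exact: (measurableT_comp (measurable_fun_pair (measurable_cst (s, X)) (@measurable_id _ _ setT)) measurable_fst).
Qed.

Let blt (f : R -> R) T : bmeas f -> bmeas (fun q : R => (q < T)%R%:R * f q).
Proof. by move=> bf; apply: bmeasM => //; exact: bmeas_ltr. Qed.

Let bseg T' (f : R -> R) : bmeas f -> bmeas (fun q : R => \1_(`[0, T']%classic) q * f q).
Proof. by move=> bf; apply: bmeasM => //; apply: bmeas_indic; exact: measurable_itv. Qed.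

Lemma E_lebI_ae U (f1 f2 : R -> R) (a : R) : bmeas f1 -> bmeas f2 ->
  (forall q, 0 <= q -> q <= U -> q != a -> f1 q = f2 q) ->
  \int[lebI U]_q f1 q = \int[lebI U]_q f2 q.
Proof.
move=> b1 b2 f12; pose B := (`[0, U]%classic `\ a : set R).
have mB : measurable B by apply: measurableD; [exact: measurable_itv|exact: measurable_set1].
apply: (E_ae mB) => //.
  apply: (@subset_measure0 _ _ _ lebesgue_measure _ [set a]) => //.
  - by apply: measurableI; [exact: measurableC|exact: measurable_itv].
  - by move=> x [/= nB xU]; apply: contrapT => xa; apply: nB; split.
  - exact: lebesgue_measure_set1.
move=> q [/=]; rewrite in_itv/= => /andP[q0 qU] /eqP qa; exact: f12.
Qed.

Lemma E_lebI_before U T (f : R -> R) : 0 <= T -> T <= U -> bmeas f ->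
  \int[lebI U]_q ((q < T)%R%:R * f q) = \int[lebI T]_q f q.
Proof.
move=> T0 TU bf; rewrite -(lebI_sub TU)//.
apply: (@E_lebI_ae _ _ _ T); [exact: blt|exact: bseg|] => q q0 qU qT.
congr (_ * _); rewrite indicE; congr (nat_of_bool _)%:R.
apply/idP/idP; rewrite inE/= in_itv/= q0/=; first exact: ltW.
by rewrite lt_neqAle qT.
Qed.

Lemma E_lebI_after U T (f : R -> R) : 0 <= T -> T <= U -> bmeas f ->
  \int[lebI U]_q ((T <= q)%R%:R * f q) = \int[lebI (U - T)]_q f (T + q).
Proof.
move=> T0 TU bf.
have b1 : bmeas (fun q : R => (T <= q)%R%:R * f q).
  have -> : (fun q : R => (T <= q)%R%:R * f q) = (fun q : R => f q - (q < T)%R%:R * f q).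
    by apply/funext => q; rewrite leNgt; case: (q < T) => /=; ring.
  by apply: bmeasB => //; exact: blt.
have ms : measurable_fun setT (fun q : R => T + q).
  by apply: measurable_funD => //; exact: measurable_cst.
rewrite (lebI_shift T0 TU b1).
have -> : \int[lebI T]_q ((T <= q)%R%:R * f q) = 0.
  rewrite -[RHS](mul0r (\int[lebI T]_q f q)) -EZ//.
  apply: (@E_lebI_ae _ _ _ T) => //; first by apply: bmeasM => //; exact: bmeas_cst.
  by move=> q q0 qT nq; rewrite leNgt lt_neqAle nq qT.
rewrite add0r; apply: (@E_lebI_ae _ _ _ 0).
- exact: (bmeas_comp ms b1).
- exact: (bmeas_comp ms bf).
- by move=> q q0 _ _; rewrite lerDl q0 mul1r.
Qed.

Let bflow s X : bmeas (fun q : R => jump_op lp lm g (s + q) (flow X q)).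
Proof.
apply: (bmeas_comp (h := fun q => (s + q, flow X q)) _ (bmeas_jump_op mlp mlm lp0 lm0 lc (bmeas_test tg))).
apply: measurable_fun_pair; first by apply: measurable_funD => //; exact: measurable_cst.
by apply: measurable_flow_comp => //; exact: measurable_cst.
Qed.

Let bderiv X : bmeas (fun q : R => flow_deriv g (flow X q)).
Proof.
apply: (bmeas_comp _ (bmeas_flow_deriv tg)).
by apply: measurable_flow_comp => //; exact: measurable_cst.
Qed.

Let bgenp z s : bmeas (fun q : R => gen (s + q) (path z (s + q))).
Proof.
have mq : measurable_fun setT (fun q : R => s + q).
  by apply: measurable_funD => //; exact: measurable_cst.
apply: (bmeas_comp (h := fun q => (s + q, path z (s + q))) _ bmeas_gen).
apply: measurable_fun_pair => //.
by apply: measurable_Phi_comp => //; exact: measurable_cst.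
Qed.

(** Up to the first potential jump the derivative along the flow integrates exactly, by
    [test_flow_FTC]. There remain the jump of [g], its compensator accumulated so far, and the same
    functional restarted after the jump. *)
Lemma compensated_first s X T v w : 0 <= s -> s <= t -> 0 < T ->
  compensated s (Phi0 s X (T, v, w)) =
  (T <= t - s)%R%:R * (compensated (s + T) (path (s + T, J (s + T) (flow X T) v, w)) +
     (g (J (s + T) (flow X T) v) - g (flow X T)))
  - \int[lebI (t - s)]_q ((q < T)%R%:R * jump_op lp lm g (s + q) (flow X q)).
Proof.
move=> s0 st T0; set z := (s + T, _, w).
have ts0 : 0 <= t - s by rewrite subr_ge0.
have tst : t - s <= t by rewrite gerBl.
pose f1 := fun q => jump_op lp lm g (s + q) (flow X q).
pose f2 := fun q => flow_deriv g (flow X q).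
pose f3 := fun q => gen (s + q) (path z (s + q)).
have b1 : bmeas f1 by exact: bflow.
have b2 : bmeas f2 by exact: bderiv.
have b3 : bmeas f3 by exact: bgenp.
have bT (f : R -> R) : bmeas f -> bmeas (fun q : R => (T <= q)%R%:R * f q).
  move=> bf; have -> : (fun q : R => (T <= q)%R%:R * f q) = (fun q => f q - (q < T)%R%:R * f q).
    by apply/funext => q; rewrite leNgt; case: (q < T) => /=; ring.
  by apply: bmeasB => //; exact: blt.
have eG : (fun q => gen (s + q) (Phi0 s X (T, v, w) (s + q))) =
    (fun q : R => (q < T)%R%:R * f1 q + (q < T)%R%:R * f2 q + (T <= q)%R%:R * f3 q).
  apply/funext => q; rewrite /Phi0 /= ltrD2l leNgt -/z.
  rewrite [s + q - s]addrAC subrr add0r /f1 /f2 /f3 /gen.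
  by case: (q < T) => /=; ring.
have bG : bmeas (fun q : R => gen (s + q) (Phi0 s X (T, v, w) (s + q))).
  by rewrite eG; apply: bmeasD; [apply: bmeasD; exact: blt|exact: bT].
rewrite -/f1.
have E0 : Phi0 s X (T, v, w) s = X by rewrite /Phi0 /= ltrDl T0 subrr flow0.
rewrite /compensated (lebI_sub tst bG) eG E0.
rewrite ED; [|by apply: bmeasD; exact: blt|exact: bT].
rewrite ED; [|exact: blt..].
have [TU|UT] := leP T (t - s).
  rewrite (E_lebI_before (ltW T0) TU b2) -(test_flow_FTC tg X (ltW T0)).
  rewrite (E_lebI_after (ltW T0) TU b3).
  have sTt : s + T <= t by rewrite addrC -lerBrDr.
  rewrite Phi0_next// -/z.
  have -> : path z (s + T) = z.1.2 by exact: Phi_start.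
  have tst' : t - (s + T) <= t by rewrite gerBl addr_ge0// ltW.
  have bg3 : bmeas (fun q : R => gen (s + T + q) (path z (s + T + q))) by exact: bgenp.
  rewrite (lebI_sub tst' bg3) opprD addrA.
  have -> : \int[lebI (t - s - T)]_q f3 (T + q) =
      \int[lebI (t - s - T)]_q gen (s + T + q) (path z (s + T + q)).
    by apply: eq_Rintegral => q _; rewrite /f3 addrA.
  rewrite -[t - s - T]addrA -opprD /z /path /f1 /=; ring.
have -> : Phi0 s X (T, v, w) t = flow X (t - s) by rewrite /Phi0 /= addrC -ltrBlDr UT.
have -> : \int[lebI (t - s)]_q ((T <= q)%R%:R * f3 q) = 0.
  rewrite -[RHS](mul0r (\int[lebI (t - s)]_q f3 q)) -EZ//.
  apply: (@E_lebI_ae _ _ _ T) => //; [exact: bT|by apply: bmeasM => //; exact: bmeas_cst|].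
  by move=> q q0 qT nq; rewrite leNgt (le_lt_trans qT UT).
have -> : \int[lebI (t - s)]_q ((q < T)%R%:R * f2 q) = \int[lebI (t - s)]_q f2 q.
  apply: (@E_lebI_ae _ _ _ T) => //; first exact: blt.
  by move=> q q0 qT nq; rewrite (le_lt_trans qT UT) mul1r.
rewrite -(test_flow_FTC tg X ts0) /f1 /= mul0r; ring.
Qed.

Let bk s X (f : Z -> R) : bmeas f ->
  bmeas (fun y : R * R * W => f (s + y.1.1, J (s + y.1.1) (flow X y.1.1) y.1.2, y.2)).
Proof. by move=> bf; apply: bmeas_comp bf; exact: measurable_after. Qed.

(** In the mean, the first jump and its compensator cancel. Only the restarted functional is left,
    on the event that the first potential jump occurs before [t], whose probability is the
    contraction factor. *)
Lemma dynkin_zero s X : 0 <= s -> s <= t ->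
  \int[Q]_w compensated s (path (s, X, w)) = 0.
Proof.
move=> s0 st.
pose D (z : R * state R) := \int[Q]_w compensated z.1 (path (z.1, z.2, w)).
pose P (z : R * state R) := 0 <= z.1 <= t.
suff : forall z, P z -> D z = 0 by move=> /(_ (s, X)); rewrite /P/= s0 st; exact.
have btot : bmeas (fun z : Z => compensated z.1.1 (path z)).
  apply: bmeas_compensated => //; exact: measurableT_comp measurable_fst measurable_fst.
have [_ [C DC]] := btot.
have c0 : 0 < c%:num by [].
apply: (@contraction0 _ _ P D (1 - expR (- (c%:num * t))) C).
- by rewrite subr_ge0 expR_neg_le1 ?mulr_ge0//= ltrBlDr ltrDl expR_gt0.
- move=> D0 D00 small [r Y] /andP[/= r0 rt].
  pose f1 := fun q => jump_op lp lm g (r + q) (flow Y q).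
  have b1 : bmeas f1 by exact: bflow.
  have U0 : 0 <= t - r by rewrite subr_ge0.
  pose nx (y : R * R * W) : Z := (r + y.1.1, J (r + y.1.1) (flow Y y.1.1) y.1.2, y.2).
  have my11 : measurable_fun setT (fun y : R * R * W => y.1.1).
    exact: measurableT_comp measurable_fst measurable_fst.
  have mfl : measurable_fun setT (fun y : R * R * W => flow Y y.1.1).
    by apply: measurable_flow_comp => //; exact: measurable_cst.
  have mnx : measurable_fun setT nx by exact: measurable_after.
  have ble : bmeas (fun y : R * R * W => (y.1.1 <= t - r)%R%:R : R).
    exact: (bmeas_comp my11 (bmeas_le (t - r))).
  have bg := bmeas_test tg.
  pose T1 := fun y : R * R * W => (y.1.1 <= t - r)%R%:R * compensated (nx y).1.1 (path (nx y)).
  have bT1 : bmeas T1 by apply: bmeasM => //; exact: (bmeas_comp mnx btot).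
  pose T2 := fun y : R * R * W => (y.1.1 <= t - r)%R%:R * (g (nx y).1.2 - g (flow Y y.1.1)).
  have bT2 : bmeas T2.
    apply: bmeasM => //; apply: bmeasB; last exact: (bmeas_comp mfl bg).
    apply: (bmeas_comp (h := fun y => (nx y).1.2) _ bg).
    apply: (measurableT_comp (_ : measurable_fun setT (fun z : Z => z.1.2)) mnx).
    exact: measurableT_comp measurable_snd measurable_fst.
  pose f3 (x : R) := \int[lebI (t - r)]_q ((q < x)%R%:R * f1 q).
  have bf3 : bmeas f3.
    apply: (bmeas_E2 (expl c) (lebI (t - r)) (f := fun z : R * R => (z.2 < z.1)%R%:R * f1 z.2)).
    apply: bmeasM; first exact: bmeas_lt2.
    exact: bmeas_comp measurable_snd b1.
  pose T3 := fun y : R * R * W => f3 y.1.1.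
  have bT3 : bmeas T3 by exact: (bmeas_comp my11 bf3).
  have mh : measurable_fun setT (fun w => (tau w, mark w, rest w)).
    by apply: measurable_fun_pair => //; exact: measurable_fun_pair.
  have eD : D (r, Y) = \int[Q]_w T1 (tau w, mark w, rest w) +
     (\int[Q]_w T2 (tau w, mark w, rest w) - \int[Q]_w T3 (tau w, mark w, rest w)).
    rewrite -EB; [|exact: (bmeas_comp mh bT2)|exact: (bmeas_comp mh bT3)].
    rewrite -ED; [|exact: (bmeas_comp mh bT1)|]; last first.
      by apply: bmeasB; [exact: (bmeas_comp mh bT2)|exact: (bmeas_comp mh bT3)].
    apply: eq_Rintegral => w _ /=.
    rewrite (@compensated_eq r _ (Phi0 r Y (tau w, mark w, rest w))) => //; last first.
      by move=> r' rr'; exact: Phi_Phi0.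
    rewrite compensated_first// /T1 /T2 /T3 /f3 /f1 /=; ring.
  (* Averaging over the mark gives [c^-1] times [jump_op] at the waiting time, by [E_thin];
     [compensator] turns this into an integral up to the waiting time. *)
  have e2 : \int[Q]_w T2 (tau w, mark w, rest w) = \int[Q]_w T3 (tau w, mark w, rest w).
    rewrite (law bT2) (law bT3).
    transitivity (\int[expl c]_x ((x <= t - r)%R%:R * (c%:num^-1 * f1 x))).
      apply: eq_Rintegral => x _; rewrite /T2 /=.
      have bth : bmeas (fun v => g (J (r + x) (flow Y x) v)).
        apply: (bmeas_comp _ bg).
        exact: (measurableT_comp mJ (measurable_fun_pair (measurable_cst (r + x, flow Y x)) (@measurable_id _ _ setT))).
      under eq_Rintegral do rewrite E_cst.
      rewrite EZ; last by apply: bmeasB => //; exact: bmeas_cst.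
      congr (_ * _); rewrite EB//; last exact: bmeas_cst.
      by rewrite E_cst E_thin//; rewrite addrAC subrr add0r.
    rewrite compensator//; last by apply: bmeasM => //; exact: bmeas_cst.
    have -> : \int[expl c]_x \int[lebI (t - r)]_q ((q < x)%R%:R * (c%:num^-1 * f1 q)) =
        \int[expl c]_x (c%:num^-1 * f3 x).
      apply: eq_Rintegral => x _; rewrite -EZ; last exact: blt.
      by apply: eq_Rintegral => q _; rewrite mulrCA.
    rewrite EZ// mulrA divff ?mul1r ?gt_eqF//.
    apply: eq_Rintegral => x _; rewrite -[LHS](E_cst U).
    by apply: eq_Rintegral => v _; rewrite -[LHS](E_cst Q).
  rewrite eD e2 subrr addr0.
  have h1 : `|\int[Q]_w T1 (tau w, mark w, rest w)| <= (1 - expR (- (c%:num * (t - r)))) * D0.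
    apply: first_jump_damping => //.
      rewrite -[RHS](mul0r (\int[expl c]_x 0)) -EZ; last exact: bmeas_cst.
      apply: eq_Rintegral => x _; rewrite mul0r.
      have [rx|_] := ltP (t - r) x; last by rewrite mul0r.
      rewrite mul1r; under eq_Rintegral.
        move=> v _; under eq_Rintegral.
          move=> w _; rewrite /T1 /= leNgt rx mul0r; over.
        rewrite E_cst; over.
      by rewrite E_cst.
    move=> x v x0 xr; have := small (nx (x, v, point)).1; rewrite /P /D /= => h.
    have -> : \int[Q]_w T1 (x, v, w) =
      \int[Q]_w compensated (r + x) (path (r + x, J (r + x) (flow Y x) v, w)).
      by apply: eq_Rintegral => w _; rewrite /T1 /= xr mul1r.
    by apply: h; rewrite addr_ge0 ?(ltW x0)//= addrC -lerBrDr.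
  (* The factor for the horizon [t - r] is at most the one for [t], and the contraction argument
     requires a single constant. *)
  apply: le_trans h1 _; apply: ler_wpM2r => //.
  by rewrite lerD2l lerN2 ler_expR lerN2 ler_wpM2l// gerBl.
- move=> [r Y] /andP[/= r0 rt]; rewrite -[leRHS](E_cst Q); apply: norm_E_le.
  + exact: bcomp.
  + exact: bmeas_cst.
  + by move=> w; exact: (DC (r, Y, w)).
Qed.

End dynkin_formula.

End markov.

(** * The Markov property *)

Section cylinders.
Variable R : realType.

Definition cyl n (r : 'I_n -> R) (A : 'I_n -> set (state R)) (p : R -> state R) : R :=
  \prod_(i < n) \1_(A i) (p (r i)).

Lemma bmeas_prod_ord d (T : measurableType d) n (f : 'I_n -> T -> R) :
  (forall i, bmeas (f i)) -> bmeas (fun x => \prod_(i < n) f i x).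
Proof.
elim: n f => [|n IH] f bf.
  by under eq_fun do rewrite big_ord0; exact: bmeas_cst.
by under eq_fun do rewrite big_ord_recr; apply: bmeasM => //; exact: IH.
Qed.

Lemma cyl01 n (r : 'I_n -> R) A p : 0 <= cyl r A p <= 1.
Proof.
apply: (big_ind (fun x : R => 0 <= x <= 1)) => //; first by rewrite ler01 lexx.
  by move=> x y /andP[x0 x1] /andP[y0 y1]; rewrite mulr_ge0//= mulr_ile1.
by move=> i _; rewrite indicE; case: (_ \in _); rewrite /= ?lexx ?ler01.
Qed.

Lemma cyl_indic n (r : 'I_n -> R) A p : cyl r A p = (`[< forall i, A i (p (r i)) >])%:R.
Proof.
case: asboolP => [h|/existsNP[i h]].
  by rewrite /cyl big1// => i _; rewrite indicE mem_set.
by rewrite /cyl (bigD1 i)//= indicE memNset// mul0r.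
Qed.

End cylinders.

Section restart.
Variable R : realType.
Context dW (W : measurableType dW) (Q : probability W R).
Variables (tau mark : W -> R) (rest : W -> W).
Hypotheses (mtau : measurable_fun setT tau) (mmark : measurable_fun setT mark)
  (mrest : measurable_fun setT rest).
Hypothesis tau_gt0 : forall w, 0 < tau w.
Hypothesis tau_unb : forall w (x : R), exists n, x < \sum_(i < n) tau (iter i rest w).
Variable c : {posnum R}.
Hypothesis law : forall f : R * R * W -> R, bmeas f ->
  \int[Q]_w f (tau w, mark w, rest w) =
  \int[expl c]_t \int[@unif R]_v \int[Q]_w f (t, v, w).
Variables (lp lm : R -> state R -> R).
Hypotheses (mlp : measurable_fun setT (fun z : R * state R => lp z.1 z.2))
  (mlm : measurable_fun setT (fun z : R * state R => lm z.1 z.2)).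

Local Notation U := (@unif R).
Local Notation J := (thin lp lm c).
Local Notation Z := (R * state R * W)%type.
Local Notation Phi := (Phi mark tau_gt0 tau_unb J).
Local Notation Phi0 := (Phi0 mark tau_gt0 tau_unb c lp lm).

Variables (s : R) (H : (R -> state R) -> R).
Hypothesis s0 : 0 <= s.
Hypothesis H_after : forall p p', (forall r, s <= r -> p r = p' r) -> H p = H p'.
Hypothesis H_meas : forall d (T : measurableType d) (p : T -> R -> state R),
  measurable_fun setT (fun z : T * R => p z.1 z.2) -> bmeas (fun x => H (p x)).
Hypothesis H0 : forall X, \int[Q]_w H (fun r => Phi r (s, X, w)) = 0.

Let mPhi := measurable_Phi_comp mtau mmark mrest tau_gt0 tau_unb c mlp mlm.
Let mPhi0 := measurable_Phi0 mtau mmark mrest tau_gt0 tau_unb c mlp mlm.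

(* The Markov property in the form: whatever is observed before [s], a functional
   of the future with vanishing mean for every starting state has mean [0]. *)
Lemma restart_start n (r : 'I_n -> R) (A : 'I_n -> set (state R)) (a : R) X :
  0 <= a <= s -> (forall i, a <= r i <= s) -> (forall i, measurable (A i)) ->
  \int[Q]_w (cyl r A (fun q => Phi q (a, X, w)) * H (fun q => Phi q (a, X, w))) = 0.
Proof.
(* The claim is generalised over the starting time and state and over the cylinder, since a first
   potential jump changes all of them. *)
pose I := (('I_n -> R) * ('I_n -> set (state R)) * (R * state R))%type.
pose P (i : I) := [/\ 0 <= i.2.1 <= s, (forall j, i.2.1 <= i.1.1 j <= s) &
   (forall j, measurable (i.1.2 j))].
pose D (i : I) := \int[Q]_w (cyl i.1.1 i.1.2 (fun q => Phi q (i.2.1, i.2.2, w)) *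
   H (fun q => Phi q (i.2.1, i.2.2, w))).
suff K : forall i, P i -> D i = 0.
  by move=> h1 h2 h3; apply: (K (r, A, (a, X))).
move=> {r A a X}.
have bcyl d (T : measurableType d) r (A : 'I_n -> set (state R)) (p : T -> R -> state R) :
    (forall j, measurable (A j)) ->
    measurable_fun setT (fun z : T * R => p z.1 z.2) -> bmeas (fun x => cyl r A (p x)).
  move=> mA mp; apply: bmeas_prod_ord => i.
  apply: (bmeas_comp (h := fun x => p x (r i)) _ (bmeas_indic R (mA i))).
  exact: (measurableT_comp mp (measurable_fun_pair (@measurable_id _ _ setT) (measurable_cst (r i)))).
have mpath (a : R) X : measurable_fun setT (fun z : W * R => Phi z.2 (a, X, z.1)).
  by apply: mPhi => //; exact: (measurable_fun_pair (measurable_cst (a, X)) measurable_fst).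
have bH : bmeas (fun z : Z => H (fun q => Phi q z)).
  by apply: (H_meas (p := fun z q => Phi q z)); exact: mPhi.
have [_ [C HC]] := bH.
apply: (@contraction0 _ _ P D (1 - expR (- (c%:num * s))) C).
- by rewrite subr_ge0 expR_neg_le1 ?mulr_ge0//= ltrBlDr ltrDl expR_gt0.
- move=> D0 D00 small [[r A] [a X]] [/= /andP[a0 as_] ra mA].
  have sa0 : 0 <= s - a by rewrite subr_ge0.
  pose f (y : R * R * W) := cyl r A (Phi0 a X y) * H (Phi0 a X y).
  have bf : bmeas f by apply: bmeasM; [exact: bcyl|exact: H_meas].
  have bH0 Y : bmeas (fun y => H (Phi0 s Y y)) by exact: H_meas.
  have E Y : \int[expl c]_t \int[U]_v \int[Q]_w H (Phi0 s Y (t, v, w)) = 0.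
    rewrite -(law (bH0 Y)) -[RHS](H0 Y); apply: eq_Rintegral => w _.
    by apply: H_after => q sq; rewrite Phi_Phi0.
  pose Y := flow X (s - a).
  pose kap := cyl r A (fun q => flow X (q - a)).
  (* With no potential jump up to [s] the observations are those of the flow and contribute the
     constant [kap]. By [memoryless] the residual noise is fresh, and [H] has mean zero when started
     from [Y]. *)
  have tail0 : \int[expl c]_t (((s - a) < t)%R%:R * \int[U]_v \int[Q]_w f (t, v, w)) = 0.
    pose h (x : R) := \int[U]_v \int[Q]_w H (Phi0 s Y (x, v, w)).
    have bh : bmeas h by exact: (bmeas_E23 Q c (bH0 Y)).
    transitivity (\int[expl c]_t (kap * (((s - a) < t)%R%:R * h (t - (s - a))))); last first.
      rewrite EZ ?memoryless// ?E ?mulr0//.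
      apply: bmeasM; first exact: bmeas_gt.
      apply: bmeas_comp bh; apply: measurable_funB => //; exact: measurable_cst.
    apply: eq_Rintegral => x _; have [sx|_] := ltP (s - a) x; last by rewrite !mul0r mulr0.
    rewrite !mul1r /h -EZ; last exact: (bmeas_E3 Q c (x - (s - a)) (bH0 Y)).
    apply: eq_Rintegral => v _; rewrite -EZ; last exact: (bmeas_pair1 (bH0 Y) (x - (s - a), v)).
    apply: eq_Rintegral => w _; rewrite /f; congr (_ * _).
      apply: eq_bigr => i _; rewrite /Phi0 /=; have /andP[_ ris] := ra i.
      by rewrite ifT//; apply: le_lt_trans ris _; rewrite -ltrBlDl.
    by apply: H_after => q sq; exact: Phi0_restart.
  have h1 : `|\int[Q]_w f (tau w, mark w, rest w)| <= (1 - expR (- (c%:num * (s - a)))) * D0.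
    apply: first_jump_damping => // x v x0 xr.
    have axs : a + x <= s by rewrite addrC -lerBrDr.
    (* Observations before the jump are read off the flow and factor out as [kp]. They are replaced
       by the void condition [setT] at time [s], so the cylinder keeps its length and all its times
       lie in [[a + x, s]]. *)
    pose r' i := if r i < a + x then s else r i.
    pose A' i := if r i < a + x then setT else A i.
    pose Y' := J (a + x) (flow X x) v.
    pose kp := \prod_(i < n) (if r i < a + x then \1_(A i) (flow X (r i - a)) else 1 : R).
    have -> : \int[Q]_w f (x, v, w) = kp * D (r', A', (a + x, Y')).
      rewrite /D /= -EZ; last first.
        apply: bmeasM; last exact: (H_meas (mpath _ _)).
        apply: bcyl => // j; rewrite /A'; case: ifP => // _; exact: mA.
      apply: eq_Rintegral => w _; rewrite mulrA /f; congr (_ * _); last first.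
        by apply: H_after => q sq; rewrite Phi0_next//; exact: le_trans sq.
      rewrite /cyl /kp -big_split /=; apply: eq_bigr => i _.
      rewrite /A' /r' /Phi0 /=; case: ifP => _; last by rewrite mul1r.
      by rewrite indicT mulr1.
    rewrite normrM -[leRHS]mul1r; apply: ler_pM => //.
      have : 0 <= kp <= 1.
        apply: (big_ind (fun x : R => 0 <= x <= 1)) => //; first by rewrite ler01 lexx.
          by move=> x1 y /andP[x10 x11] /andP[y0 y1]; rewrite mulr_ge0//= mulr_ile1.
        move=> i _; case: ifP => _; last by rewrite ler01 lexx.
        by rewrite indicE; case: (_ \in _); rewrite /= ?lexx ?ler01.
      by move=> /andP[k0 k1]; rewrite ger0_norm.
    apply: small; split => /=.
    - by rewrite addr_ge0// ltW.
    - move=> j; rewrite /r'; have /andP[h3 h4] := ra j.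
      by have [_|h5] := ltP (r j) (a + x); apply/andP; split.
    - by move=> j; rewrite /A'; case: ifP.
  have -> : D (r, A, (a, X)) = \int[Q]_w f (tau w, mark w, rest w).
    apply: eq_Rintegral => w _; rewrite /f /=; congr (_ * _).
      by apply: eq_bigr => i _; have /andP[h3 _] := ra i; rewrite Phi_Phi0.
    by apply: H_after => q sq; rewrite Phi_Phi0//; exact: le_trans sq.
  apply: le_trans h1 _; apply: ler_wpM2r => //.
  by rewrite lerD2l lerN2 ler_expR lerN2 ler_wpM2l// gerBl.
- move=> [[r A] [a X]] [/= _ _ mA].
  rewrite -[leRHS](E_cst Q); apply: norm_E_le.
  + by apply: bmeasM; [exact: bcyl|exact: (H_meas (mpath a X))].
  + exact: bmeas_cst.
  move=> w; rewrite normrM -[leRHS]mul1r; apply: ler_pM => //.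
    by have /andP[k0 k1] := cyl01 r A (fun q => Phi q (a, X, w)); rewrite ger0_norm.
Qed.

End restart.

(** * Rates and natural filtrations *)

Section measurable_families.
Context d d' (Z : measurableType d) (T : measurableType d') (R : realType).
Variable kap : Z -> probability T R.
Hypothesis mkap : forall A, measurable A -> measurable_fun setT (fun z => kap z A).

Let kap_ker (z : Z) : {measure set T -> \bar R} := kap z.

HB.instance Definition _ := @isKernel.Build _ _ Z T R kap_ker mkap.
Let kap_ker1 z : kap_ker z setT = 1%E. Proof. exact: probability_setT. Qed.
HB.instance Definition _ := @Kernel_isProbability.Build _ _ Z T R kap_ker kap_ker1.

Lemma measurable_E_family (f : Z * T -> R) :
  measurable_fun setT f -> (forall z, 0 <= f z) ->
  measurable_fun setT (fun z => \int[kap z]_y f (z, y)).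
Proof.
move=> mf f0.
have := @measurable_fun_integral_finite_kernel _ _ Z T R (EFin \o f) kap_ker.
move=> /(_ (fun z => f0 z)) h.
have h2 : measurable_fun setT (fun z => \int[kap z]_y (f (z, y))%:E)%E.
  by apply: h; exact/measurable_EFinP.
exact: (measurableT_comp (fine_measurable measurableT) h2).
Qed.

End measurable_families.

Section rates.
Variable R : realType.
Implicit Types (lam : R -> state R -> state R -> R) (m : R -> probability (state R) R).

(** Times are truncated at [0], here and in [rate], so that data given on the half-line become total
    measurable functions of a real time. *)
Definition measurable_family m : Prop := forall A, measurable A ->
  measurable_fun setT (fun r : R => m (Num.max 0 r) A).

Definition rate lam m (r : R) (X : state R) : R :=
  Lambda lam (Num.max 0 r) X (m (Num.max 0 r)).

Lemma max0_ge0 (r : R) : 0 <= Num.max 0 r.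
Proof. by rewrite le_max lexx. Qed.

Lemma measurable_max0 : measurable_fun setT (fun r : R => Num.max 0 r).
Proof. by apply: measurable_maxr => //; exact: measurable_cst. Qed.

Variable lam : R -> state R -> state R -> R.
Hypothesis hlam : rate_function lam.

Lemma measurable_rate_clamp :
  measurable_fun setT (fun z : R * state R * state R => lam (Num.max 0 z.1.1) z.1.2 z.2).
Proof.
pose D := [set p : R * state R * state R | 0 <= p.1.1].
have m11 : measurable_fun setT (fun z : R * state R * state R => z.1.1).
  exact: measurableT_comp measurable_fst measurable_fst.
have m12 : measurable_fun setT (fun z : R * state R * state R => z.1.2).
  exact: measurableT_comp measurable_snd measurable_fst.
have mD : measurable D.
  have -> : D = (fun z : R * state R * state R => z.1.1) @^-1` `[0, +oo[%classic.
    by apply/seteqP; split => z /=; rewrite /D /= in_itv/= andbT.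
  by apply: measurable_preimageT => //; exact: measurable_itv.
suff h : measurable_fun setT ((fun p : R * state R * state R => lam p.1.1 p.1.2 p.2) \o
    (fun z : R * state R * state R => (Num.max 0 z.1.1, z.1.2, z.2))) by exact: h.
apply: (@measurable_comp _ _ _ _ _ _ D) => //.
- by move=> _ [z _ <-]; exact: max0_ge0.
- exact: rate_measurable hlam.
- apply: measurable_fun_pair => //; apply: measurable_fun_pair => //.
  exact: (measurableT_comp measurable_max0 m11).
Qed.

Lemma bmeas_rate_clamp :
  bmeas (fun z : R * state R * state R => lam (Num.max 0 z.1.1) z.1.2 z.2).
Proof.
split; first exact: measurable_rate_clamp.
have [C HC] := rate_bounded hlam; exists C => z.
rewrite ger0_norm; first by apply: HC; exact: max0_ge0.
by apply: (rate_ge0 hlam); exact: max0_ge0.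
Qed.

Lemma bmeas_lam t X : 0 <= t -> bmeas (lam t X).
Proof.
move=> t0; have := bmeas_pair1 bmeas_rate_clamp (t, X).
by rewrite /= max_r.
Qed.

Lemma rate_ge0' m r X : 0 <= rate lam m r X.
Proof.
apply: Rintegral_ge0 => Y _; apply: (rate_ge0 hlam); exact: max0_ge0.
Qed.

Lemma measurable_rate m : measurable_family m ->
  measurable_fun setT (fun z : R * state R => rate lam m z.1 z.2).
Proof.
move=> mm; apply: (@measurable_E_family _ _ _ _ R (fun z : R * state R => m (Num.max 0 z.1))
  _ (fun z : R * state R * state R => lam (Num.max 0 z.1.1) z.1.2 z.2)).
- move=> A mA; exact: (measurableT_comp (mm A mA) measurable_fst).
- exact: measurable_rate_clamp.
- by move=> z; apply: (rate_ge0 hlam); exact: max0_ge0.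
Qed.

End rates.

Lemma measurable_pprobability_family (R : realType) (m : R -> pprobability (state R) R) :
  measurable_fun [set s : R | 0 <= s] m -> measurable_family m.
Proof.
move=> mm.
have m2 : measurable_fun setT (fun r : R => m (Num.max 0 r)).
  suff h : measurable_fun setT (m \o (fun r : R => Num.max 0 r)) by exact: h.
  apply: (@measurable_comp _ _ _ _ _ _ [set s : R | 0 <= s]) => //.
  - have -> : [set s : R | 0 <= s] = `[0, +oo[%classic.
      by apply/seteqP; split => z /=; rewrite in_itv/= andbT.
    exact: measurable_itv.
  - by move=> _ [r _ <-]; exact: max0_ge0.
  - exact: measurable_max0.
by move=> A mA; exact: (measurable_kernel (kprobability m2) A mA).
Qed.

Lemma rate_bound_ex (R : realType) (lamp lamm : R -> state R -> state R -> R) :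
  rate_function lamp -> rate_function lamm -> exists c : {posnum R},
  forall t X Y, 0 <= t -> lamp t X Y + lamm t X Y <= c%:num.
Proof.
move=> hp hm; have [Cp HCp] := rate_bounded hp; have [Cm HCm] := rate_bounded hm.
(* The summand [1] keeps [c] positive even when both rates vanish. *)
have c0 : 0 < `|Cp| + `|Cm| + 1 by rewrite ltr_wpDl// addr_ge0.
exists (PosNum c0) => t X Y t0; apply: (@le_trans _ _ (`|Cp| + `|Cm|)); last by rewrite lerDl.
by apply: lerD; [apply: le_trans (HCp t X Y t0) (ler_norm _)|apply: le_trans (HCm t X Y t0) (ler_norm _)].
Qed.

Section conditional_expectation.
Context (R : realType) d (Om : measurableType d) (P : probability Om R).
Implicit Types (f Z Y : Om -> R).

Lemma integral_indic_E A f : measurable A -> bmeas f ->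
  (\int[P]_(o in A) (f o)%:E = (\int[P]_o (\1_A o * f o))%:E)%E.
Proof.
move=> mA bf.
rewrite -(Rintegral_fin2 P (bmeasM (bmeas_indic R mA) bf)).
rewrite integral_mkcond; apply: eq_integral => o _.
by rewrite patchE indicE; case: (o \in A); rewrite ?mul1r ?mul0r.
Qed.

Lemma is_cond_expP (G : set_system Om) Z Y : G `<=` measurable -> bmeas Z -> bmeas Y ->
  measurable_wrt G Y -> (forall A, G A -> \int[P]_o (\1_A o * (Z o - Y o)) = 0) ->
  is_cond_exp P G Z Y.
Proof.
move=> Gm bZ bY mY H; split => //.
  exact: bmeas_integrable.
move=> A GA; have mA := Gm A GA; rewrite !integral_indic_E//; congr EFin.
have bA := bmeas_indic R mA.
apply/eqP; rewrite eq_sym -subr_eq0 -EB; [|exact: bmeasM..].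
by rewrite -[X in _ == X](H A GA); apply/eqP; apply: eq_Rintegral => o _; rewrite mulrBr.
Qed.

Lemma is_cond_exp_E (G : set_system Om) Z Y A : measurable A -> bmeas Z -> bmeas Y ->
  is_cond_exp P G Z Y -> G A -> \int[P]_o (\1_A o * (Z o - Y o)) = 0.
Proof.
move=> mA bZ bY [_ _ H] GA; have := H A GA; rewrite !integral_indic_E// => -[e].
have bA := bmeas_indic R mA.
under eq_Rintegral do rewrite mulrBr.
by rewrite EB ?e ?subrr//; exact: bmeasM.
Qed.

End conditional_expectation.

Section natural_filtrations.
Context (R : realType) d (Om : measurableType d) (P : probability Om R).
Variable X : R -> {mfun Om >-> state R}.

Lemma measurable_process t : measurable_fun setT (X t).
Proof. exact: measurable_funPT. Qed.

Lemma natural_filtration_measurable t : natural_filtration X t `<=` measurable.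
Proof.
apply: smallest_sub; first exact: sigma_algebra_measurable.
move=> B [s _ [A mA <-]]; rewrite setTI.
by apply: measurable_preimageT => //; exact: measurable_process.
Qed.

Lemma natural_filtration_coord s t A : 0 <= s -> s <= t -> measurable A ->
  natural_filtration X t (X s @^-1` A).
Proof.
move=> s0 st mA; apply: sub_sigma_algebra; exists s; first by rewrite /= in_itv/= s0.
by exists A => //; rewrite setTI.
Qed.

Lemma natural_filtrationS s t : s <= t -> natural_filtration X s `<=` natural_filtration X t.
Proof.
move=> st; apply: smallest_sub; first exact: smallest_sigma_algebra.
move=> B [r rs] h; apply: sub_sigma_algebra; exists r => //.
by move: rs; rewrite /= !in_itv/= => /andP[-> rs]; exact: le_trans st.
Qed.

Lemma natural_filtrationT s : natural_filtration X s setT.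
Proof.
exact: (@measurableT _ (g_sigma_algebraType (\bigcup_(r in `[0, s]) g_sigma_algebra_preimage (X r)))).
Qed.

Lemma natural_filtrationI s A B : natural_filtration X s A -> natural_filtration X s B ->
  natural_filtration X s (A `&` B).
Proof.
move=> FA FB; exact: (@measurableI _ (g_sigma_algebraType (\bigcup_(r in `[0, s]) g_sigma_algebra_preimage (X r))) A B FA FB).
Qed.

(** Cylinders are stable under intersection, by concatenating their lists of times, and they
    generate the past, so [pi_lambda_E] applies. *)
Lemma natural_E s (K : Om -> R) : bmeas K -> 0 <= s ->
  (forall n (r : 'I_n -> R) (A : 'I_n -> set (state R)),
    (forall i, 0 <= r i <= s) -> (forall i, measurable (A i)) ->
    \int[P]_o (cyl r A (X ^~ o) * K o) = 0) ->
  forall B, natural_filtration X s B -> \int[P]_o (\1_B o * K o) = 0.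
Proof.
move=> bK s0 H.
pose G := [set B : set Om | exists n (r : 'I_n -> R) (A : 'I_n -> set (state R)),
   [/\ (forall i, 0 <= r i <= s), (forall i, measurable (A i)) &
     B = [set o | forall i, A i (X (r i) o)]]].
have GI : setI_closed G.
  move=> B1 B2 [n1 [r1 [A1 [h1 m1 ->]]]] [n2 [r2 [A2 [h2 m2 ->]]]].
  exists (n1 + n2)%N, (fun i => match fintype.split i with inl i => r1 i | inr i => r2 i end),
    (fun i => match fintype.split i with inl i => A1 i | inr i => A2 i end); split.
  - by move=> i; case: fintype.split.
  - by move=> i; case: fintype.split.
  - apply/seteqP; split => o /=.
      by move=> [g1 g2] i; case: fintype.split.
    move=> h; split => i.
      by have := h (unsplit (inl i)); rewrite unsplitK.
    by have := h (unsplit (inr i)); rewrite unsplitK.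
have GT : G setT.
  exists 0%N, (fun=> 0), (fun=> setT); split => //.
    by case.
  by apply/seteqP; split => o // _ [].
have Gm : G `<=` measurable.
  move=> B [n [r [A [h m ->]]]].
  have -> : [set o | forall i, A i (X (r i) o)] = \bigcap_(i in [set: 'I_n]) (X (r i) @^-1` A i).
    by apply/seteqP; split => o /= h' i; [move=> _; exact: h'|exact: (h' i Logic.I)].
  apply: fin_bigcap_measurable => // i _.
  by apply: measurable_preimageT => //; exact: measurable_process.
have HG B : G B -> \int[P]_o (\1_B o * K o) = 0.
  move=> [n [r [A [h m ->]]]]; rewrite -[RHS](H n r A h m).
  apply: eq_Rintegral => o _; congr (_ * _); rewrite cyl_indic indicE.
by congr (nat_of_bool _)%:R; apply/idP/asboolP => [/set_mem|h1] //; exact/mem_set.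
have := @pi_lambda_E R _ Om P G K GI GT Gm bK HG => PL.
move=> B FB; apply: PL; move: B FB; apply: smallest_sub.
  exact: smallest_sigma_algebra.
move=> B [r /=]; rewrite in_itv/= => rs [A mA <-]; apply: sub_sigma_algebra.
exists 1%N, (fun=> r), (fun=> A); split => //.
by rewrite setTI; apply/seteqP; split => o /= h; [move=> _|exact: (h ord0)].
Qed.

End natural_filtrations.

(** * The martingale problem in terms of compensated increments *)

Section dynkin_of_process.
Variable R : realType.
Variables (lp lm : R -> state R -> R) (c : {posnum R}).
Hypotheses (mlp : measurable_fun setT (fun z : R * state R => lp z.1 z.2))
  (mlm : measurable_fun setT (fun z : R * state R => lm z.1 z.2)).
Hypotheses (lp0 : forall r X, 0 <= lp r X) (lm0 : forall r X, 0 <= lm r X).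
Hypothesis lc : forall r X, lp r X + lm r X <= c%:num.
Variable g : state R -> R.
Hypothesis tg : test_function g.

Definition dynkin (p : R -> state R) (t : R) : R :=
  g (p t) - g (p 0) - \int[lebI t]_r gen lp lm g r (p (clip t r)).

Let bg := bmeas_test tg.
Let bgen := bmeas_gen mlp mlm lp0 lm0 lc tg.

Lemma bmeas_dynkin d (Om : measurableType d) (X : R -> Om -> state R) (t : R) : 0 <= t ->
  (forall r, 0 <= r -> r <= t -> measurable_fun setT (X r)) ->
  (forall o r, 0 <= r -> r < t -> X s o @[s --> r^'+] --> X r o) ->
  bmeas (fun o => dynkin (X ^~ o) t).
Proof.
move=> t0 mX rcX; have mj := joint_measurable_process t0 mX rcX.
apply: bmeasB.
  by apply: bmeasB; apply: bmeas_comp bg; apply: mX.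
pose m0 : probability Om R := dirac point.
apply: (bmeas_E1 (lebI t) m0 (f := fun z : R * Om => gen lp lm g z.1 (X (clip t z.1) z.2))).
apply: (bmeas_comp (h := fun z : R * Om => (z.1, X (clip t z.1) z.2)) _ bgen).
exact: measurable_fun_pair.
Qed.

Lemma bmeas_gen_path d (Om : measurableType d) (X : R -> Om -> state R) (t : R) o : 0 <= t ->
  (forall r, 0 <= r -> r <= t -> measurable_fun setT (X r)) ->
  (forall o r, 0 <= r -> r < t -> X s o @[s --> r^'+] --> X r o) ->
  bmeas (fun r => gen lp lm g r (X (clip t r) o)).
Proof.
move=> t0 mX rcX; have mj := joint_measurable_process t0 mX rcX.
apply: (bmeas_comp (h := fun r => (r, X (clip t r) o)) _ bgen).
apply: measurable_fun_pair => //.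
exact: (measurableT_comp mj (measurable_fun_pair (@measurable_id _ _ setT) (measurable_cst o))).
Qed.

Lemma dynkin_increment d (Om : measurableType d) (X : R -> Om -> state R) (s t : R) o :
  0 <= s -> s <= t ->
  (forall r, 0 <= r -> r <= t -> measurable_fun setT (X r)) ->
  (forall o r, 0 <= r -> r < t -> X s o @[s --> r^'+] --> X r o) ->
  dynkin (X ^~ o) t - dynkin (X ^~ o) s = compensated lp lm g t s (X ^~ o).
Proof.
move=> s0 st mX rcX; have t0 := le_trans s0 st.
have ts0 : 0 <= t - s by rewrite subr_ge0.
have tst : t - s <= t by rewrite gerBl.
have bt := bmeas_gen_path o t0 mX rcX.
have bs : bmeas (fun r => gen lp lm g r (X (clip s r) o)).
  apply: bmeas_gen_path => //.
  - by move=> r r0 rs; apply: mX => //; exact: le_trans st.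
  - by move=> o' r r0 rs; apply: rcX => //; exact: lt_le_trans st.
have ms : measurable_fun setT (fun q : R => s + q).
  by apply: measurable_funD => //; exact: measurable_cst.
rewrite /dynkin /compensated (lebI_shift s0 st bt).
have -> : \int[lebI s]_r gen lp lm g r (X (clip t r) o) =
    \int[lebI s]_r gen lp lm g r (X (clip s r) o).
  apply: (@E_lebI_ae _ _ _ _ 0) => // r r0 rs _.
  by rewrite !clip_id//; exact: le_trans st.
have -> : \int[lebI (t - s)]_q gen lp lm g (s + q) (X (clip t (s + q)) o) =
    \int[lebI t]_q (\1_(`[0, t - s]%classic) q * gen lp lm g (s + q) (X (s + q) o)).
  rewrite -(lebI_sub tst (bmeas_comp ms bt)); apply: eq_Rintegral => q _.
  rewrite indicE; have [|_] := boolP (q \in _); last by rewrite !mul0r.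
  rewrite inE/= in_itv/= => /andP[q0 qt]; rewrite clip_id// ?addr_ge0//.
  by rewrite addrC -lerBrDr.
by ring.
Qed.

End dynkin_of_process.

Section dynkin_process_lemmas.
Variable R : realType.
Variables (lamp lamm : R -> state R -> state R -> R).
Hypotheses (hp : rate_function lamp) (hm : rate_function lamm).
Variable c : {posnum R}.
Hypothesis Hc : forall t X Y, 0 <= t -> lamp t X Y + lamm t X Y <= c%:num.
Variable m : R -> probability (state R) R.
Hypothesis mm : measurable_family m.

Local Notation lp := (rate lamp m).
Local Notation lm := (rate lamm m).

Lemma measurable_lp : measurable_fun setT (fun z : R * state R => lp z.1 z.2).
Proof. exact: measurable_rate. Qed.
Lemma measurable_lm : measurable_fun setT (fun z : R * state R => lm z.1 z.2).
Proof. exact: measurable_rate. Qed.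

Lemma rates_le r X : lp r X + lm r X <= c%:num.
Proof.
rewrite -[leRHS](E_cst (m (Num.max 0 r))) /rate /Lambda -ED; last first.
- by apply: bmeas_lam => //; exact: max0_ge0.
- by apply: bmeas_lam => //; exact: max0_ge0.
apply: le_E.
- by apply: bmeasD; apply: bmeas_lam => //; exact: max0_ge0.
- exact: bmeas_cst.
- by move=> Y; apply: Hc; exact: max0_ge0.
Qed.

Let mlp := measurable_lp.
Let mlm := measurable_lm.
Let lp0 := rate_ge0' hp m.
Let lm0 := rate_ge0' hm m.
Let lc := rates_le.

Variables (d : measure_display) (Om : measurableType d) (P : probability Om R)
  (X : R -> {mfun Om >-> state R}).
Hypothesis rcX : forall o r, 0 <= r -> X s o @[s --> r^'+] --> X r o.

Let mX r : measurable_fun setT (X r). Proof. exact: measurable_process. Qed.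

Variable g : state R -> R.
Hypothesis tg : test_function g.

Lemma generator_gen s Y : 0 <= s -> generator lamp lamm s Y (m s) g Y = gen lp lm g s Y.
Proof.
move=> s0; rewrite /generator /gen /jump_op /flow_deriv /rate max_r//; ring.
Qed.

Lemma dynkin_processE t o : 0 <= t ->
  dynkin_process X lamp lamm m g t o = dynkin lp lm g (X ^~ o) t.
Proof.
move=> t0; rewrite /dynkin_process /dynkin; congr (_ - _).
rewrite -lebIE; last first.
  apply: (bmeas_gen_path mlp mlm lp0 lm0 lc tg (X := fun r => X r : Om -> state R)) => //.
  by move=> o' r r0 _; exact: rcX.
apply: eq_Rintegral => r; rewrite inE/= in_itv/= => /andP[r0 rt].
by rewrite generator_gen// clip_id.
Qed.

Lemma bmeas_dynkin_process t : 0 <= t -> bmeas (dynkin_process X lamp lamm m g t).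
Proof.
move=> t0; have -> : dynkin_process X lamp lamm m g t = (fun o => dynkin lp lm g (X ^~ o) t).
  by apply/funext => o; exact: dynkin_processE.
apply: (bmeas_dynkin mlp mlm lp0 lm0 lc tg (X := fun r => X r : Om -> state R)) => //.
by move=> o r r0 _; exact: rcX.
Qed.

(** The process is read on [Om] equipped with the sigma-algebra of the past at [t]. There [X r] is
    measurable for [r <= t], which is what [bmeas_dynkin] asks for. *)
Lemma dynkin_process_adapted t : 0 <= t ->
  measurable_wrt (natural_filtration X t) (dynkin_process X lamp lamm m g t).
Proof.
move=> t0; have -> : dynkin_process X lamp lamm m g t = (fun o => dynkin lp lm g (X ^~ o) t).
  by apply/funext => o; exact: dynkin_processE.
pose Om' := g_sigma_algebraType (\bigcup_(s in `[0, t]) g_sigma_algebra_preimage (X s)).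
pose X' (r : R) : Om' -> state R := X r.
have mX' r : 0 <= r -> r <= t -> measurable_fun setT (X' r).
  move=> r0 rt _ A mA; rewrite setTI; exact: natural_filtration_coord.
have [mD _] : bmeas (fun o : Om' => dynkin lp lm g (X' ^~ o) t).
  by apply: (bmeas_dynkin mlp mlm lp0 lm0 lc tg) => // o r r0 _; exact: rcX.
by move=> B mB; have := mD measurableT B mB; rewrite setTI.
Qed.

Lemma dynkin_process_increment s t o : 0 <= s -> s <= t ->
  dynkin_process X lamp lamm m g t o - dynkin_process X lamp lamm m g s o =
  compensated lp lm g t s (X ^~ o).
Proof.
move=> s0 st; rewrite !dynkin_processE ?(le_trans s0 st)//.
apply: (dynkin_increment mlp mlm lp0 lm0 lc tg (X := fun r => X r : Om -> state R)) => //.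
by move=> o' r r0 _; exact: rcX.
Qed.

(** Adaptedness and integrability follow from right continuity and bounded rates, so the martingale
    property comes down to increments with mean zero on past events. Existence and uniqueness both
    use it in this form. *)
Lemma martingale_dynkinP : 
  (forall s t B, 0 <= s -> s <= t -> natural_filtration X s B ->
    \int[P]_o (\1_B o * compensated lp lm g t s (X ^~ o)) = 0) <->
  martingale P (natural_filtration X) (dynkin_process X lamp lamm m g).
Proof.
split=> [H|[_ H] s t B s0 st FB].
  split=> [t t0|s t s0 st].
    split; first exact: dynkin_process_adapted.
    exact/bmeas_integrable/bmeas_dynkin_process.
  apply: is_cond_expP.
  - exact: natural_filtration_measurable.
  - exact: bmeas_dynkin_process (le_trans s0 st).
  - exact: bmeas_dynkin_process.
  - exact: dynkin_process_adapted.
  - move=> A FA; rewrite -[RHS](H s t A s0 st FA); apply: eq_Rintegral => o _.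
    by rewrite dynkin_process_increment.
have mB := natural_filtration_measurable FB.
have := is_cond_exp_E mB (bmeas_dynkin_process (le_trans s0 st)) (bmeas_dynkin_process s0) (H s t s0 st) FB.
by move=> <-; apply: eq_Rintegral => o _; rewrite dynkin_process_increment.
Qed.

End dynkin_process_lemmas.

(** * Existence for a given flow of laws *)

Section construction.
Variable R : realType.
Context dW (W : measurableType dW) (Q : probability W R).
Variables (tau mark : W -> R) (rest : W -> W).
Hypotheses (mtau : measurable_fun setT tau) (mmark : measurable_fun setT mark)
  (mrest : measurable_fun setT rest).
Hypothesis tau_gt0 : forall w, 0 < tau w.
Hypothesis tau_unb : forall w (x : R), exists n, x < \sum_(i < n) tau (iter i rest w).
Variable c : {posnum R}.
Hypothesis law : forall f : R * R * W -> R, bmeas f ->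
  \int[Q]_w f (tau w, mark w, rest w) =
  \int[expl c]_t \int[@unif R]_v \int[Q]_w f (t, v, w).
Variables (lamp lamm : R -> state R -> state R -> R).
Hypotheses (hp : rate_function lamp) (hm : rate_function lamm).
Hypothesis Hc : forall t X Y, 0 <= t -> lamp t X Y + lamm t X Y <= c%:num.
Variable m : R -> probability (state R) R.
Hypothesis mm : measurable_family m.
Variable mu0 : probability (state R) R.

Local Notation lp := (rate lamp m).
Local Notation lm := (rate lamm m).
Local Notation J := (thin lp lm c).
Local Notation Phi := (Phi mark tau_gt0 tau_unb J).

Let mlp := measurable_lp hp mm.
Let mlm := measurable_lm hm mm.
Let lp0 := rate_ge0' hp m.
Let lm0 := rate_ge0' hm m.
Let lc := rates_le hp hm Hc m.

Local Notation Om := (state R * W)%type.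
Let P : probability Om R := (mu0 \x Q)%E.

Let mPhi := measurable_Phi_comp mtau mmark mrest tau_gt0 tau_unb c mlp mlm.

Let process_meas (t : R) : measurable_fun setT (fun o : Om => Phi t (0, o.1, o.2)).
Proof.
apply: mPhi; first exact: measurable_cst.
apply: measurable_fun_pair => //; apply: measurable_fun_pair => //; exact: measurable_cst.
Qed.

Let process (t : R) : {mfun Om >-> state R} :=
  MeasurableFun.Pack (MeasurableFun.Class (isMeasurableFun.Build _ _ _ _ _ (process_meas t))).

Let process_path o : admissible_path (fun t => process t o) /\ piecewise_linear (fun t => process t o).
Proof. by apply: Phi_path => r X u; exact: thin_next. Qed.

Let rc o r : 0 <= r -> process s o @[s --> r^'+] --> process r o.
Proof. by move=> r0; have [[[h _] _] _] := process_path o; exact: h. Qed.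

(** [restart_start] integrated over the initial state and extended from cylinders to the whole
    past. *)
Let restart s (H : (R -> state R) -> R) : 0 <= s ->
  (forall p p', (forall r, s <= r -> p r = p' r) -> H p = H p') ->
  (forall d (T : measurableType d) (p : T -> R -> state R),
    measurable_fun setT (fun z : T * R => p z.1 z.2) -> bmeas (fun x => H (p x))) ->
  (forall X, \int[Q]_w H (fun r => Phi r (s, X, w)) = 0) ->
  forall B, natural_filtration process s B -> \int[P]_o (\1_B o * H (process ^~ o)) = 0.
Proof.
move=> s0 Ha Hm H0.
have mp : measurable_fun setT (fun z : Om * R => process z.2 z.1).
  apply: mPhi => //; apply: measurable_fun_pair.
    apply: measurable_fun_pair; first exact: measurable_cst.
    exact: (measurableT_comp measurable_fst measurable_fst).
  exact: (measurableT_comp measurable_snd measurable_fst).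
have bH : bmeas (fun o => H (process ^~ o)) by apply: (Hm _ _ (fun o => process ^~ o)).
apply: natural_E => // n r A hr mA.
have bcyl : bmeas (fun o => cyl r A (process ^~ o)).
  apply: bmeas_prod_ord => i.
  exact: (bmeas_comp (process_meas (r i)) (bmeas_indic R (mA i))).
transitivity (\int[mu0]_X \int[Q]_w
    (cyl r A (process ^~ (X, w)) * H (process ^~ (X, w)))).
  exact: (E_prod mu0 Q (bmeasM bcyl bH)).
rewrite -[RHS](E_cst mu0); apply: eq_Rintegral => X _.
apply: (restart_start mtau mmark mrest law mlp mlm s0 Ha Hm H0) => //.
by rewrite lexx.
Qed.

Let markov : markov_process P process.
Proof.
move=> s t A s0 st mA.
(* The transition probability from time [s] to time [t]. Evaluated at the state at time [s], it is a
   version of the conditional expectation for both sigma-algebras. *)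
pose ps Y := \int[Q]_w (\1_A (Phi t (s, Y, w)) : R).
pose H (p : R -> state R) : R := \1_A (p t) - ps (p s).
have bA := bmeas_indic R mA.
have bps : bmeas ps.
  apply: (bmeas_E2 mu0 Q (f := fun z : state R * W => \1_A (Phi t (s, z.1, z.2)))).
  apply: (bmeas_comp (h := fun z : state R * W => Phi t (s, z.1, z.2)) _ bA).
  apply: mPhi; first exact: measurable_cst.
  apply: measurable_fun_pair => //; apply: measurable_fun_pair => //; exact: measurable_cst.
have Hm d (T : measurableType d) (p : T -> R -> state R) :
    measurable_fun setT (fun z : T * R => p z.1 z.2) -> bmeas (fun x => H (p x)).
  move=> mp; have mpt r : measurable_fun setT (fun x => p x r).
    exact: (measurableT_comp mp (measurable_fun_pair (@measurable_id _ _ setT) (measurable_cst r))).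
  by apply: bmeasB; [exact: bmeas_comp (mpt t) bA|exact: bmeas_comp (mpt s) bps].
have H0 X : \int[Q]_w H (fun r => Phi r (s, X, w)) = 0.
  have mw r : measurable_fun setT (fun w => Phi r (s, X, w)).
    apply: mPhi; first exact: measurable_cst.
    exact: (measurable_fun_pair (measurable_cst (s, X)) (@measurable_id _ _ setT)).
  transitivity (\int[Q]_w (\1_A (Phi t (s, X, w)) - ps X)).
    by apply: eq_Rintegral => w _; rewrite /H Phi_start.
  rewrite EB; [|exact: bmeas_comp (mw t) bA|exact: bmeas_cst].
  by rewrite E_cst subrr.
have Ha p p' : (forall r, s <= r -> p r = p' r) -> H p = H p'.
  by move=> pp; rewrite /H (pp t st) (pp s (lexx s)).
have K := restart s0 Ha Hm H0.
have bX : bmeas (\1_A \o process t : Om -> R) by exact: bmeas_comp (process_meas t) bA.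
have bW : bmeas (ps \o process s : Om -> R) by exact: bmeas_comp (process_meas s) bps.
have sub : g_sigma_algebra_preimage (process s) `<=` natural_filtration process s.
  move=> B [C mC <-]; rewrite setTI; exact: natural_filtration_coord.
have mW : measurable_wrt (g_sigma_algebra_preimage (process s)) (ps \o process s : Om -> R).
  move=> B mB; exists (ps @^-1` B); last by rewrite setTI.
  by apply: measurable_preimageT => //; have [] := bps.
exists (ps \o process s).
  apply: is_cond_expP => //; last by move=> B /sub; exact: K.
  move=> B /sub; exact: natural_filtration_measurable.
apply: is_cond_expP => //; first exact: natural_filtration_measurable.
by move=> B mB; apply: sub; exact: mW.
Qed.

Let init : initial_law P process mu0.
Proof.
move=> A mA; rewrite /distribution /pushforward.
have -> : process 0 @^-1` A = A `*` setT.
  by apply/seteqP; split => -[X w] /=; rewrite Phi_start//; case.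
transitivity ((mu0 \x Q)%E (A `*` setT)); first by [].
rewrite product_measure1E// [X in (_ * X)%E](_ : _ = 1%E) ?mule1//.
exact: probability_setT.
Qed.

Let mart : martingale_problem P process lamp lamm m.
Proof.
move=> g tg; apply/(martingale_dynkinP hp hm Hc mm P rc tg) => s t B s0 st FB.
have t0 := le_trans s0 st.
have Ha p p' : (forall r, s <= r -> p r = p' r) ->
    compensated lp lm g t s p = compensated lp lm g t s p'.
  exact: compensated_eq.
have Hm d (T : measurableType d) (p : T -> R -> state R) :
    measurable_fun setT (fun z : T * R => p z.1 z.2) ->
    bmeas (fun x => compensated lp lm g t s (p x)).
  exact: (bmeas_compensated mlp mlm lp0 lm0 lc tg t (measurable_cst s)).
have H0 X := dynkin_zero mtau mmark mrest tau_gt0 tau_unb law mlp mlm lp0 lm0 lc tg t0 X s0 st.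
exact: (restart s0 Ha Hm H0 FB).
Qed.

Lemma construction : exists (d : measure_display) (Om : measurableType d)
    (P : probability Om R) (X : R -> {mfun Om >-> state R}),
  [/\ solution P X lamp lamm m mu0, markov_process P X &
      forall o : Om, piecewise_linear (fun t => X t o)].
Proof.
exists _, Om, P, process; split; [split|exact: markov|].
- by move=> o; have [] := process_path o.
- exact: init.
- exact: mart.
- by move=> o; have [] := process_path o.
Qed.

End construction.

Lemma solution_exists (R : realType) (lamp lamm : R -> state R -> state R -> R)
    (m : R -> probability (state R) R) (mu0 : probability (state R) R) :
  rate_function lamp -> rate_function lamm -> measurable_family m ->
  exists (d : measure_display) (Om : measurableType d)
    (P : probability Om R) (X : R -> {mfun Om >-> state R}),
  [/\ solution P X lamp lamm m mu0, markov_process P X &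
      forall o : Om, piecewise_linear (fun t => X t o)].
Proof.
move=> hp hm mm.
have [c Hc] := rate_bound_ex hp hm.
have [d [W [Q [tau [mark [rest [[mt mk mr] t0 tu law]]]]]]] := noise_exists c.
exact: (construction mt mk mr t0 tu law hp hm Hc mm mu0).
Qed.

(** * The forward equation *)

Section exponentials_are_test_functions.
Variable R : realType.
Variables (j : nat) (al be : R).
Hypotheses (al0 : 0 <= al) (be0 : 0 <= be).

Local Notation g := (expo j al be).

(** Makes the limits that define [pdx] and [pdy] unique, so that they can be computed. *)
Lemma increments_proper (a : R) : 0 <= a -> ProperFilter (increments a).
Proof.
move=> a0; split; last exact: within_filter.
move=> hA.
have /nbhs_ballP[e /= e0 He] : nbhs (0 : R) (fun h => h != 0 -> 0 <= a + h -> False) by exact: hA.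
apply: (He (e / 2)).
- by rewrite /ball/= sub0r normrN gtr0_norm ?divr_gt0//; lra.
- by rewrite gt_eqF ?divr_gt0.
- by rewrite addr_ge0// ltW// divr_gt0.
Qed.

Lemma expR_quot_cvg (a : R) : h^-1 * (expR (- (a * h)) - 1) @[h --> 0^'] --> - a.
Proof.
have D : is_derive (0 : R) 1 (fun h : R => expR (- (a * h))) (- a).
  have -> : - a = expR (- (a * 0)) *: (- a *: 1) :> R.
    by rewrite mulr0 oppr0 expR0 scale1r /GRing.scale/= mulr1.
  apply: (@is_derive1_comp _ expR (fun h : R => - (a * h))).
  have -> : (fun h : R => - (a * h)) = (fun h => (- a) *: h).
    by apply/funext => h; rewrite /GRing.scale/= mulNr.
  exact: is_deriveZ.
have [dD <-] := D; rewrite /derive; move: dD; rewrite /derivable => dD.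
have e : (fun h : R => h^-1 *: (((fun h : R => expR (- (a * h))) \o shift 0) (h *: 1) - expR (- (a * 0)))) =
    (fun h : R => h^-1 * (expR (- (a * h)) - 1)).
  apply/funext => h; rewrite /= /GRing.scale/= addr0 mulr1 mulr0 oppr0 expR0 //.
by rewrite -e; exact: dD.
Qed.

Lemma expo_ge0 X : 0 <= g X :> R.
Proof. by rewrite /expo !mulr_ge0// expR_ge0. Qed.

Lemma expo_le1 X : g X <= 1 :> R.
Proof.
have h1 : expR (- (al * st_x X)) <= 1 by apply: expR_neg_le1; rewrite mulr_ge0// st_x_ge0.
have h2 : expR (- (be * st_y X)) <= 1 by apply: expR_neg_le1; rewrite mulr_ge0// st_y_ge0.
have h3 := expR_ge0 (- (al * st_x X)); have h4 := expR_ge0 (- (be * st_y X)).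
rewrite /expo; case: (_ == _); last by rewrite !mul0r.
by rewrite mul1r; exact: mulr_ile1.
Qed.

Lemma expo_continuous : continuous (g : state R -> R).
Proof.
move=> X.
have ck : (fun Y : state R => ((st_k Y == j)%:R : R)) @ X --> ((st_k X == j)%:R : R).
    have nz : \forall Y \near X, (st_k Y == j)%:R = (st_k X == j)%:R :> R.
    by have := @nbhs_st_k R X; apply: filterS => Y /= ->.
  exact: cvg_near_cst nz.
have ce (a : R) (f : state R -> R) : continuous f ->
    (fun Y => expR (- (a * f Y))) @ X --> expR (- (a * f X)).
  move=> cf; apply: (@cvg_comp _ _ _ (fun Y => - (a * f Y)) expR); last exact: continuous_expR.
  exact: (cvgN (@cvgM _ _ _ _ (fun=> a) f a (f X) (cvg_cst a) (cf X))).
have cx := ce al (@st_x R) (@st_x_continuous R).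
have cy := ce be (@st_y R) (@st_y_continuous R).
have h := cvgM (cvgM ck cx) cy.
exact: h.
Qed.

Let quot_cvg X (a : R) (b : R) (f : R -> R) : 0 <= b ->
  (forall h, 0 <= b + h -> f h = h^-1 * (g X * expR (- (a * h)) - g X)) ->
  f @ increments b --> - a * g X.
Proof.
move=> b0 fE.
have h1 : g X * (h^-1 * (expR (- (a * h)) - 1)) @[h --> 0^'] --> g X * - a.
  by apply: cvgM; [exact: cvg_cst|exact: expR_quot_cvg].
move=> A; rewrite mulrC => /h1 hA.
change ((0 : R)^' (fun h => 0 <= b + h -> A (f h))).
have hA' : (0 : R)^' (fun h => A (g X * (h^-1 * (expR (- (a * h)) - 1)))) := hA.
apply: (@filterS _ (0 : R)^' _ _ _ _ hA') => h /= {}hA hb; rewrite fE//.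
by have -> : h^-1 * (g X * expR (- (a * h)) - g X) = g X * (h^-1 * (expR (- (a * h)) - 1)) by ring.
Qed.

Lemma expo_x_cvg X : quot_x g X @ increments (st_x X) --> - al * g X.
Proof.
apply: quot_cvg; first exact: st_x_ge0.
move=> h h0; rewrite /quot_x; congr (_ * (_ - _)).
rewrite /expo st_k_mk st_x_mk// -mulrA [in RHS]mulrC.
have -> : st_y (mkstate (st_k X) (st_x X + h) (st_y X)) = st_y X.
  have [k0|k0] := posnP (st_k X); first by rewrite !st_y_idle.
  by rewrite st_y_mk ?gtn_eqF// st_y_ge0.
rewrite mulrDr opprD expRD; ring.
Qed.

Lemma expo_y_cvg X : busy X -> quot_y g X @ increments (st_y X) --> - be * g X.
Proof.
move=> kX; apply: quot_cvg; first exact: st_y_ge0.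
move=> h h0; rewrite /quot_y; congr (_ * (_ - _)).
rewrite /expo st_k_mk st_x_mk ?st_x_ge0//.
have -> : st_y (mkstate (st_k X) (st_x X) (st_y X + h)) = st_y X + h.
  by rewrite st_y_mk// gtn_eqF.
rewrite mulrDr opprD expRD; ring.
Qed.

Lemma expo_pdx X : pdx g X = - al * g X :> R.
Proof.
have := increments_proper (st_x_ge0 X) => ?.
exact: (cvg_lim (@Rhausdorff R) (expo_x_cvg (X := X))).
Qed.

Lemma expo_pdy X : busy X -> pdy g X = - be * g X :> R.
Proof.
have := increments_proper (st_y_ge0 X) => ? kX.
exact: (cvg_lim (@Rhausdorff R) (expo_y_cvg kX)).
Qed.

Let Zg_continuous (a : R) : continuous (fun X => a * g X : R).
Proof. by move=> X; exact: (@cvgM _ _ _ _ (fun=> a) g a (g X) (cvg_cst a) (@expo_continuous X)). Qed.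

Let Zg_bounded (a : R) X : `|a * g X| <= `|a|.
Proof.
rewrite normrM -[leRHS]mulr1 ler_wpM2l//.
by rewrite ger0_norm ?expo_ge0// expo_le1.
Qed.

Lemma expo_test : test_function (g : state R -> R).
Proof.
have ex : pdx g = (fun X => - al * g X) :> (state R -> R) by apply/funext => X; exact: expo_pdx.
split.
- by exists 1 => X _; rewrite ger0_norm ?expo_ge0// expo_le1.
- exact: expo_continuous.
- by move=> X; apply/cvg_ex; exists (- al * g X); exact: expo_x_cvg.
- by exists `|- al| => X _; rewrite ex; exact: Zg_bounded.
- by rewrite ex; exact: Zg_continuous.
- by move=> X kX; apply/cvg_ex; exists (- be * g X); exact: expo_y_cvg.
- by exists `|- be| => X kX; rewrite expo_pdy//; exact: Zg_bounded.
- rewrite continuous_open_subspace; last exact: (@st_k_open R (fun k => (0 < k)%N)).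
  move=> X /set_mem kX.
  have nz : \forall Y \near X, - be * g Y = pdy g Y :> R.
    by have := @nbhs_st_k R X; apply: filterS => Y /= kY; rewrite expo_pdy// /busy/= kY.
  rewrite /continuous_at (expo_pdy kX); apply: cvg_trans (near_eq_cvg nz) _; exact: Zg_continuous.
Qed.

(** For [k = 0] the variable [y] does not run, so [be] counts only when [j > 0]. The transport part
    of the generator has [expo] as an eigenfunction, with eigenvalue minus this rate. *)
Definition decay_rate : R := al + (0 < j)%N%:R * be.

Lemma decay_rate_ge0 : 0 <= decay_rate.
Proof. by rewrite addr_ge0// mulr_ge0. Qed.

Lemma expo_flow_deriv X : flow_deriv g X = - decay_rate * g X :> R.
Proof.
rewrite /flow_deriv expo_pdx /decay_rate.
have [kj|kj] := eqVneq (st_k X) j; last first.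
  by rewrite {1 3}/expo (negbTE kj) !mul0r mulr0 mulr0 add0r; case: (ltnP 0 (st_k X)) => k0;
   rewrite ?mul0r// expo_pdy// /expo (negbTE kj) !mul0r !mulr0.
have -> : (0 < j)%N = (0 < st_k X)%N by rewrite kj.
have [k0|k0] := ltnP 0 (st_k X); last by rewrite !mul0r !addr0 mulNr.
rewrite expo_pdy// !mul1r; ring.
Qed.

Lemma expo_flow X h : 0 <= h -> g (flow X h) = expR (- (decay_rate * h)) * g X :> R.
Proof.
move=> h0; rewrite /expo st_k_flow st_x_flow// st_y_flow//.
have [kj|kj] := eqVneq (st_k X) j; last by rewrite !mul0r mulr0.
have -> : decay_rate = al + (0 < st_k X)%N%:R * be by rewrite /decay_rate kj.
have [k0|k0] := posnP (st_k X).
  rewrite (st_y_idle k0) mul0r addr0 mulr0 oppr0 expR0 !mulr1 !mul1r.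
  by rewrite mulrDr opprD expRD mulrC.
rewrite !mul1r -!expRD; congr expR; ring.
Qed.

End exponentials_are_test_functions.

Section reflection.
Variable R : realType.

Lemma lebesgue_measure_reflect (s : R) (A : set R) : measurable A ->
  lebesgue_measure ((fun x => s - x) @^-1` A) = lebesgue_measure A.
Proof.
move=> mA.
have ms : measurable_fun [set: measurableTypeR R] ((fun x => s - x) : measurableTypeR R -> measurableTypeR R).
  by apply: measurable_funB => //; exact: measurable_cst.
pose h : {mfun measurableTypeR R >-> measurableTypeR R} :=
  MeasurableFun.Pack (MeasurableFun.Class (isMeasurableFun.Build _ _ _ _ _ ms)).
have K (m : {measure set (measurableTypeR R) -> \bar R}) :
    (forall A, measurable A -> m A = lebesgue_measure (h @^-1` A)) ->
    forall A, measurable A -> lebesgue_measure A = m A.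
  move=> mE; apply: lebesgue_measure_unique => X [[a b] _ <-].
  rewrite mE; last exact: measurable_itv.
  rewrite (_ : h @^-1` _ = `[s - b, s - a[%classic); last first.
    apply/seteqP; split => x /=; rewrite !in_itv/= => /andP[? ?]; apply/andP; split; lra.
  rewrite !lebesgue_measure_itv /= !lte_fin ltrD2l ltrN2.
  by case: ifP => // _; rewrite -!EFinB; congr EFin; ring.
by apply: esym; apply: (K (pushforward lebesgue_measure h)).
Qed.

Lemma lebI_reflect (q : R) (f : R -> R) : bmeas f ->
  \int[lebI q]_v f v = \int[lebI q]_r f (q - r).
Proof.
have ms : measurable_fun setT (fun r : R => q - r).
  by apply: measurable_funB => //; exact: measurable_cst.
have bs (g : R -> R) : bmeas g -> bmeas (fun r : R => g (q - r)) by move=> bg; exact: bmeas_comp bg.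
move: f; apply: (@bmeas_ext _ _ R (fun f => \int[lebI q]_r f r)
   (fun f => \int[lebI q]_r f (q - r))).
- by have := @E_functional _ _ R (lebI q).
- split.
  + by move=> f g bf bg; rewrite !ED//; exact: bs.
  + by move=> r f bf; rewrite !EZ//; exact: bs.
  + by move=> f g bf bg fg; apply: le_E => //; exact: bs.
move=> A mA.
have mA' : measurable ((fun r => q - r) @^-1` A) by exact: measurable_preimageT.
transitivity (fine (lebI q A)); first by rewrite E_indic.
have -> : \int[lebI q]_r (\1_A (q - r) : R) = fine (lebI q ((fun r => q - r) @^-1` A)).
  by rewrite -E_indic.
congr fine; rewrite /lebI -(@lebesgue_measure_reflect q (A `&` _)); last first.
  by apply: measurableI => //; exact: measurable_itv.
congr lebesgue_measure; apply/seteqP; split => x /= [Ax]; rewrite !in_itv/= => /andP[? ?];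
  split => //; apply/andP; split; lra.
Qed.

End reflection.

Section exponential_weight.
Variable R : realType.
Variable ga : R.
Hypothesis ga0 : 0 <= ga.

Definition weight (v : R) : R := expR (- (ga * Num.max 0 v)).

Lemma bmeas_weight : bmeas weight.
Proof.
apply: (bmeas_expN (u := fun q : R => Num.max 0 q)) => //.
- exact: max0_ge0.
- exact: measurable_max0.
Qed.

Lemma weightE v : 0 <= v -> weight v = expR (- (ga * v)).
Proof. by move=> v0; rewrite /weight max_r. Qed.

(** For [ga > 0] the function [ga * weight] is the density of an exponential law, whose
    probabilities of intervals are known; the case [ga = 0] is trivial. *)
Lemma E_weight r q : 0 <= r -> r <= q ->
  \int[lebI q]_v (ga * weight v * (r < v)%R%:R) = weight r - weight q.
Proof.
move=> r0 rq; have q0 := le_trans r0 rq.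
have := ga0; rewrite le_eqVlt => /predU1P[g0|gp].
  rewrite /weight -g0 !mul0r subrr -[RHS](mul0r (\int[lebI q]_v (0 : R))) -EZ; last exact: bmeas_cst.
  by apply: eq_Rintegral => v _; rewrite !mul0r.
have br : bmeas (fun v : R => (r < v)%R%:R : R) by exact: (bmeas_gt r (@measurable_id _ _ setT)).
pose c := PosNum gp.
transitivity (c%:num * \int[lebI q]_v (decay c v * (r < v)%R%:R)).
  rewrite -EZ; last by apply: bmeasM => //; exact: bmeas_decay.
  by apply: eq_Rintegral => v _; rewrite mulrA.
rewrite -E_expl_density//.
have bI T : bmeas (\1_(`[0, T]%classic : set R) : R -> R).
  by apply: bmeas_indic; exact: measurable_itv.
transitivity (\int[expl c]_t (\1_(`[0, q]%classic) t - \1_(`[0, r]%classic) t : R)).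
  apply: eq_Rintegral => t _; rewrite !indicE.
  have mI T : (t \in (`[0, T]%classic : set R)) = (0 <= t <= T).
    by apply/idP/idP; rewrite inE/= in_itv.
  rewrite !mI; have [rt|tr] := ltP r t.
    by rewrite mulr1 andbF subr0.
  by rewrite (le_trans tr rq) !andbT mulr0 subrr.
have ei u : 0 <= u -> \int[expl c]_t (\1_(`[0, u]%classic) t : R) = 1 - weight u.
  move=> u0; transitivity (fine (expl c `[0, u]%classic)).
    by apply: E_indic; exact: measurable_itv.
  by rewrite expl_itv0c// weightE.
rewrite EB// !ei//; ring.
Qed.

End exponential_weight.

Lemma balance_end (R : realType) (a b i : R) : a - b - i = 0 -> b = a - i.
Proof. by move=> h; lra. Qed.

Lemma balance_solve (R : realType) (a b x y z : R) :
  a = (1 - x) * y - (b - a - x * (y - z)) -> x * z = y - b.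
Proof. by move=> e; lra. Qed.

(** * The law at time [t] through the last potential jump *)

Section forward.
Variable R : realType.
Variables (lp lm : R -> state R -> R) (c : {posnum R}).
Hypotheses (mlp : measurable_fun setT (fun z : R * state R => lp z.1 z.2))
  (mlm : measurable_fun setT (fun z : R * state R => lm z.1 z.2)).
Hypotheses (lp0 : forall r X, 0 <= lp r X) (lm0 : forall r X, 0 <= lm r X).
Hypothesis lc : forall r X, lp r X + lm r X <= c%:num.
Variables (d : measure_display) (Om : measurableType d) (P : probability Om R)
  (X : R -> {mfun Om >-> state R}).
Hypothesis rcX : forall o r, 0 <= r -> X s o @[s --> r^'+] --> X r o.
Hypothesis HX : forall g, test_function g -> forall s t B, 0 <= s -> s <= t ->
  natural_filtration X s B ->
  \int[P]_o (\1_B o * compensated lp lm g t s (X ^~ o)) = 0.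

Local Notation U := (@unif R).
Local Notation J := (thin lp lm c).

Variables (s t : R) (B : set Om).
Hypotheses (s0 : 0 <= s) (st : s <= t) (FB : natural_filtration X s B).

Let t0 : 0 <= t. Proof. exact: le_trans st. Qed.
Let T := t - s.
Let T0 : 0 <= T. Proof. by rewrite subr_ge0. Qed.
Let Tt : T <= t. Proof. by rewrite gerBl. Qed.
Let mX r : measurable_fun setT (X r). Proof. exact: measurable_process. Qed.
Let mB : measurable B. Proof. exact: natural_filtration_measurable FB. Qed.
Let bB : bmeas (\1_B : Om -> R). Proof. exact: bmeas_indic. Qed.

(** Time runs backwards from [t]; [clip] keeps it in [[0, t]], which makes the reversed process
    jointly measurable on the whole line. *)
Definition backward (v : R) (o : Om) : state R := X (clip t (t - v)) o.

Lemma backwardE v o : 0 <= v -> v <= t -> backward v o = X (t - v) o.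
Proof. by move=> v0 vt; rewrite /backward clip_id// ?subr_ge0// gerBl. Qed.

Lemma measurable_backward : measurable_fun setT (fun z : R * Om => backward z.1 z.2).
Proof.
have mj := joint_measurable_process (X := fun r => X r : Om -> state R) t0 (fun r _ _ => mX r)
  (fun o r r0 _ => rcX (o := o) r0).
apply: (measurableT_comp mj (g := fun z : R * Om => (t - z.1, z.2))).
by apply: measurable_fun_pair => //; apply: measurable_funB => //; exact: measurable_cst.
Qed.

Let bwd_pair : measurable_fun setT (fun z : R * Om => (t - z.1, backward z.1 z.2)).
Proof.
apply: measurable_fun_pair; last exact: measurable_backward.
by apply: measurable_funB => //; exact: measurable_cst.
Qed.

Let bB2 (f : R * Om -> R) : bmeas f -> bmeas (fun z : R * Om => \1_B z.2 * f z).
Proof. by move=> bf; apply: bmeasM => //; exact: bmeas_comp measurable_snd bB. Qed.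

Let bE (f : R * Om -> R) : bmeas f -> bmeas (fun v => \int[P]_o (\1_B o * f (v, o))).
Proof. by move=> bf; exact: (bmeas_E2 (expl c) P (bB2 bf)). Qed.

(* The state at time [t] if the last potential jump in [(s, t]] happens at time
   [t - z.1.1] with mark [z.1.2]; if [T < z.1.1] there is none. *)
Definition last_jump (z : R * R * Om) : state R :=
  if T < z.1.1 then flow (X s z.2) T
  else flow (J (t - z.1.1) (backward z.1.1 z.2) z.1.2) z.1.1.

Lemma measurable_last_jump : measurable_fun setT last_jump.
Proof.
have m11 : measurable_fun setT (fun z : R * R * Om => z.1.1).
  exact: measurableT_comp measurable_fst measurable_fst.
have m12 : measurable_fun setT (fun z : R * R * Om => z.1.2).
  exact: measurableT_comp measurable_snd measurable_fst.
apply: measurable_fun_ifT.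
- by apply: measurable_fun_ltr => //; exact: measurable_cst.
- apply: measurable_flow_comp; last exact: measurable_cst.
  exact: measurableT_comp (mX s) measurable_snd.
apply: measurable_flow_comp => //.
apply: (measurableT_comp (measurable_thin c mlp mlm) (g := fun z : R * R * Om => (t - z.1.1, backward z.1.1 z.2, z.1.2))).
apply: measurable_fun_pair => //.
exact: (measurableT_comp bwd_pair (measurable_fun_pair m11 measurable_snd)).
Qed.

Section exponential_test.
Variables (j : nat) (al be : R).
Hypotheses (al0 : 0 <= al) (be0 : 0 <= be).

Let g : state R -> R := expo j al be.
Let tg : test_function g. Proof. exact: expo_test. Qed.
Let ga := decay_rate j al be.
Let ga0 : 0 <= ga. Proof. exact: decay_rate_ge0. Qed.
Let bg : bmeas g. Proof. exact: bmeas_test. Qed.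
Let w := weight ga.
Let bw : bmeas w. Proof. exact: bmeas_weight. Qed.

Let bgz : bmeas (fun z : R * Om => g (backward z.1 z.2)).
Proof. exact: bmeas_comp measurable_backward bg. Qed.

Let bjz : bmeas (fun z : R * Om => jump_op lp lm g (t - z.1) (backward z.1 z.2)).
Proof. exact: bmeas_comp bwd_pair (bmeas_jump_op mlp mlm lp0 lm0 lc bg). Qed.

Let G v := \int[P]_o (\1_B o * g (backward v o)).
Let K v := \int[P]_o (\1_B o * jump_op lp lm g (t - v) (backward v o)).
Let phi v := K v - ga * G v.

Let bG : bmeas G. Proof. exact: (bE bgz). Qed.
Let bK : bmeas K. Proof. exact: (bE bjz). Qed.
Let bphi : bmeas phi.
Proof. by apply: bmeasB => //; apply: bmeasM => //; exact: bmeas_cst. Qed.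

(** The martingale property between [t - q] and [t], available on [B] because [s <= t - q]. The mean
    of the generator is [phi]: its jump part is [K], and its transport part is [- ga * G] as [g] is
    an eigenfunction. *)
Lemma balance q : 0 <= q -> q <= T -> G q = G 0 - \int[lebI q]_v phi v.
Proof.
move=> q0 qT; have qt := le_trans qT Tt.
have tq0 : 0 <= t - q by rewrite subr_ge0.
have tqt : t - q <= t by rewrite gerBl.
have stq : s <= t - q by rewrite lerBrDr addrC -lerBrDr.
have FB' := natural_filtrationS stq FB.
pose h (z : R * Om) := gen lp lm g (t - z.1) (backward z.1 z.2).
have bh : bmeas h by exact: bmeas_comp bwd_pair (bmeas_gen mlp mlm lp0 lm0 lc tg).
have bho o : bmeas (fun v => h (v, o)).
  exact: (bmeas_comp (measurable_fun_pair (@measurable_id _ _ setT) (measurable_cst o)) bh).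
have mr : measurable_fun setT (fun r : R => q - r).
  by apply: measurable_funB => //; exact: measurable_cst.
have e1 o : compensated lp lm g t (t - q) (X ^~ o) =
    g (backward 0 o) - g (backward q o) - \int[lebI q]_v h (v, o).
  rewrite /compensated (backwardE o (lexx 0) t0) (backwardE o q0 qt) subr0; congr (_ - _).
  have -> : t - (t - q) = q by ring.
  rewrite (lebI_reflect _ (bho o)) -(lebI_sub qt (bmeas_comp mr (bho o))).
  apply: eq_Rintegral => r _; rewrite indicE; have [|_] := boolP (r \in _); last by rewrite !mul0r.
  move=> /set_mem; rewrite set_itvE => /andP[r0 rq].
  have qr0 : 0 <= q - r by rewrite subr_ge0.
  have qrt : q - r <= t by apply: le_trans qt; rewrite gerBl.
  rewrite /h (backwardE o qr0 qrt) /fst.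
  by have -> : t - (q - r) = t - q + r by ring.
have bhE : bmeas (fun o => \int[lebI q]_v h (v, o)) by exact: (bmeas_E1 (lebI q) P bh).
have bg' v : bmeas (fun o => g (backward v o)) by exact: bmeas_comp (mX _) bg.
have := HX tg tq0 tqt FB'.
under eq_Rintegral do rewrite e1 !mulrBr.
rewrite EB; [|by apply: bmeasB; apply: bmeasM|exact: bmeasM].
rewrite EB; [|exact: bmeasM..].
have -> : \int[P]_o (\1_B o * \int[lebI q]_v h (v, o)) = \int[lebI q]_v phi v.
  transitivity (\int[P]_o \int[lebI q]_v (\1_B o * h (v, o))).
    by apply: eq_Rintegral => o _; rewrite EZ.
  rewrite -(E_fubini (lebI q) P (bB2 bh)); apply: eq_Rintegral => v _.
  rewrite /phi /K /G -EZ; last exact: bmeasM.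
  have bjv : bmeas (fun o => \1_B o * jump_op lp lm g (t - v) (backward v o)).
    exact: (bmeas_pair1 (bB2 bjz) v).
  rewrite -EB//; last by apply: bmeasM; [exact: bmeas_cst|exact: bmeasM].
  apply: eq_Rintegral => o _; rewrite /h /gen /= expo_flow_deriv// -/g -/ga; ring.
exact: balance_end.
Qed.

(* Integrating [balance] against [ga * w] and exchanging the integrals makes the
   terms with [ga * w * G] cancel. *)
Lemma weighted_balance q : 0 <= q -> q <= T ->
  w q * G q = G 0 - \int[lebI q]_v (w v * K v).
Proof.
move=> q0 qT.
have bwG : bmeas (fun v => ga * w v * G v).
  exact: (bmeasM (bmeasM (bmeas_cst _ ga) bw) bG).
have bga : bmeas (fun v => ga * w v) := bmeasM (bmeas_cst _ ga) bw.
have bphi2 : bmeas (fun z : R * R => ga * w z.1 * ((z.2 < z.1)%R%:R * phi z.2)).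
  apply: bmeasM; first exact: bmeas_comp measurable_fst bga.
  apply: bmeasM; first exact: bmeas_lt2.
  exact: bmeas_comp measurable_snd bphi.
have bG0 : bmeas (fun _ : R => G 0) by exact: bmeas_cst.
have bwq : bmeas (fun _ : R => w q) by exact: bmeas_cst.
have bw0 : bmeas (fun v => ga * w v * G 0) := bmeasM bga bG0.
have bI2 := bmeas_E2 (expl c) (lebI q) bphi2.
have bI1 := bmeas_E1 (lebI q) (expl c) bphi2.
have bgt r : bmeas (fun v : R => (r < v)%R%:R : R) := bmeas_gt r (@measurable_id _ _ setT).
have A1 : \int[lebI q]_v (ga * w v * G v) =
    (1 - w q) * G 0 - \int[lebI q]_r (phi r * (w r - w q)).
  transitivity (\int[lebI q]_v (ga * w v * G 0 -
      \int[lebI q]_r (ga * w v * ((r < v)%R%:R * phi r)))).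
    apply: (@E_lebI_ae _ _ _ _ 0); [exact: bwG|exact: (bmeasB bw0 bI2)|].
    move=> v v0 vq _; rewrite (balance v0 (le_trans vq qT)) mulrBr; congr (_ - _).
    rewrite EZ; last exact: (bmeasM (bmeas_ltr v) bphi).
    by rewrite (E_lebI_before v0 vq bphi).
  rewrite (EB (lebI q) bw0 bI2).
  congr (_ - _).
    transitivity (G 0 * \int[lebI q]_v (ga * w v * (0 < v)%R%:R)).
      rewrite -(EZ (lebI q) (G 0) (bmeasM bga (bgt 0))).
      apply: (@E_lebI_ae _ _ _ _ 0).
      - exact: bw0.
      - exact: (bmeasM bG0 (bmeasM bga (bgt 0))).
      - move=> v v0 _ vn; rewrite lt_neqAle eq_sym vn v0 /=; ring.
    by rewrite E_weight// mulrC; congr (_ * _); rewrite /w weightE// mulr0 oppr0 expR0.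
  rewrite (E_fubini (lebI q) (lebI q) bphi2) /=; apply: (@E_lebI_ae _ _ _ _ 0).
  - exact: bI1.
  - exact: (bmeasM bphi (bmeasB bw bwq)).
  move=> r r0 rq _; rewrite -(E_weight ga0 r0 rq) -(EZ _ _ (bmeasM bga (bgt r))).
  by apply: eq_Rintegral => v _; rewrite /w; ring.
have bpw : bmeas (fun r => phi r * w r) := bmeasM bphi bw.
have bwphi : bmeas (fun r => w q * phi r) := bmeasM bwq bphi.
have bwK : bmeas (fun r => w r * K r) := bmeasM bw bK.
have A2 : \int[lebI q]_r (phi r * (w r - w q)) =
    \int[lebI q]_r (phi r * w r) - w q * (G 0 - G q).
  have -> : G 0 - G q = \int[lebI q]_v phi v by rewrite (balance q0 qT) opprB addrC subrK.
  rewrite -(EZ _ _ bphi) -(EB _ bpw bwphi).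
  by apply: eq_Rintegral => r _; ring.
have A3 : \int[lebI q]_r (phi r * w r) =
    \int[lebI q]_v (w v * K v) - \int[lebI q]_v (ga * w v * G v).
  rewrite -(EB _ bwK bwG).
  by apply: eq_Rintegral => r _; rewrite /phi; ring.
by apply: (balance_solve (a := \int[lebI q]_v (ga * w v * G v))); rewrite -A3 -A2; exact: A1.
Qed.


Let bwK : bmeas (fun v => w v * K v). Proof. exact: (bmeasM bw bK). Qed.

Let f3 x := \int[lebI T]_q ((q < x)%R%:R * (w q * K q)).

Let bf3 : bmeas f3.
Proof.
apply: (bmeas_E2 (expl c) (lebI T) (f := fun z : R * R => (z.2 < z.1)%R%:R * (w z.2 * K z.2))).
exact: (bmeasM (@bmeas_lt2 R) (bmeas_comp measurable_snd bwK)).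
Qed.

Let bgl : bmeas (fun z : R * R * Om => \1_B z.2 * g (last_jump z)).
Proof.
exact: (bmeasM (bmeas_comp measurable_snd bB) (bmeas_comp measurable_last_jump bg)).
Qed.

Let bT : bmeas (fun x : R => (x <= T)%R%:R : R). Proof. exact: bmeas_le. Qed.

(** Averaging over the mark gives [w x * (G x + c^-1 * K x)] when [x <= T], and [w T * G T] when
    there is no potential jump. [weighted_balance] expresses both through [G 0]. *)
Let last_jump_inner x : 0 < x ->
  \int[U]_u \int[P]_o (\1_B o * g (last_jump (x, u, o))) =
  (G 0 - f3 x) + (x <= T)%R%:R * (c%:num^-1 * (w x * K x)).
Proof.
move=> x0; have [xT|Tx] := leP x T; last first.
  have -> : f3 x = \int[lebI T]_q (w q * K q).
    apply: (@E_lebI_ae _ _ _ _ 0); [exact: (bmeasM (bmeas_ltr x) bwK)|exact: bwK|].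
    by move=> q q0 qT _; rewrite (le_lt_trans qT Tx) mul1r.
  rewrite mul0r addr0 -(weighted_balance T0 (lexx T)) -[RHS](E_cst U).
  apply: eq_Rintegral => u _; rewrite /G -EZ; last first.
    exact: (bmeasM bB (bmeas_comp (mX _) bg)).
  apply: eq_Rintegral => o _; rewrite /last_jump /= Tx (backwardE o T0 Tt).
  have -> : t - T = s by rewrite /T; ring.
  by rewrite /g expo_flow// -/ga /w weightE//; ring.
have xt := le_trans xT Tt.
rewrite mul1r /f3 (E_lebI_before (ltW x0) xT bwK) -(weighted_balance (ltW x0) xT).
pose f (z : R * Om) := \1_B z.2 * g (J (t - x) (backward x z.2) z.1).
have bf : bmeas f.
  apply: (bmeasM (bmeas_comp measurable_snd bB)); apply: (bmeas_comp _ bg).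
  apply: (measurableT_comp (measurable_thin c mlp mlm) (g := fun z : R * Om => (t - x, backward x z.2, z.1))).
  apply: measurable_fun_pair => //; apply: measurable_fun_pair; first exact: measurable_cst.
  exact: (measurableT_comp (mX _) measurable_snd).
transitivity (w x * \int[U]_u \int[P]_o f (u, o)).
  rewrite -EZ; last exact: (bmeas_E2 U P bf).
  apply: eq_Rintegral => u _; rewrite -EZ; last exact: (bmeas_pair1 bf u).
  apply: eq_Rintegral => o _; rewrite /last_jump /= ltNge xT /=.
  by rewrite /g expo_flow ?(ltW x0)// -/ga -/g /f /w weightE ?(ltW x0)//=; ring.
rewrite (E_fubini U P bf) /=.
have -> : \int[P]_o \int[U]_u f (u, o) =
    \int[P]_o (\1_B o * g (backward x o) + c%:num^-1 * (\1_B o * jump_op lp lm g (t - x) (backward x o))).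
  apply: eq_Rintegral => o _; rewrite /f /= EZ; last first.
    apply: (bmeas_comp _ bg).
    exact: (measurableT_comp (measurable_thin c mlp mlm) (measurable_fun_pair (measurable_cst (t - x, backward x o)) (@measurable_id _ _ setT))).
  by rewrite E_thin//; ring.
have bjx := bmeas_pair1 (bB2 bjz) x.
rewrite ED; [|exact: (bmeasM bB (bmeas_comp (mX _) bg))|exact: (bmeasM (bmeas_cst _ _) bjx)].
by rewrite (EZ _ _ bjx) -/(G x) -/(K x); ring.
Qed.

(** After averaging over [x], the term [f3] and the term with [c^-1] cancel by [compensator]. What
    is left is [G 0], which is the left-hand side. *)
Lemma forward_expo :
  \int[P]_o (\1_B o * g (X t o)) =
  \int[expl c]_x \int[U]_u \int[P]_o (\1_B o * g (last_jump (x, u, o))).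
Proof.
pose eU : probability (R * R)%type R := (expl c \x U)%E.
have bin : bmeas (fun x => \int[U]_u \int[P]_o (\1_B o * g (last_jump (x, u, o)))).
  exact: (bmeas_E2 (expl c) U (bmeas_E2 eU P bgl)).
have bwK' : bmeas (fun x => c%:num^-1 * (w x * K x)) := bmeasM (bmeas_cst _ _) bwK.
have bjp : bmeas (fun x : R => (x <= T)%R%:R * (c%:num^-1 * (w x * K x))) := bmeasM bT bwK'.
have bG0 : bmeas (fun _ : R => G 0) by exact: bmeas_cst.
have bGf : bmeas (fun x => G 0 - f3 x) := bmeasB bG0 bf3.
transitivity (\int[expl c]_x ((G 0 - f3 x) + (x <= T)%R%:R * (c%:num^-1 * (w x * K x)))); last first.
  apply: esym; apply: (E_ae (measurable_itv `]0, +oo[) (expl_pos c)).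
  - exact: bin.
  - exact: (bmeasD bGf bjp).
  - move=> x; rewrite /= in_itv/= andbT; exact: last_jump_inner.
rewrite (ED _ bGf bjp) (EB _ bG0 bf3) E_cst (compensator c T0 bwK').
have -> : \int[expl c]_x \int[lebI T]_q ((q < x)%R%:R * (c%:num^-1 * (w q * K q))) =
    \int[expl c]_x (c%:num^-1 * f3 x).
  apply: eq_Rintegral => x _; rewrite -EZ; last exact: (bmeasM (bmeas_ltr x) bwK).
  by apply: eq_Rintegral => q _; rewrite mulrCA.
rewrite (EZ _ _ bf3) mulrA divff ?gt_eqF// mul1r subrK /G.
by apply: eq_Rintegral => o _; rewrite (backwardE o (lexx 0) t0) subr0.
Qed.

End exponential_test.

(** Both sides are integrals of [f] against laws restricted to an event, [B] on the left and the
    cylinder [B2] over [B] on the right; by [forward_expo] these laws agree on the exponentials,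
    which determine them. *)
Lemma forward f : bmeas f ->
  \int[P]_o (\1_B o * f (X t o)) =
  \int[expl c]_x \int[U]_u \int[P]_o (\1_B o * f (last_jump (x, u, o))).
Proof.
move=> bf.
pose eU : probability (R * R)%type R := (expl c \x U)%E.
pose P2 : probability (R * R * Om)%type R := (eU \x P)%E.
pose B2 : set (R * R * Om) := setT `*` B.
have mB2 : measurable B2 by exact: measurableX.
have e (h : state R -> R) : bmeas h -> \int[P2]_z (\1_B2 z * h (last_jump z)) =
    \int[expl c]_x \int[U]_u \int[P]_o (\1_B o * h (last_jump (x, u, o))).
  move=> bh.
  have bl : bmeas (fun z : R * R * Om => \1_B z.2 * h (last_jump z)).
    exact: (bmeasM (bmeas_comp measurable_snd bB) (bmeas_comp measurable_last_jump bh)).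
  transitivity (\int[P2]_z (\1_B z.2 * h (last_jump z))).
    apply: eq_Rintegral => z _; congr (_ * _); rewrite !indicE; congr (nat_of_bool _)%:R.
    by apply/idP/idP => /set_mem; [move=> [_ ?]|move=> ?]; apply/mem_set.
  rewrite (E_prod eU P bl); exact: (E_prod (expl c) U (bmeas_E2 eU P bl)).
rewrite -(e f bf); apply: E_restr_law => //; first exact: measurable_last_jump.
move=> A mA; apply: expo_determine_set => //; first exact: measurable_last_jump.
move=> j al be al0 be0; rewrite (forward_expo j al0 be0) e//.
by apply: bmeas_test; exact: expo_test.
Qed.

End forward.

(** * Comparison of two solutions and uniqueness *)

Section comparison.
Variable R : realType.
Variable c : {posnum R}.

Record jump_rates (lp lm : R -> state R -> R) : Prop := JumpRates {
  jr_mp : measurable_fun setT (fun z : R * state R => lp z.1 z.2) ;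
  jr_mm : measurable_fun setT (fun z : R * state R => lm z.1 z.2) ;
  jr_p0 : forall r X, 0 <= lp r X ;
  jr_m0 : forall r X, 0 <= lm r X ;
  jr_le : forall r X, lp r X + lm r X <= c%:num }.

Record jump_process (lp lm : R -> state R -> R) d (Om : measurableType d)
    (P : probability Om R) (X : R -> {mfun Om >-> state R}) : Prop := JumpProcess {
  jp_rc : forall o r, 0 <= r -> X s o @[s --> r^'+] --> X r o ;
  jp_dynkin : forall g, test_function g -> forall s t B, 0 <= s -> s <= t ->
    natural_filtration X s B ->
    \int[P]_o (\1_B o * compensated lp lm g t s (X ^~ o)) = 0 }.

Local Notation U := (@unif R).

Lemma bmeas_thin lp lm (r : R) d (T : measurableType d) (h : T -> state R) (u : T -> R) (f : state R -> R) :
  jump_rates lp lm -> bmeas f -> measurable_fun setT h -> measurable_fun setT u ->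
  bmeas (fun z => f (thin lp lm c r (h z) (u z))).
Proof.
move=> [mp mm _ _ _] bf mh mu; apply: (bmeas_comp _ bf).
apply: (measurableT_comp (measurable_thin c mp mm) (g := fun z => (r, h z, u z))).
apply: measurable_fun_pair => //; apply: measurable_fun_pair => //; exact: measurable_cst.
Qed.

Lemma bmeas_flow (f : state R -> R) x : bmeas f -> bmeas (fun Z => f (flow Z x)).
Proof.
by move=> bf; apply: (bmeas_comp _ bf); apply: measurable_flow_comp; [exact: measurable_id|exact: measurable_cst].
Qed.

Lemma forward_inner lp lm d (Om : measurableType d) (P : probability Om R)
    (X : R -> {mfun Om >-> state R}) s t B (f : state R -> R) :
  jump_rates lp lm -> jump_process lp lm P X -> 0 <= s -> s <= t ->
  natural_filtration X s B -> bmeas f ->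
  exists I : R -> R, [/\ bmeas I, \int[P]_o (\1_B o * f (X t o)) = \int[expl c]_x I x,
    (forall x, t - s < x -> I x = \int[P]_o (\1_B o * f (flow (X s o) (t - s)))) &
    (forall x, 0 < x -> x <= t - s -> I x = \int[U]_u \int[P]_o
      (\1_B o * f (flow (thin lp lm c (t - x) (X (t - x) o) u) x)))].
Proof.
move=> [mp mm p0 m0 le] [rc H] s0 st FB bf.
have mB := natural_filtration_measurable FB.
pose I x := \int[U]_u \int[P]_o (\1_B o * f (last_jump lp lm c X s t (x, u, o))).
exists I; split.
- pose eU : probability (R * R)%type R := (expl c \x U)%E.
  have bl : bmeas (fun z : R * R * Om => \1_B z.2 * f (last_jump lp lm c X s t z)).
    apply: bmeasM; first exact: bmeas_comp measurable_snd (bmeas_indic R mB).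
    apply: (bmeas_comp _ bf); exact: (@measurable_last_jump _ _ _ c mp mm _ _ X rc s t s0 st).
  exact: (bmeas_E2 (expl c) U (bmeas_E2 eU P bl)).
- exact: (forward mp mm p0 m0 le rc H s0 st FB bf).
- move=> x tx; rewrite /I -[RHS](E_cst U); apply: eq_Rintegral => u _.
  by apply: eq_Rintegral => o _; rewrite /last_jump /= tx.
- move=> x x0 xt; apply: eq_Rintegral => u _; apply: eq_Rintegral => o _.
  rewrite /last_jump /= ltNge xt /= backwardE ?(ltW x0)//.
  by apply: le_trans xt _; rewrite gerBl.
Qed.

Lemma jump_op_diff (lp1 lm1 lp2 lm2 : R -> state R -> R) r X (f : state R -> R) :
  (forall Y, `|f Y| <= 1) ->
  `|jump_op lp1 lm1 f r X - jump_op lp2 lm2 f r X| <=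
  2 * (`|lp1 r X - lp2 r X| + `|lm1 r X - lm2 r X|).
Proof.
move=> f1; rewrite /jump_op.
set b := (0 < st_k X)%N%:R; set u := f (st_up X) - f X; set v := f (st_down X) - f X.
have -> : lp1 r X * u + b * (lm1 r X * v) - (lp2 r X * u + b * (lm2 r X * v)) =
   (lp1 r X - lp2 r X) * u + (lm1 r X - lm2 r X) * (b * v) by ring.
have d Y Z : `|f Y - f Z| <= 2.
  by apply: le_trans (ler_normB _ _) _; have := f1 Y; have := f1 Z; lra.
have bv : `|b * v| <= 2.
  by rewrite normrM /b; case: (0 < st_k X)%N; rewrite ?normr1 ?normr0 ?mul1r ?mul0r//; exact: d.
apply: le_trans (ler_normD _ _) _; rewrite !normrM mulrDr; apply: lerD.
  by rewrite mulrC; apply: ler_wpM2r => //; exact: d.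
by rewrite mulrC; apply: ler_wpM2r => //; rewrite -normrM.
Qed.

Lemma norm_E_indic_le d (Om : measurableType d) (P : probability Om R) (B : set Om) (f : Om -> R) M :
  measurable B -> bmeas f -> (forall o, `|f o| <= M) -> `|\int[P]_o (\1_B o * f o)| <= M.
Proof.
move=> mB bf fM; rewrite -[leRHS](E_cst P); apply: norm_E_le.
- by apply: bmeasM => //; exact: bmeas_indic.
- exact: bmeas_cst.
move=> o; rewrite normrM -[leRHS]mul1r; apply: ler_pM => //.
by rewrite indicE; case: (_ \in _); rewrite ?normr1 ?normr0.
Qed.

Section two_processes.
Variables (lp1 lm1 lp2 lm2 : R -> state R -> R).
Hypotheses (jr1 : jump_rates lp1 lm1) (jr2 : jump_rates lp2 lm2).
Variables (d1 d2 : measure_display) (Om1 : measurableType d1) (Om2 : measurableType d2).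
Variables (P1 : probability Om1 R) (P2 : probability Om2 R).
Variables (X1 : R -> {mfun Om1 >-> state R}) (X2 : R -> {mfun Om2 >-> state R}).
Hypotheses (jp1 : jump_process lp1 lm1 P1 X1) (jp2 : jump_process lp2 lm2 P2 X2).
Variables (s : R) (B1 : set Om1) (B2 : set Om2).
Hypotheses (s0 : 0 <= s) (FB1 : natural_filtration X1 s B1) (FB2 : natural_filtration X2 s B2).
Hypothesis matched : forall f, bmeas f ->
  \int[P1]_o (\1_B1 o * f (X1 s o)) = \int[P2]_o (\1_B2 o * f (X2 s o)).
Variables (K A : R).
Hypotheses (K0 : 0 <= K) (A0 : 0 <= A).
Hypothesis close : forall r X, s <= r ->
  `|lp1 r X - lp2 r X| + `|lm1 r X - lm2 r X| <= A * expR (K * (r - s)).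

Let mB1 : measurable B1. Proof. exact: natural_filtration_measurable FB1. Qed.
Let mB2 : measurable B2. Proof. exact: natural_filtration_measurable FB2. Qed.

Let delta r (f : state R -> R) : R :=
  `|\int[P1]_o (\1_B1 o * f (X1 r o)) - \int[P2]_o (\1_B2 o * f (X2 r o))|.

(** The Laplace transform of the waiting time at [K]: the mean factor that [exp (K r)] loses when
    time goes back by one waiting time. *)
Let kap := \int[expl c]_x expR (- (K * Num.max 0 x)).

(** The intermediate [I12] thins the first process with the rates of the second. It differs from
    [I22] only by the laws at time [r - x], and from [I11] only by the rates, where [E_thin] brings
    [c^-1] and [jump_op_diff] brings [2]. *)
Let damp D : 0 <= D ->
  (forall r f, s <= r -> bmeas f -> (forall Y, `|f Y| <= 1) -> delta r f <= D * expR (K * (r - s))) ->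
  forall r f x, s <= r -> bmeas f -> (forall Y, `|f Y| <= 1) -> 0 < x -> x <= r - s ->
  `|\int[U]_u \int[P1]_o (\1_B1 o * f (flow (thin lp1 lm1 c (r - x) (X1 (r - x) o) u) x)) -
    \int[U]_u \int[P2]_o (\1_B2 o * f (flow (thin lp2 lm2 c (r - x) (X2 (r - x) o) u) x))|
  <= (D + c%:num^-1 * (2 * A)) * expR (K * (r - x - s)).
Proof.
move=> D0 HD r f x sr bf f1 x0 xr.
have bfx := bmeas_flow x bf; set fx := (fun Z => f (flow Z x)) in bfx.
have fx1 Y : `|fx Y| <= 1 by exact: f1.
have srx : s <= r - x by rewrite lerBrDr addrC -lerBrDr.
have bt lp lm d (Om : measurableType d) (Y : {mfun Om >-> state R}) (B : set Om) :
    jump_rates lp lm -> measurable B ->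
    bmeas (fun z : R * Om => \1_B z.2 * fx (thin lp lm c (r - x) (Y z.2) z.1)).
  move=> jr mB; apply: bmeasM; first exact: bmeas_comp measurable_snd (bmeas_indic R mB).
  apply: (bmeas_thin _ jr bfx) => //.
  exact: (measurableT_comp (measurable_funPT Y) measurable_snd).
have b11 := bt lp1 lm1 _ _ (X1 (r - x)) B1 jr1 mB1.
have b12 := bt lp2 lm2 _ _ (X1 (r - x)) B1 jr2 mB1.
have b22 := bt lp2 lm2 _ _ (X2 (r - x)) B2 jr2 mB2.
pose I11 := \int[U]_u \int[P1]_o (\1_B1 o * fx (thin lp1 lm1 c (r - x) (X1 (r - x) o) u)).
pose I12 := \int[U]_u \int[P1]_o (\1_B1 o * fx (thin lp2 lm2 c (r - x) (X1 (r - x) o) u)).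
pose I22 := \int[U]_u \int[P2]_o (\1_B2 o * fx (thin lp2 lm2 c (r - x) (X2 (r - x) o) u)).
rewrite -/I11 -/I22.
have h1 : `|I12 - I22| <= D * expR (K * (r - x - s)).
  rewrite /I12 /I22 -(EB _ (bmeas_E2 U P1 b12) (bmeas_E2 U P2 b22)) -[leRHS](E_cst U).
  apply: norm_E_le.
  - exact: (bmeasB (bmeas_E2 U P1 b12) (bmeas_E2 U P2 b22)).
  - exact: bmeas_cst.
  move=> u; apply: (HD (r - x) (fun Z => fx (thin lp2 lm2 c (r - x) Z u))) => //.
  by apply: (bmeas_thin _ jr2 bfx) => //; exact: measurable_cst.
have h2 : `|I11 - I12| <= c%:num^-1 * (2 * A) * expR (K * (r - x - s)).
  rewrite /I11 /I12 (E_fubini U P1 b11) (E_fubini U P1 b12) /=.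
  rewrite -(EB _ (bmeas_E1 U P1 b11) (bmeas_E1 U P1 b12)) /=.
  have e o : \int[U]_u (\1_B1 o * fx (thin lp1 lm1 c (r - x) (X1 (r - x) o) u)) -
      \int[U]_u (\1_B1 o * fx (thin lp2 lm2 c (r - x) (X1 (r - x) o) u)) =
      \1_B1 o * (c%:num^-1 * (jump_op lp1 lm1 fx (r - x) (X1 (r - x) o) -
         jump_op lp2 lm2 fx (r - x) (X1 (r - x) o))).
    rewrite !EZ; [|by apply: (bmeas_thin _ _ bfx) => //; exact: measurable_cst..].
    have [_ _ p0 m0 le] := jr1; have [_ _ p0' m0' le'] := jr2.
    rewrite !E_thin//; ring.
  under eq_Rintegral do rewrite e.
  apply: norm_E_indic_le => //.
    apply: bmeasM; first exact: bmeas_cst.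
    have [mp mm p0 m0 le] := jr1; have [mp' mm' p0' m0' le'] := jr2.
    have mz : measurable_fun setT (fun o => (r - x, X1 (r - x) o)).
      exact: (measurable_fun_pair (measurable_cst (r - x)) (measurable_process X1 (r - x))).
    apply: bmeasB.
      exact: (bmeas_comp mz (bmeas_jump_op mp mm p0 m0 le bfx)).
    exact: (bmeas_comp mz (bmeas_jump_op mp' mm' p0' m0' le' bfx)).
  move=> o; rewrite normrM gtr0_norm ?invr_gt0// -!mulrA ler_wpM2l// ?invr_ge0//.
  apply: le_trans (jump_op_diff _ _ _ _ _ _ fx1) _.
  by rewrite ler_wpM2l//; exact: close.
apply: (le_trans (ler_distD I12 I11 I22)).
rewrite [leRHS]mulrDl [leLHS]addrC; exact: (lerD h1 h2).
Qed.

(** Going back by a waiting time [x] multiplies the weight by [exp (- K x)], of mean [kap]; so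
    [contraction_bound] applies with [q = kap] and [e = kap * a]. If there is no potential jump
    after [s], the two terms agree by [matched]. *)
Lemma process_comparison : kap < 1 ->
  forall r f, s <= r -> bmeas f -> (forall Y, `|f Y| <= 1) ->
  delta r f <= kap * (c%:num^-1 * (2 * A)) / (1 - kap) * expR (K * (r - s)).
Proof.
move=> kap1 r f sr bf f1.
have c0 : 0 < c%:num by [].
have bmax : bmeas (fun x : R => expR (- (K * Num.max 0 x))) by exact: bmeas_weight.
have kap0 : 0 <= kap by apply: Rintegral_ge0 => x _; exact: expR_ge0.
set a := c%:num^-1 * (2 * A).
have a0 : 0 <= a by rewrite !mulr_ge0// invr_ge0.
apply: (@contraction_bound R (R * (state R -> R))%type
  (fun i => [/\ s <= i.1, bmeas i.2 & forall Y, `|i.2 Y| <= 1])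
  (fun i => delta i.1 i.2) (fun i => expR (K * (i.1 - s))) kap (kap * a) 2 _ _ _ _ _ (r, f)) => //.
- by rewrite kap0.
- exact: mulr_ge0.
- move=> D D0 HD [{}r {}f] /= [{}sr {}bf {}f1].
  have [I1 [bI1 e1 t1 i1]] := forward_inner jr1 jp1 s0 sr FB1 bf.
  have [I2 [bI2 e2 t2 i2]] := forward_inner jr2 jp2 s0 sr FB2 bf.
  rewrite /delta e1 e2 -(EB _ bI1 bI2).
  pose Wt x := (D + a) * expR (K * (r - s)) * expR (- (K * Num.max 0 x)).
  have bI0 : bmeas (\1_(`]0, +oo[%classic : set R) : R -> R).
    by apply: bmeas_indic; exact: measurable_itv.
  have bI12 := bmeasB bI1 bI2.
  have -> : \int[expl c]_x (I1 x - I2 x) = \int[expl c]_x (\1_(`]0, +oo[%classic) x * (I1 x - I2 x)).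
    apply: (E_ae (measurable_itv `]0, +oo[) (expl_pos c) bI12 (bmeasM bI0 bI12)).
    by move=> x x0; rewrite indicE mem_set// mul1r.
  have -> : (kap * D + kap * a) * expR (K * (r - s)) = \int[expl c]_x Wt x.
    rewrite (EZ _ _ bmax) -/kap; ring.
  apply: norm_E_le.
  + exact: (bmeasM bI0 bI12).
  + by apply: bmeasM bmax; exact: bmeas_cst.
  have Wt0 x : 0 <= Wt x by rewrite !mulr_ge0 ?expR_ge0// addr_ge0.
  move=> x; rewrite indicE; have [|_] := boolP (x \in _); last by rewrite mul0r normr0.
  rewrite inE/= in_itv/= andbT => x0; rewrite mul1r.
  have [xr|rx] := leP x (r - s); last first.
    by rewrite (t1 x rx) (t2 x rx) (matched (bmeas_flow _ bf)) subrr normr0.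
  rewrite (i1 x x0 xr) (i2 x x0 xr).
  apply: le_trans (damp D0 _ sr bf f1 x0 xr) _.
    by move=> r' f' h1 h2 h3; apply: (HD (r', f')).
  rewrite /Wt -mulrA -expRD max_r ?(ltW x0)//.
  have -> : K * (r - x - s) = K * (r - s) + - (K * x) by ring.
  exact: lexx.
- move=> [{}r {}f] /= [{}sr {}bf {}f1].
  have h : `|\int[P1]_o (\1_B1 o * f (X1 r o))| <= 1.
    by apply: norm_E_indic_le => //; exact: bmeas_comp (measurable_process X1 r) bf.
  have h' : `|\int[P2]_o (\1_B2 o * f (X2 r o))| <= 1.
    by apply: norm_E_indic_le => //; exact: bmeas_comp (measurable_process X2 r) bf.
  have e1 : 1 <= expR (K * (r - s)).
    by rewrite -expR0 ler_expR mulr_ge0// subr_ge0.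
  apply: le_trans (ler_normB _ _) _; apply: (@le_trans _ _ (2 * 1)); last by rewrite ler_wpM2l.
  by rewrite mulr1 -[2]/(1 + 1); exact: lerD.
Qed.

End two_processes.
End comparison.

(** * Uniqueness in law of the solution *)

Section uniqueness.
Variable R : realType.
Variable c : {posnum R}.
Variables (lp lm : R -> state R -> R).
Hypothesis jr : jump_rates c lp lm.
Variables (d1 d2 : measure_display) (Om1 : measurableType d1) (Om2 : measurableType d2).
Variables (P1 : probability Om1 R) (P2 : probability Om2 R).
Variables (X1 : R -> {mfun Om1 >-> state R}) (X2 : R -> {mfun Om2 >-> state R}).
Hypotheses (jp1 : jump_process lp lm P1 X1) (jp2 : jump_process lp lm P2 X2).

(** The induction invariant for finite-dimensional laws: [B1] and [B2] record the observations made
    so far on the two spaces. *)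
Definition matched (s : R) (B1 : set Om1) (B2 : set Om2) : Prop :=
  [/\ natural_filtration X1 s B1, natural_filtration X2 s B2 &
    forall f, bmeas f ->
    \int[P1]_o (\1_B1 o * f (X1 s o)) = \int[P2]_o (\1_B2 o * f (X2 s o))].

(** With equal rates [process_comparison] holds for [A = 0] and leaves no error; a bounded [f] is
    first scaled into [[-1, 1]]. *)
Lemma matched_later s t B1 B2 : 0 <= s -> s <= t -> matched s B1 B2 -> matched t B1 B2.
Proof.
move=> s0 st [F1 F2 M]; split; [exact: natural_filtrationS F1|exact: natural_filtrationS F2|].
move=> f bf.
have [K K0 Ksmall] : exists2 K : R, 0 <= K & \int[expl c]_t expR (- (K * Num.max 0 t)) <= 2^-1.
  by apply: expl_laplace_small; rewrite invr_gt0.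
have [_ [C fC]] := bf.
have C0 : 0 < `|C| + 1 by rewrite ltr_wpDl.
pose h Y := (`|C| + 1)^-1 * f Y.
have bh : bmeas h by apply: bmeasM => //; exact: bmeas_cst.
have h1 Y : `|h Y| <= 1.
  rewrite /h normrM gtr0_norm ?invr_gt0// mulrC ler_pdivrMr// mul1r.
  by apply: le_trans (fC Y) _; rewrite (le_trans (ler_norm C))// lerDl.
have cl r X : s <= r -> `|lp r X - lp r X| + `|lm r X - lm r X| <= 0 * expR (K * (r - s)).
  by move=> _; rewrite !subrr normr0 mul0r addr0.
have k1 : \int[expl c]_t expR (- (K * Num.max 0 t)) < 1.
  by apply: le_lt_trans Ksmall _; rewrite invf_lt1// ltr1n.
have := process_comparison jr jr jp1 jp2 s0 F1 F2 M K0 (lexx 0) cl k1 st bh h1.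
rewrite !mulr0 !mul0r normr_le0 subr_eq0 => /eqP e.
have m1 : measurable B1 by exact: natural_filtration_measurable F1.
have m2 : measurable B2 by exact: natural_filtration_measurable F2.
have b1 : bmeas (fun o => \1_B1 o * h (X1 t o)).
  by apply: bmeasM (bmeas_comp (measurable_process X1 t) bh); exact: bmeas_indic.
have b2 : bmeas (fun o => \1_B2 o * h (X2 t o)).
  by apply: bmeasM (bmeas_comp (measurable_process X2 t) bh); exact: bmeas_indic.
have g Y : f Y = (`|C| + 1) * h Y by rewrite /h mulrA divff ?mul1r ?gt_eqF.
under eq_Rintegral do rewrite g mulrCA.
under [in RHS]eq_Rintegral do rewrite g mulrCA.
by rewrite (EZ _ _ b1) (EZ _ _ b2) e.
Qed.

Lemma matched_restrict s B1 B2 A : 0 <= s -> measurable A -> matched s B1 B2 ->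
  matched s (B1 `&` X1 s @^-1` A) (B2 `&` X2 s @^-1` A).
Proof.
move=> s0 mA [F1 F2 M]; split.
- by apply: natural_filtrationI => //; exact: natural_filtration_coord.
- by apply: natural_filtrationI => //; exact: natural_filtration_coord.
move=> f bf; have := M _ (bmeasM (bmeas_indic R mA) bf).
have e d (Om : measurableType d) (B : set Om) (X : Om -> state R) o :
    \1_B o * (\1_A (X o) * f (X o)) = \1_(B `&` X @^-1` A) o * f (X o).
  by rewrite mulrA indicI.
under eq_Rintegral do rewrite e.
by under [in X in _ = X]eq_Rintegral do rewrite e.
Qed.

(** Along a sorted list of times, [matched_later] moves to the next time and [matched_restrict] adds
    the observation made there to the two events. *)
Lemma matched_cylinder n (r : 'I_n -> R) (A : 'I_n -> set (state R)) (l : seq 'I_n) s B1 B2 :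
  (forall i, measurable (A i)) -> 0 <= s -> matched s B1 B2 ->
  path (fun x y => x <= y) s (map r l) ->
  P1 (B1 `&` [set o | forall i, i \in l -> A i (X1 (r i) o)]) =
  P2 (B2 `&` [set o | forall i, i \in l -> A i (X2 (r i) o)]).
Proof.
move=> mA; elim: l s B1 B2 => [|i l IH] s B1 B2 s0 M /=.
  move=> _; have e d (Om : measurableType d) (X : R -> {mfun Om >-> state R}) :
      [set o | forall i, i \in [::] -> A i (X (r i) o)] = setT :> set Om.
    by apply/seteqP; split.
  have [F1 F2 ME] := M; have := ME (fun=> 1) (bmeas_cst _ 1).
  under eq_Rintegral do rewrite mulr1.
  under [in X in _ = X]eq_Rintegral do rewrite mulr1.
  have m1 : measurable B1 by exact: natural_filtration_measurable F1.
  have m2 : measurable B2 by exact: natural_filtration_measurable F2.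
  rewrite !E_indic// !e !setIT => fe.
  by rewrite -[LHS]fineK ?fin_num_measure// fe fineK// fin_num_measure.
move=> /andP[si pl]; have r0 := le_trans s0 si.
have M' := matched_restrict r0 (mA i) (matched_later s0 si M).
have e d (Om : measurableType d) (X : R -> {mfun Om >-> state R}) (B : set Om) :
    B `&` [set o | forall j, j \in i :: l -> A j (X (r j) o)] =
    (B `&` X (r i) @^-1` A i) `&` [set o | forall j, j \in l -> A j (X (r j) o)].
  apply/seteqP; split => o /=.
    move=> [Bo h]; split; first by split => //; apply: h; rewrite mem_head.
    by move=> j jl; apply: h; rewrite inE jl orbT.
  move=> [[Bo h1] h2]; split => // j; rewrite inE => /predU1P[->//|]; exact: h2.
by rewrite !e; exact: (IH _ _ _ r0 M').
Qed.

Hypothesis init : forall f, bmeas f ->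
  \int[P1]_o f (X1 0 o) = \int[P2]_o f (X2 0 o).

Let matched0 : matched 0 setT setT.
Proof.
split; [exact: natural_filtrationT..|].
move=> f bf; under eq_Rintegral do rewrite indicT mul1r.
by under [in X in _ = X]eq_Rintegral do rewrite indicT mul1r; exact: init.
Qed.

Let cylinder_law n (r : 'I_n -> R) (A : 'I_n -> set (state R)) :
  (forall i, 0 <= r i) -> (forall i, measurable (A i)) ->
  P1 [set o | forall i, A i (X1 (r i) o)] = P2 [set o | forall i, A i (X2 (r i) o)].
Proof.
move=> r0 mA; pose l := sort (fun i j => r i <= r j) (enum 'I_n).
have pl : path (fun x y => x <= y) 0 (map r l).
  rewrite path_min_sorted.
    by rewrite sorted_map; apply: sort_sorted => i j; exact: le_total.
  by apply/allP => x /mapP[i _ ->]; exact: r0.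
have := matched_cylinder mA (lexx 0) matched0 pl.
have e d (Om : measurableType d) (X : R -> {mfun Om >-> state R}) :
    [set o | forall i, i \in l -> A i (X (r i) o)] = [set o | forall i, A i (X (r i) o)].
  apply/seteqP; split => o /= h i; last by move=> _; exact: h.
  by apply: h; rewrite mem_sort mem_enum.
by rewrite !setTI !e.
Qed.

(** Cylinders with finitely many times form a pi-system that generates the path sigma-algebra, and
    the image measures agree on them. *)
Lemma process_law_unique : same_law P1 X1 P2 X2.
Proof.
pose gens := [set B : set (R -> state R) | exists (t : R) (A : set (state R)),
   [/\ 0 <= t, measurable A & B = [set w | A (w t)]]].
pose T := g_sigma_algebraType gens.
pose cyls := [set B : set T | exists n (r : 'I_n -> R) (A : 'I_n -> set (state R)),
   [/\ (forall i, 0 <= r i), (forall i, measurable (A i)) &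
     B = [set w | forall i, A i (w (r i))]]].
have mpath d (Om : measurableType d) (X : R -> {mfun Om >-> state R}) :
    measurable_fun setT ((fun o => (fun t => X t o) : T) : Om -> T).
  apply: (@measurability _ _ Om T setT _ gens (erefl _)).
  move=> _ [_ [t [A [t0 mA ->]]] <-]; rewrite setTI.
  change (measurable (X t @^-1` A)).
  by apply: measurable_preimageT => //; exact: measurable_process.
have cyls_gen : @measurable _ T = <<s cyls >>.
  apply/seteqP; split => B.
    apply: smallest_sub; first exact: smallest_sigma_algebra.
    move=> _ [t [A [t0 mA ->]]]; apply: sub_sigma_algebra.
    exists 1%N, (fun=> t), (fun=> A); split => //.
    by apply/seteqP; split => w /= h; [move=> _|exact: (h ord0)].
  apply: smallest_sub; first exact: smallest_sigma_algebra.
  move=> _ [n [r [A [r0 mA ->]]]].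
  have -> : [set w : T | forall i, A i (w (r i))] =
      \bigcap_(i in [set: 'I_n]) [set w : T | A i (w (r i))].
    by apply/seteqP; split => w /= h i; [move=> _; exact: h|exact: (h i Logic.I)].
  apply: (@fin_bigcap_measurable _ T) => // i _; apply: sub_sigma_algebra.
  by exists (r i), (A i).
have cylsI : setI_closed cyls.
  move=> C1 C2 [n1 [r1 [A1 [h1 m1 ->]]]] [n2 [r2 [A2 [h2 m2 ->]]]].
  exists (n1 + n2)%N, (fun i => match fintype.split i with inl i => r1 i | inr i => r2 i end),
    (fun i => match fintype.split i with inl i => A1 i | inr i => A2 i end); split.
  - by move=> i; case: fintype.split.
  - by move=> i; case: fintype.split.
  - apply/seteqP; split => w /=.
      by move=> [g1 g2] i; case: fintype.split.
    move=> h; split => i.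
      by have := h (unsplit (inl i)); rewrite unsplitK.
    by have := h (unsplit (inr i)); rewrite unsplitK.
have cylsT : cyls setT.
  exists 0%N, (fun=> 0), (fun=> setT); split => //; try by case.
  by apply/seteqP; split => w // _ [].
pose h1 : {mfun Om1 >-> T} :=
  MeasurableFun.Pack (MeasurableFun.Class (isMeasurableFun.Build _ _ _ _ _ (mpath _ _ X1))).
pose h2 : {mfun Om2 >-> T} :=
  MeasurableFun.Pack (MeasurableFun.Class (isMeasurableFun.Build _ _ _ _ _ (mpath _ _ X2))).
have K (m1 m2 : {measure set T -> \bar R}) :
    (forall A, m1 A = P1 (h1 @^-1` A)) -> (forall A, m2 A = P2 (h2 @^-1` A)) ->
    forall A, measurable A -> m1 A = m2 A.
  move=> m1E m2E; apply: (measure_unique cyls (fun=> setT)) => //.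
  - by rewrite bigcup_const//; exists 0%N.
  - by move=> _ [n [r [A [r0 mA ->]]]]; rewrite m1E m2E; exact: cylinder_law.
  - by move=> _; rewrite m1E preimage_setT probability_setT ltry.
move=> B pB; exact: (K (pushforward P1 h1) (pushforward P2 h2) (fun=> erefl) (fun=> erefl) B pB).
Qed.

End uniqueness.

Section solutions.
Variable R : realType.
Variables (lamp lamm : R -> state R -> state R -> R).
Hypotheses (hp : rate_function lamp) (hm : rate_function lamm).

Variable c : {posnum R}.
Hypothesis Hc : forall t X Y, 0 <= t -> lamp t X Y + lamm t X Y <= c%:num.

Lemma rates_jump_rates m : measurable_family m -> jump_rates c (rate lamp m) (rate lamm m).
Proof.
move=> mm; split.
- exact: measurable_lp.
- exact: measurable_lm.
- exact: rate_ge0'.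
- exact: rate_ge0'.
- exact: rates_le.
Qed.

Lemma solution_jump_process m mu0 d (Om : measurableType d) (P : probability Om R)
    (X : R -> {mfun Om >-> state R}) : measurable_family m ->
  solution P X lamp lamm m mu0 -> jump_process (rate lamp m) (rate lamm m) P X.
Proof.
move=> mm [adm _ mart].
have rc o r : 0 <= r -> X s o @[s --> r^'+] --> X r o.
  by move=> r0; have [[h _] _] := adm o; exact: h.
split => // g tg; apply/(martingale_dynkinP hp hm Hc mm P rc tg); exact: mart.
Qed.

Lemma solution_initial m mu0 d (Om : measurableType d) (P : probability Om R)
    (X : R -> {mfun Om >-> state R}) f : bmeas f ->
  solution P X lamp lamm m mu0 -> \int[P]_o f (X 0 o) = \int[mu0]_Y f Y.
Proof.
move=> bf [_ init _].
have mX0 := measurable_process X 0.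
apply: (E_law mX0 (@measurable_id _ _ setT) bf) => A mA; exact: init.
Qed.

Lemma solution_unique m mu0 : measurable_family m ->
  forall (d1 : measure_display) (Om1 : measurableType d1)
      (P1 : probability Om1 R) (X1 : R -> {mfun Om1 >-> state R})
      (d2 : measure_display) (Om2 : measurableType d2)
      (P2 : probability Om2 R) (X2 : R -> {mfun Om2 >-> state R}),
    solution P1 X1 lamp lamm m mu0 -> solution P2 X2 lamp lamm m mu0 ->
    same_law P1 X1 P2 X2.
Proof.
move=> mm d1 Om1 P1 X1 d2 Om2 P2 X2 S1 S2.
apply: (process_law_unique (rates_jump_rates mm) (solution_jump_process mm S1)
  (solution_jump_process mm S2)) => f bf.
by rewrite (solution_initial bf S1) (solution_initial bf S2).
Qed.

End solutions.

(** * The fixed point *)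

Section uniform_limit.
Context d (T : measurableType d) (R : realType).
Variables (m : nat -> probability T R) (e : nat -> R).
Hypothesis e_cvg : e n @[n --> \oo] --> (0 : R).
Hypothesis m_cauchy : forall n k A, measurable A ->
  `|fine (m n A) - fine (m (n + k)%N A)| <= e n.

Let a n A : R := fine (m n A).

Let e0 n : 0 <= e n.
Proof. by have := @m_cauchy n 0 setT measurableT; apply: le_trans. Qed.

Let small (x k : R) : (forall n, `|x| <= k * e n) -> x = 0.
Proof.
move=> h; apply/eqP; rewrite -normr_le0.
have c : k * e n @[n --> \oo] --> k * 0 by apply: cvgM => //; exact: cvg_cst.
rewrite -[leRHS](mulr0 k) -(cvg_lim (@Rhausdorff R) c); apply: limr_ge.
  by apply/cvg_ex; eexists; exact: c.
by apply: nearW => n; exact: h.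
Qed.

(** An explicit formula for the limit that is non-negative on all sets, measurable or not, as a
    measure structure demands. On measurable sets the Cauchy bound keeps every [a n A] within [e n]
    of it. *)
Let v A : R := inf [set a n A + e n | n in setT].

Let a0 n A : 0 <= a n A. Proof. by apply: fine_ge0; exact: measure_ge0. Qed.

Let v0 A : 0 <= v A.
Proof.
apply: lb_le_inf; first by exists (a 0 A + e 0), 0%N.
by move=> _ [n _ <-]; rewrite addr_ge0.
Qed.

Let v_close n A : measurable A -> `|a n A - v A| <= e n.
Proof.
move=> mA; rewrite distrC ler_distl; apply/andP; split.
  apply: lb_le_inf; first by exists (a 0 A + e 0), 0%N.
  move=> _ [k _ <-]; have [nk|/ltnW kn] := leqP n k.
    have := m_cauchy n (k - n) mA; rewrite subnKC// -/(a n A) -/(a k A) ler_distl.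
    by move=> /andP[_ h]; have := e0 k; lra.
  have := m_cauchy k (n - k) mA; rewrite subnKC// -/(a n A) -/(a k A) ler_distl.
  by move=> /andP[h _]; have := e0 n; lra.
apply: ge_inf; last by exists n.
by exists 0 => _ [k _ <-]; rewrite addr_ge0.
Qed.

Let aE n A : measurable A -> a n A = \int[m n]_x \1_A x.
Proof. by move=> mA; rewrite E_indic. Qed.

Let v_set0 : v set0 = 0.
Proof.
apply: (@small _ 1) => n; have := v_close n (@measurable0 _ T).
by rewrite /a measure0 sub0r normrN mul1r.
Qed.

Let vU A B : measurable A -> measurable B -> A `&` B = set0 -> v (A `|` B) = v A + v B.
Proof.
move=> mA mB AB; apply/eqP; rewrite -subr_eq0; apply/eqP; apply: (@small _ 3) => n.
have h1 := v_close n mA; have h2 := v_close n mB; have h3 := v_close n (measurableU _ _ mA mB).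
have eU : a n (A `|` B) = a n A + a n B.
  by rewrite /a measureU// fineD// fin_num_measure.
move: h1 h2 h3; rewrite eU !ler_distl => /andP[? ?] /andP[? ?] /andP[? ?].
apply/andP; split; lra.
Qed.

Let mu A : \bar R := (v A)%:E.

Let mu_0 : mu set0 = 0%E. Proof. by rewrite /mu v_set0. Qed.
Let mu_ge0 A : (0 <= mu A)%E. Proof. by rewrite lee_fin. Qed.

(** Convergence is uniform over measurable sets, so limits may be exchanged: [n] is fixed with
    [e n <= eps / 3], and sigma-additivity of [m n] handles the partial unions. *)
Let mu_sigma_additive : semi_sigma_additive mu.
Proof.
move=> F mF tF mUF.
pose Un n := \bigcup_(k < n) F k.
have mU n : measurable (Un n) by apply: bigcup_measurable => k _.
have UnS n : Un n.+1 = Un n `|` F n.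
  apply/seteqP; split => x.
    move=> [k /= kn Fk]; move: kn; rewrite ltnS leq_eqVlt => /predU1P[<-|kn]; first by right.
    by left; exists k.
  by move=> [[k /= kn Fk]|Fn]; [exists k => //=; exact: ltnW|exists n => /=].
have Ud n : Un n `&` F n = set0.
  apply/seteqP; split => // x [[k /= kn Fk] Fn].
  by have : k = n by [apply: tF => //; exists x]; move=> e1; rewrite e1 ltnn in kn.
have eU n : \sum_(0 <= i < n) v (F i) = v (Un n).
  elim: n => [|n IH].
    by rewrite big_geq// /Un bigcup_mkord big_ord0 v_set0.
  by rewrite big_nat_recr//= IH UnS vU.
have -> : (fun n => (\sum_(0 <= i < n) mu (F i))%E) = (fun n => (v (Un n))%:E).
  by apply/funext => n; rewrite /mu sumEFin eU.
apply: cvg_EFin; first exact: nearW.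
apply/cvgrPdist_le => eps eps0.
have [n en] : exists n, e n <= eps / 3.
  have /cvgrPdist_le/(_ (eps / 3)) := e_cvg.
  rewrite divr_gt0// => /(_ isT) [N _ HN]; exists N.
  by have := HN N (leqnn N); rewrite /= sub0r normrN ger0_norm.
have cU : a n (Un N) @[N --> \oo] --> a n (\bigcup_k F k).
  rewrite aE//; under eq_fun do rewrite aE//.
  apply: (@bounded_cvg_E _ _ _ _ _ _ 1).
  - by move=> N; exact: measurable_indic.
  - by move=> N x; rewrite indicE; case: (_ \in _); rewrite /= ?normr1 ?normr0.
  move=> x; have [/set_mem[k _ Fk]|no] := boolP (x \in \bigcup_k F k).
    apply: cvg_near_cst; exists k.+1 => // N /= kN.
    by rewrite !indicE !mem_set//; [exists k|exists k].
  apply: cvg_near_cst; apply: nearW => N; rewrite !indicE (negbTE no).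
  rewrite memNset// => -[k _ Fk]; move/negP : no; apply; apply/mem_set.
  by exists k.
have /cvgrPdist_le/(_ (eps / 3)) := cU.
rewrite divr_gt0// => /(_ isT); apply: filterS => N hN.
have h1 := v_close n (mU N); have h2 := v_close n mUF.
move: hN h1 h2; rewrite !ler_distl => /andP[? ?] /andP[? ?] /andP[? ?].
apply/andP; split; lra.
Qed.

HB.instance Definition _ := isMeasure.Build _ T R mu mu_0 mu_ge0 mu_sigma_additive.

Let mu_T : mu setT = 1%E.
Proof.
rewrite /mu; congr EFin; apply/eqP; rewrite -subr_eq0; apply/eqP; apply: (@small _ 1) => n.
have := v_close n (@measurableT _ T).
by rewrite /a probability_setT/= distrC mul1r.
Qed.

HB.instance Definition _ := Measure_isProbability.Build _ _ R mu mu_T.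

Lemma uniform_limit : exists mu : probability T R,
  forall n A, measurable A -> `|fine (m n A) - fine (mu A)| <= e n.
Proof. by exists mu => n A mA; exact: v_close. Qed.

End uniform_limit.

(** Layer cake: the integral of a function [h] with values in [[0, 1]] is the mean over a uniform
    [u] of the measure of the set where [u < h]. The factor [2] comes from [f = 2 h - 1]. *)
Lemma E_close_of_sets d (T : measurableType d) (R : realType)
    (m1 m2 : probability T R) (e : R) :
  (forall A, measurable A -> `|fine (m1 A) - fine (m2 A)| <= e) ->
  forall f, bmeas f -> (forall x, `|f x| <= 1) ->
  `|\int[m1]_x f x - \int[m2]_x f x| <= 2 * e.
Proof.
move=> H f bf f1.
pose h x := 2^-1 * (f x + 1).
have h01 x : 0 <= h x <= 1.
  by have := f1 x; rewrite ler_norml /h => /andP[? ?]; apply/andP; split; lra.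
have bh : bmeas h.
  by apply: bmeasM; [exact: bmeas_cst|apply: bmeasD => //; exact: bmeas_cst].
have b2 : bmeas (fun z : R * T => (z.1 < h z.2)%R%:R : R).
  split; last by exists 1 => z; case: (_ < _); rewrite ?normr1 ?normr0.
  have -> : (fun z : R * T => (z.1 < h z.2)%R%:R : R) = (fun z => if z.1 < h z.2 then 1 else 0).
    by apply/funext => z; case: (_ < _).
  apply: measurable_fun_ifT; [|exact: measurable_cst..].
  apply: measurable_fun_ltr => //.
  by have [mh _] := bh; exact: measurableT_comp mh measurable_snd.
have mh u : measurable [set x | u < h x].
  have -> : [set x | u < h x] = h @^-1` `]u, +oo[%classic.
    by apply/seteqP; split => x /=; rewrite in_itv/= andbT.
  by have [mh' _] := bh; apply: measurable_preimageT => //; exact: measurable_itv.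
have lay (m : probability T R) : \int[m]_x h x = \int[@unif R]_u fine (m [set x | u < h x]).
  transitivity (\int[m]_x \int[@unif R]_u ((u < h x)%R%:R : R)).
    by apply: eq_Rintegral => x _; rewrite E_unif_lt.
  rewrite -(E_fubini (@unif R) m b2); apply: eq_Rintegral => u _ /=.
  rewrite -E_indic//; apply: eq_Rintegral => x _; rewrite indicE; congr (nat_of_bool _)%:R.
  by apply/idP/idP; rewrite inE.
have bl (m : probability T R) : bmeas (fun u : R => fine (m [set x | u < h x])).
  have := bmeas_E2 (@unif R) m b2; congr bmeas; apply/funext => u /=.
  rewrite -E_indic//; apply: eq_Rintegral => x _; rewrite indicE; congr (nat_of_bool _)%:R.
  by apply/idP/idP; rewrite inE.
have key : `|\int[m1]_x h x - \int[m2]_x h x| <= e.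
  rewrite !lay -EB// -[leRHS](E_cst (@unif R)); apply: norm_E_le.
  - exact: bmeasB.
  - exact: bmeas_cst.
  - by move=> u; exact: H.
have fE (m : probability T R) : \int[m]_x f x = 2 * \int[m]_x h x - 1.
  rewrite -EZ// -[X in _ - X](E_cst m) -EB; [|by apply: bmeasM => //; exact: bmeas_cst|exact: bmeas_cst].
  by apply: eq_Rintegral => x _; rewrite /h; field.
rewrite !fE opprB addrA subrK -mulrBr normrM ger0_norm//.
exact: ler_wpM2l.
Qed.

Section laws.
Context (R : realType) d (Om : measurableType d) (P : probability Om R).
Variable X : R -> {mfun Om >-> state R}.

Lemma E_distribution t f : bmeas f ->
  \int[distribution P (X t)]_Y f Y = \int[P]_o f (X t o).
Proof.
by move=> bf; apply: (@E_law _ _ _ _ _ _ _ (distribution P (X t)) P id (X t) f).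
Qed.

(** Right continuity gives joint measurability on each [[0, n]], hence measurability in time of the
    one-dimensional laws by Fubini; the intervals exhaust the half-line. *)
Lemma process_law_family : admissible_process X ->
  measurable_family (fun t => distribution P (X t)).
Proof.
move=> adm A mA.
have bA := bmeas_indic R mA.
have rc o r : 0 <= r -> X s o @[s --> r^'+] --> X r o.
  by move=> r0; have [[h _] _] := adm o; exact: h.
pose F n r := \int[P]_o (\1_A (X (clip n%:R r) o) : R).
have bF n : bmeas (F n).
  have mj := joint_measurable_process (X := fun r => X r : Om -> state R) (ler0n R n)
    (fun r _ _ => measurable_process X r) (fun o r r0 _ => rc o r r0).
  exact: (bmeas_E2 (dirac point : probability R R) P (f := fun z => \1_A (X (clip n%:R z.1) z.2)) (bmeas_comp mj bA)).
pose E n := [set r : R | Num.max 0 r <= n%:R].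
have mE n : measurable (E n).
  have -> : E n = (fun r => Num.max 0 r) @^-1` `]-oo, n%:R]%classic.
    by apply/seteqP; split => r /=; rewrite in_itv.
  by apply: measurable_preimageT; [exact: measurable_max0|exact: measurable_itv].
rewrite (_ : setT = \bigcup_n E n); last first.
  apply/seteqP; split => r // _; exists (Num.truncn (Num.max 0 r)).+1 => //=.
  by have /andP[_ h] := truncn_itv (max0_ge0 r); exact: ltW.
apply/(measurable_fun_bigcup _ mE) => n.
have ph : {in E n, (fun r => (F n r)%:E) =1 (fun r => distribution P (X (Num.max 0 r)) A)}.
  move=> r; rewrite inE /E /= => rn.
  have -> : F n r = \int[distribution P (X (Num.max 0 r))]_Y \1_A Y.
    by rewrite E_distribution// /F /clip min_r.
  by rewrite E_indic// fineK// fin_num_measure.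
apply: (eq_measurable_fun _ ph); apply: measurable_funTS.
by apply/measurable_EFinP; have [] := bF n.
Qed.

End laws.

Section fixed_point.
Variable R : realType.
Variables (lamp lamm : R -> state R -> state R -> R).
Hypotheses (hp : rate_function lamp) (hm : rate_function lamm).

Lemma rate_diff lam (c : {posnum R}) (m m' : R -> probability (state R) R) (D : R) r X : rate_function lam ->
  (forall t X Y, 0 <= t -> lam t X Y <= c%:num) -> 0 <= r ->
  (forall f, bmeas f -> (forall Y, `|f Y| <= 1) ->
    `|\int[m r]_Y f Y - \int[m' r]_Y f Y| <= D) ->
  `|rate lam m r X - rate lam m' r X| <= c%:num * D.
Proof.
move=> hl lc r0 H; rewrite /rate /Lambda max_r//.
have c0 : 0 < c%:num by [].
pose f Y := c%:num^-1 * lam r X Y.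
have bl := bmeas_lam hl X r0.
have bf : bmeas f by apply: bmeasM => //; exact: bmeas_cst.
have e (mu : probability (state R) R) : \int[mu]_Y lam r X Y = c%:num * \int[mu]_Y f Y.
  by rewrite -EZ//; apply: eq_Rintegral => Y _; rewrite /f mulrA divff ?mul1r ?gt_eqF.
rewrite !e -mulrBr normrM gtr0_norm// ler_wpM2l//; apply: H => // Y.
have l0 := rate_ge0 hl X Y r0.
by rewrite /f ger0_norm ?mulr_ge0 ?invr_ge0// mulrC ler_pdivrMr// mul1r; exact: lc.
Qed.

Variable c : {posnum R}.
Hypothesis Hc : forall t X Y, 0 <= t -> lamp t X Y + lamm t X Y <= c%:num.

Let lpc t X Y : 0 <= t -> lamp t X Y <= c%:num.
Proof.
move=> t0; apply: le_trans (Hc X Y t0); rewrite lerDl; exact: (rate_ge0 hm).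
Qed.

Let lmc t X Y : 0 <= t -> lamm t X Y <= c%:num.
Proof.
move=> t0; apply: le_trans (Hc X Y t0); rewrite lerDr; exact: (rate_ge0 hp).
Qed.

Variable K : R.
Hypotheses (K0 : 0 <= K)
  (Ksmall : \int[expl c]_t expR (- (K * Num.max 0 t)) <= 16^-1).

(** Flows of laws at distance [D] give rates that differ by at most [c D] each, so [A = 2 c D] and
    the constant is [4 kap D / (1 - kap)]. It is at most [D / 2] as soon as [kap <= 1/9], hence for
    [1/16]. *)
Lemma contraction_constant (kap D w : R) : 0 <= kap -> kap <= 16^-1 -> 0 <= D -> 0 <= w ->
  kap * (c%:num^-1 * (2 * (2 * c%:num * D))) / (1 - kap) * w <= D / 2 * w.
Proof.
move=> k0 k1 D0 w0; apply: ler_wpM2r => //.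
have k2 : 0 < 1 - kap by lra.
rewrite ler_pdivrMr//.
have -> : kap * (c%:num^-1 * (2 * (2 * c%:num * D))) = 4 * kap * D.
  by field; rewrite gt_eqF.
have -> : D / 2 * (1 - kap) = (1 - kap) / 2 * D by ring.
by apply: ler_wpM2r => //; lra.
Qed.

Lemma law_contraction (m m' : R -> probability (state R) R) mu0 D
    d (Om : measurableType d) (P : probability Om R) (X : R -> {mfun Om >-> state R})
    d' (Om' : measurableType d') (P' : probability Om' R) (X' : R -> {mfun Om' >-> state R}) :
  measurable_family m -> measurable_family m' -> 0 <= D ->
  solution P X lamp lamm m mu0 -> solution P' X' lamp lamm m' mu0 ->
  (forall r f, 0 <= r -> bmeas f -> (forall Y, `|f Y| <= 1) ->
    `|\int[m r]_Y f Y - \int[m' r]_Y f Y| <= D * expR (K * r)) ->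
  forall r f, 0 <= r -> bmeas f -> (forall Y, `|f Y| <= 1) ->
    `|\int[P]_o f (X r o) - \int[P']_o f (X' r o)| <= D / 2 * expR (K * r).
Proof.
move=> mm mm' D0 S S' H r f r0 bf f1.
have eT d0 (Om0 : measurableType d0) (P0 : probability Om0 R) (h : Om0 -> R) :
    \int[P0]_o (\1_setT o * h o) = \int[P0]_o h o.
  by apply: eq_Rintegral => o _; rewrite indicT mul1r.
have init f0 : bmeas f0 -> \int[P]_o (\1_setT o * f0 (X 0 o)) = \int[P']_o (\1_setT o * f0 (X' 0 o)).
  by move=> b0; rewrite !eT (solution_initial b0 S) (solution_initial b0 S').
have close r0' X0 : 0 <= r0' -> `|rate lamp m r0' X0 - rate lamp m' r0' X0| +
    `|rate lamm m r0' X0 - rate lamm m' r0' X0| <= 2 * c%:num * D * expR (K * (r0' - 0)).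
  move=> r00; rewrite subr0.
  have -> : 2 * c%:num * D * expR (K * r0') = c%:num * (D * expR (K * r0')) + c%:num * (D * expR (K * r0')) by ring.
  by apply: lerD; apply: rate_diff => // f0 b0 f01; exact: H.
have kap0 : 0 <= \int[expl c]_t expR (- (K * Num.max 0 t)).
  by apply: Rintegral_ge0 => x _; exact: expR_ge0.
have A0 : 0 <= 2 * c%:num * D by rewrite !mulr_ge0.
have k1 : \int[expl c]_t expR (- (K * Num.max 0 t)) < 1.
  by apply: le_lt_trans Ksmall _; rewrite invf_lt1// ltr1n.
have := process_comparison (rates_jump_rates hp hm Hc mm) (rates_jump_rates hp hm Hc mm')
  (solution_jump_process hp hm Hc mm S) (solution_jump_process hp hm Hc mm' S') (lexx 0)
  (@natural_filtrationT _ _ _ X 0) (@natural_filtrationT _ _ _ X' 0) init K0 A0 close k1 r0 bf f1.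
rewrite !eT subr0 => h; apply: le_trans h _.
by apply: contraction_constant => //; exact: expR_ge0.
Qed.

End fixed_point.

(** * Picard iteration on flows of laws *)

Section picard.
Variable R : realType.
Variables (lamp lamm : R -> state R -> state R -> R).
Hypotheses (hp : rate_function lamp) (hm : rate_function lamm).
Variable mu0 : probability (state R) R.

(** A relation, since solutions are only known to exist; it retains the process itself, whose Markov
    property and path structure are wanted at the fixed point. *)
Definition law_of (m m' : R -> probability (state R) R) : Prop :=
  exists (d : measure_display) (Om : measurableType d)
    (P : probability Om R) (X : R -> {mfun Om >-> state R}),
  [/\ solution P X lamp lamm m mu0, markov_process P X,
      (forall o : Om, piecewise_linear (fun t => X t o)) &
      m' = (fun t => distribution P (X t))].

Lemma law_of_exists m : measurable_family m ->
  exists2 m', measurable_family m' & law_of m m'.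
Proof.
move=> mm; have [d [Om [P [X [S M L]]]]] := solution_exists mu0 hp hm mm.
exists (fun t => distribution P (X t)); last by exists d, Om, P, X.
by apply: process_law_family; have [] := S.
Qed.

(** The rates see [m] only through integrals at truncated times. The fixed point is an equality on
    measurable sets at non-negative times, and this lemma makes that sufficient. *)
Lemma solution_congr (m m' : R -> probability (state R) R) d (Om : measurableType d) (P : probability Om R)
    (X : R -> {mfun Om >-> state R}) :
  measurable_family m -> measurable_family m' ->
  (forall r A, 0 <= r -> measurable A -> m r A = m' r A) ->
  solution P X lamp lamm m mu0 -> solution P X lamp lamm m' mu0.
Proof.
move=> mm mm' e S; have [adm init mart] := S.
have [c Hc] := rate_bound_ex hp hm.
have er lam : rate lam m = rate lam m'.
  apply/funext => r; apply/funext => Y; rewrite /rate /Lambda.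
  by apply: eq_measure_E => A mA; apply: e => //; exact: max0_ge0.
have [rc H] := solution_jump_process hp hm Hc mm S.
split; [exact: adm|exact: init|].
move=> g tg; apply/(martingale_dynkinP hp hm Hc mm' P rc tg).
by rewrite -!er; exact: H.
Qed.

Lemma mean_field_exists : exists2 m, measurable_family m & exists2 m', law_of m m' &
  forall r A, 0 <= r -> measurable A -> m r A = m' r A.
Proof.
have [c Hc] := rate_bound_ex hp hm.
have [K K0 Ksmall] : exists2 K : R, 0 <= K & \int[expl c]_t expR (- (K * Num.max 0 t)) <= 16^-1.
  by apply: expl_laplace_small; rewrite invr_gt0.
(* Choice turns the relation into a map on measurable flows, which can be iterated. *)
have [step Hstep] : {step : {m | measurable_family m} -> {m | measurable_family m} &
    forall m, law_of (sval m) (sval (step m))}.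
  apply: (@choice _ _ (fun m m' => law_of (sval m) (sval m'))) => -[m mm].
  by have [m' mm' h] := law_of_exists mm; exists (exist _ m' mm').
have m00 : measurable_family (fun _ : R => mu0) by move=> A mA; exact: measurable_cst.
pose ms n := sval (iter n step (exist _ _ m00)).
have mms n : measurable_family (ms n) by exact: (svalP (iter n step (exist _ _ m00))).
have law_ms n : law_of (ms n) (ms n.+1) by exact: Hstep.
have w0 r : 0 <= expR (K * r) :> R by exact: expR_ge0.
have q0 n : 0 <= 2^-1 ^+ n :> R by rewrite exprn_ge0// invr_ge0.
have contr m1 m2 m1' m2' D : measurable_family m1 -> measurable_family m2 -> 0 <= D ->
    law_of m1 m1' -> law_of m2 m2' ->
    (forall r f, 0 <= r -> bmeas f -> (forall Y, `|f Y| <= 1) ->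
      `|\int[m1 r]_Y f Y - \int[m2 r]_Y f Y| <= D * expR (K * r)) ->
    (forall r f, 0 <= r -> bmeas f -> (forall Y, `|f Y| <= 1) ->
      `|\int[m1' r]_Y f Y - \int[m2' r]_Y f Y| <= D / 2 * expR (K * r)).
  move=> mm1 mm2 D0 [d1 [Om1 [P1 [X1 [S1 _ _ ->]]]]] [d2 [Om2 [P2 [X2 [S2 _ _ ->]]]]] H r f r0 bf f1.
  rewrite !E_distribution//.
  exact: (law_contraction hp hm Hc K0 Ksmall mm1 mm2 D0 S1 S2 H).
(* Two probability laws differ by at most [2] on functions bounded by [1], and each step halves the
   weighted distance. *)
have close n r f : 0 <= r -> bmeas f -> (forall Y, `|f Y| <= 1) ->
    `|\int[ms n r]_Y f Y - \int[ms n.+1 r]_Y f Y| <= 2 * 2^-1 ^+ n * expR (K * r).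
  elim: n r f => [|n IH] r f r0 bf f1.
    have h (m : probability (state R) R) : `|\int[m]_Y f Y| <= 1.
      rewrite -[leRHS](E_cst m); apply: norm_E_le => //; exact: bmeas_cst.
    have e1 : 1 <= expR (K * r) by rewrite -expR0 ler_expR mulr_ge0.
    apply: le_trans (ler_normB _ _) _; rewrite expr0 mulr1.
    have := h (ms 0 r); have := h (ms 1 r); lra.
  have -> : 2 * 2^-1 ^+ n.+1 * expR (K * r) = (2 * 2^-1 ^+ n) / 2 * expR (K * r) by rewrite exprSr; ring.
  by apply: (contr (ms n) (ms n.+1)) => //; rewrite mulr_ge0.
(* The geometric series with terms [2 * 2 ^ -n] has the tail [4 * 2 ^ -n]. *)
have cauchy r : 0 <= r -> forall n k A, measurable A ->
    `|fine (ms n r A) - fine (ms (n + k)%N r A)| <= 4 * 2^-1 ^+ n * expR (K * r).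
  move=> r0 n k A mA; have bA := bmeas_indic R mA.
  have s1 j : `|fine (ms j r A) - fine (ms j.+1 r A)| <= 2 * 2^-1 ^+ j * expR (K * r).
    rewrite -!E_indic//; apply: close => // Y.
    by rewrite indicE; case: (_ \in _); rewrite /= ?normr1 ?normr0.
  suff h : `|fine (ms n r A) - fine (ms (n + k)%N r A)| <=
      (4 * 2^-1 ^+ n - 4 * 2^-1 ^+ (n + k)) * expR (K * r).
    apply: le_trans h _; apply: ler_wpM2r => //; rewrite gerBl mulr_ge0//; exact: q0.
  elim: k => [|k IH]; first by rewrite addn0 !subrr mul0r normr0.
  rewrite addnS; apply: le_trans (ler_distD (fine (ms (n + k)%N r A)) _ _) _.
  apply: le_trans (lerD IH (s1 (n + k)%N)) _.
  by rewrite -mulrDl; apply: ler_wpM2r => //; rewrite exprSr; have := q0 (n + k)%N; lra.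
have cq (k : R) : k * 2^-1 ^+ n @[n --> \oo] --> 0.
  rewrite -[X in _ --> X](mulr0 k); apply: cvgM; first exact: cvg_cst.
  by apply: cvg_expr; rewrite ger0_norm ?invr_ge0// invf_lt1// ltr1n.
have [mu Hmu] : {mu : R -> probability (state R) R & forall r n A, measurable A ->
    `|fine (ms n (Num.max 0 r) A) - fine (mu r A)| <= 4 * 2^-1 ^+ n * expR (K * Num.max 0 r)}.
  apply: (@choice _ _ (fun r (mu : probability (state R) R) => forall n A, measurable A ->
    `|fine (ms n (Num.max 0 r) A) - fine (mu A)| <= 4 * 2^-1 ^+ n * expR (K * Num.max 0 r))) => r.
  apply: uniform_limit; last exact: (cauchy _ (max0_ge0 r)).
  have := cq (4 * expR (K * Num.max 0 r)).
  by apply: cvg_trans; apply: near_eq_cvg; apply: nearW => n; rewrite mulrAC.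
have mmu : measurable_family mu.
  move=> A mA.
  have mf : measurable_fun setT (fun r : R => fine (mu (Num.max 0 r) A)).
    pose h n (r : R) := fine (ms n (Num.max 0 r) A).
    have mh n : measurable_fun setT (h n).
      exact: (measurableT_comp (fine_measurable measurableT) (mms n A mA)).
    have hcv r : setT r -> h n r @[n --> \oo] --> fine (mu (Num.max 0 r) A).
      move=> _; apply/cvgrPdist_le => eps eps0.
      have /cvgrPdist_le/(_ eps eps0) := cq (4 * expR (K * Num.max 0 r)).
      apply: filterS => n; rewrite sub0r normrN => hn; rewrite distrC.
      have mx : Num.max 0 (Num.max 0 r) = Num.max 0 r by rewrite maxA maxxx.
      have := Hmu (Num.max 0 r) n A mA; rewrite mx => hb; apply: le_trans hb _.
      by apply: le_trans hn; rewrite mulrAC; exact: ler_norm.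
    exact: (measurable_fun_cvg mh hcv).
  have -> : (fun r : R => mu (Num.max 0 r) A) = EFin \o (fun r : R => fine (mu (Num.max 0 r) A)).
    by apply/funext => r; rewrite /= fineK// fin_num_measure.
  exact/measurable_EFinP.
have [nu mnu Hnu] := law_of_exists mmu.
exists mu => //; exists nu => // r A r0 mA.
have f1 Y : `|\1_A Y| <= 1 :> R.
  by rewrite indicE; case: (_ \in _); rewrite /= ?normr1 ?normr0.
have bA := bmeas_indic R mA.
(* Passing from sets to bounded functions doubles the constant [4], by [E_close_of_sets]. *)
have cl n : forall r f, 0 <= r -> bmeas f -> (forall Y, `|f Y| <= 1) ->
    `|\int[ms n r]_Y f Y - \int[mu r]_Y f Y| <= 8 * 2^-1 ^+ n * expR (K * r).
  move=> r' f r'0 bf hf.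
  have -> : 8 * 2^-1 ^+ n * expR (K * r') = 2 * (4 * 2^-1 ^+ n * expR (K * r')) by ring.
  apply: E_close_of_sets => // B mB.
  by have := Hmu r' n B mB; rewrite max_r.
(* Both [mu] and its image [nu] are within [4 * 2 ^ -n * exp (K r)] of the iterate [ms n.+1]: the
   first by [cl n.+1], the second by contracting the bound [cl n]. *)
have bound n : `|fine (mu r A) - fine (nu r A)| <= 8 * expR (K * r) * 2^-1 ^+ n.
  rewrite -!E_indic//.
  have h1 := cl n.+1 r _ r0 bA f1.
  have h2 := contr (ms n) mu (ms n.+1) nu (8 * 2^-1 ^+ n) (mms n) mmu
    (mulr_ge0 (ler0n R 8) (q0 n)) (law_ms n) Hnu (cl n) r _ r0 bA f1.
  apply: le_trans (ler_distD (\int[ms n.+1 r]_Y \1_A Y) _ _) _.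
  rewrite distrC; apply: le_trans (lerD h1 h2) _.
  by rewrite exprSr le_eqVlt; apply/orP; left; apply/eqP; field.
have z : fine (mu r A) - fine (nu r A) = 0.
  apply/eqP; rewrite -normr_le0.
  have cv := cq (8 * expR (K * r)).
  rewrite -(cvg_lim (@Rhausdorff R) cv); apply: limr_ge.
    by apply/cvg_ex; eexists; exact: cv.
  by apply: nearW => n; exact: bound.
move/eqP : z; rewrite subr_eq0 => /eqP z.
by rewrite -[LHS]fineK ?fin_num_measure// z fineK// fin_num_measure.
Qed.

End picard.

Unset Implicit Arguments.

Theorem theorem1 (R : realType) (lamp lamm : R -> state R -> state R -> R)
    (hlamp : rate_function lamp) (hlamm : rate_function lamm) :
  (forall mu0 : probability (state R) R,
    exists (d : measure_display) (Om : measurableType d)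
      (P : probability Om R) (X : R -> {mfun Om >-> state R}),
      [/\ solution P X lamp lamm (fun t => distribution P (X t)) mu0,
          markov_process P X &
          forall o : Om, piecewise_linear (fun t => X t o)])
  /\
  (forall (m : R -> pprobability (state R) R),
    measurable_fun [set s : R | 0 <= s] m ->
    forall mu0 : probability (state R) R,
      (exists (d : measure_display) (Om : measurableType d)
        (P : probability Om R) (X : R -> {mfun Om >-> state R}),
        solution P X lamp lamm m mu0)
      /\
      (forall (d1 : measure_display) (Om1 : measurableType d1)
          (P1 : probability Om1 R) (X1 : R -> {mfun Om1 >-> state R})
          (d2 : measure_display) (Om2 : measurableType d2)
          (P2 : probability Om2 R) (X2 : R -> {mfun Om2 >-> state R}),
        solution P1 X1 lamp lamm m mu0 ->
        solution P2 X2 lamp lamm m mu0 ->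
        same_law P1 X1 P2 X2)).
Proof.
split=> [mu0|m mm mu0].
  (* [X] solves the problem for the given flow [mu], and its own laws [nu] coincide with [mu] at
     non-negative times, so [solution_congr] may replace [mu] by them. *)
  have [mu mmu [nu [d [Om [P [X [S M L ->]]]]] e]] := mean_field_exists hlamp hlamm mu0.
  exists d, Om, P, X; split; [|exact: M|exact: L].
  have mnu : measurable_family (fun t => distribution P (X t)).
    by apply: process_law_family; have [] := S.
  exact: (solution_congr hlamp hlamm mmu mnu e S).
have fm := measurable_pprobability_family mm.
split.
  have [d [Om [P [X [S _ _]]]]] := solution_exists mu0 hlamp hlamm fm.
  by exists d, Om, P, X.
have [c Hc] := rate_bound_ex hlamp hlamm.
exact: (solution_unique hlamp hlamm Hc fm).
Qed.
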